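(* Let $G=(V_1,V_2,E)$, $\mathbf N$ be as in the context, with the nodes of $\mathbf N$ given an RGB coloring by three circularly contiguous sets $R,G,B$ such that $|R|,|G|,|B|$ satisfy the triangle inequality, and let $\sigma$ be the corresponding tripartite pairing of $\mathbf N$. Let $x,y,w,v$ be four distinct nodes appearing in this cyclic order such that $\{x,y,w,v\}$ contains at least one node of each RGB color. If $x,w\in V_1$ and $y,v\in V_2$, then $$Z^{DD}_{\sigma}(G,\mathbf N)\,Z^{DD}_{\sigma_{xywv}}(G,\mathbf N\setminus\{x,y,w,v\})=Z^{DD}_{\sigma_{xy}}(G,\mathbf N\setminus\{x,y\})\,Z^{DD}_{\sigma_{wv}}(G,\mathbf N\setminus\{w,v\})+Z^{DD}_{\sigma_{xv}}(G,\mathbf N\setminus\{x,v\})\,Z^{DD}_{\sigma_{wy}}(G,\mathbf N\setminus\{w,y\}),$$ where for a set $U\subseteq\{x,y,w,v\}$, $\sigma_U$ denotes the unique planar pairing of $\mathbf N\setminus U$ in which no two nodes of the same RGB color are paired (with the convention that a term is $0$ if the corresponding pairing does not exist).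
   Context: $G=(V_1,V_2,E)$ is a finite edge-weighted planar bipartite graph embedded in the plane; vertices of $V_1$ are called black and those of $V_2$ white. A set $\mathbf N$ of $2n$ vertices on the outer face, called nodes, is labeled $1,\dots,2n$ in counterclockwise order, and contains $n$ black and $n$ white nodes (node colors otherwise arbitrary). For $\mathbf N'\subseteq\mathbf N$, a double-dimer configuration on $(G,\mathbf N')$ is a multiset of edges of $G$ such that each vertex in $\mathbf N'$ is an endpoint of exactly one edge and every other vertex of $G$ (including nodes not in $\mathbf N'$) is an endpoint of exactly two edges; it consists of paths joining the vertices of $\mathbf N'$ in pairs, doubled edges, and cycles of length $>2$ (loops). Its weight is the product of its edge weights (with multiplicity) times $2^{\ell}$, $\ell$ the number of loops. For a pairing $\tau$ of $\mathbf N'$ (a partition of $\mathbf N'$ into 2-element blocks), $Z^{DD}_\tau(G,\mathbf N')$ is the total weight of double-dimer configurations on $(G,\mathbf N')$ whose paths join the nodes exactly according to $\tau$. Two pairs $\{a,c\},\{b,d\}$ cross if $a<b<c<d$; a pairing is planar if no two pairs cross. RGB coloring: the nodes are partitioned into three circularly contiguous (possibly empty) sets colored red, green, blue (independent of the black/white coloring); when $|R|,|G|,|B|$ satisfy the triangle inequality there is a unique planar pairing in which no pair has two nodes of the same RGB color, called the tripartite pairing; removing nodes keeps the induced RGB coloring on the remaining nodes. *)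

(* Defs.v *)
From HB Require Import structures.
From mathcomp Require Import all_boot all_order all_algebra.
Set Implicit Arguments. Unset Strict Implicit. Unset Printing Implicit Defensive.
Import Order.TTheory GRing.Theory Num.Theory.

Section DoubleDimer.
Variables (V1 V2 : finType).
Local Notation VT := (V1 + V2)%type.

Definition is_black (u : VT) : bool := if u is inl _ then true else false.

(* A multiset of edges with multiplicities 0,1,2 (higher multiplicities are
   excluded anyway by the degree constraints). *)
Local Notation mset := {ffun V1 * V2 -> 'I_3}.

Definition supp_adj (m : mset) : rel VT := fun u v =>
  match u, v with
  | inl b, inr w => (0 < m (b, w))%N
  | inr w, inl b => (0 < m (b, w))%N
  | _, _ => false
  end.

Definition mdeg (m : mset) (u : VT) : nat :=
  match u with
  | inl b => (\sum_(w : V2) (m (b, w) : nat))%N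
  | inr w => (\sum_(b : V1) (m (b, w) : nat))%N
  end.

Variable E : {set V1 * V2}.

Definition is_dd_config (Np : {set VT}) (m : mset) : bool :=
  [forall e, (0 < m e)%N ==> (e \in E)] &&
  [forall u, mdeg m u == (if u \in Np then 1 else 2)%N].

Definition dd_comps (m : mset) : {set {set VT}} :=
  [set [set u | connect (supp_adj m) v u] | v : VT].

(* loops = components avoiding N' that are cycles of length > 2
   (components avoiding N' are cycles or doubled edges) *)
Definition nloops (Np : {set VT}) (m : mset) : nat :=
  #|[set C in dd_comps m | [disjoint C & Np] && (2 < #|C|)%N]|.

(* nodes, labeled by 'I_N (label i stands for i+1 in the paper) *)
Variables (N : nat) (node : 'I_N -> VT).

Definition joins_by (S : {set 'I_N}) (tau : {set {set 'I_N}}) (m : mset) : bool :=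
  [forall i in S, forall j in S, (i != j) ==>
     (connect (supp_adj m) (node i) (node j) == ([set i; j] \in tau))].

Variables (R : comNzRingType) (wt : V1 * V2 -> R).

Definition config_weight (Np : {set VT}) (m : mset) : R :=
  ((\prod_(e : V1 * V2) wt e ^+ (m e)) * 2%:R ^+ nloops Np m)%R.

Definition ZDD (tau : {set {set 'I_N}}) (S : {set 'I_N}) : R :=
  (\sum_(m : mset | is_dd_config (node @: S) m && joins_by S tau m)
      config_weight (node @: S) m)%R.

Definition is_pairing (S : {set 'I_N}) (tau : {set {set 'I_N}}) : bool :=
  partition tau S && [forall B in tau, #|B| == 2%N].

Definition crossing (B1 B2 : {set 'I_N}) : bool :=
  [exists a : 'I_N, exists b : 'I_N, exists c : 'I_N, exists d : 'I_N,
     [&& B1 == [set a; c], B2 == [set b; d], (a < b)%N, (b < c)%N & (c < d)%N]].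

Definition planar_pairing (tau : {set {set 'I_N}}) : bool :=
  [forall B1 in tau, forall B2 in tau, ~~ crossing B1 B2].

Definition tripartite (col : 'I_N -> 'I_3) (S : {set 'I_N})
    (tau : {set {set 'I_N}}) : bool :=
  [&& is_pairing S tau, planar_pairing tau &
      [forall B in tau, forall i in B, forall j in B, (i != j) ==> (col i != col j)]].

(* Z^{DD}_{sigma_S}(G, S): sigma_S the (unique) tripartite pairing of S,
   and 0 if no such pairing exists *)
Definition Ztri (col : 'I_N -> 'I_3) (S : {set 'I_N}) : R :=
  if [pick tau | tripartite col S tau] is Some tau then ZDD tau S else 0%R.

Definition cyc_interval (A : {set 'I_N}) : Prop :=
  exists s l : nat, forall i : 'I_N, (i \in A) = ((i + N - s %% N) %% N < l)%N.

Definition rgb_coloring (col : 'I_N -> 'I_3) : Prop :=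
  forall c : 'I_3, cyc_interval [set i | col i == c].

Definition triangle_ineq (col : 'I_N -> 'I_3) : Prop :=
  forall c1 c2 c3 : 'I_3, c1 != c2 -> c1 != c3 -> c2 != c3 ->
    (#|[set i | col i == c1]| <= #|[set i | col i == c2]| + #|[set i | col i == c3]|)%N.

Definition cyc_order4 (x y w v : 'I_N) : bool :=
  [|| [&& (x < y)%N, (y < w)%N & (w < v)%N],
      [&& (y < w)%N, (w < v)%N & (v < x)%N],
      [&& (w < v)%N, (v < x)%N & (x < y)%N] |
      [&& (v < x)%N, (x < y)%N & (y < w)%N]].

(* ---- planar embedding with the nodes on the outer face, in order ----
   Encoded combinatorially: the graph G' = G + z, where z (= None) is a new
   vertex adjacent to all nodes, has a genus-0 rotation system in which the
   rotation at z lists the nodes in label order. *)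
Definition gedge (u v : VT) : bool :=
  match u, v with
  | inl b, inr w => (b, w) \in E
  | inr w, inl b => (b, w) \in E
  | _, _ => false
  end.

Definition adjz : rel (option VT) := fun a b =>
  match a, b with
  | Some u, Some v => gedge u v
  | None, Some u => [exists i, node i == u]
  | Some u, None => [exists i, node i == u]
  | None, None => false
  end.

(* nxt a b = the neighbour following b in the cyclic rotation around a *)
Definition rotation_system (nxt : option VT -> option VT -> option VT) : Prop :=
  forall a, (forall b, adjz a b -> adjz a (nxt a b)) /\
            (forall b b', adjz a b -> adjz a b' -> fconnect (nxt a) b b').

Definition face_step (nxt : option VT -> option VT -> option VT)
    (d : option VT * option VT) : option VT * option VT := (d.2, nxt d.2 d.1).

(* Euler's formula V - E + F = 2 on every connected component with edges *)
Definition genus0 (nxt : option VT -> option VT -> option VT) : Prop :=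
  forall a : option VT,
    let C := [set b | connect adjz a b] in
    let D := [set d : option VT * option VT | adjz d.1 d.2 && (d.1 \in C)] in
    let F := [set [set d' | fconnect (face_step nxt) d d'] | d in D] in
    (0 < #|D|)%N -> (2 * #|C| + 2 * #|F| = #|D| + 4)%N.

Definition nodes_outer (nxt : option VT -> option VT -> option VT) : Prop :=
  forall i j : 'I_N, (j : nat) = ((i + 1) %% N)%N ->
    nxt None (Some (node i)) = Some (node j).

Definition planar_nodes_outer : Prop :=
  exists nxt, [/\ rotation_system nxt, genus0 nxt & nodes_outer nxt].

End DoubleDimer.

(* Main.v *)
(* Let [g A] be the weighted count of dimer covers of the vertices that are not
   nodes, the white nodes in [A] and the black nodes outside [A].  Superposing two
   covers gives a double-dimer configuration, and each of its loops arises twice;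
   so [g A * g B] is the weight of the configurations whose paths separate [A] from
   [B] suitably.  In genus 0 an even subgraph bounds a set of faces, hence the paths
   of a configuration join the nodes without crossing.  A sign count over noncrossing
   pairings then shows that [g] satisfies the Plucker relations, so that over a
   domain (polynomials in the edge weights) [g] is, up to a scalar, given by the
   maximal minors of a matrix [P].
   Rotate the labels so that the colors are consecutive intervals.  If [S] are the
   remaining nodes and [Y] the deleted white ones, sum [g (A :|: Y) * g (S :\: A :|: Y)]
   with signs over the [A] in [S] that contain the first color and avoid the third:
   configurations pairing two nodes of the middle color cancel, nodes of one outer
   color are never paired, and what remains is [Ztri], up to sign.  By Laplace
   expansion the same sum is a determinant of order 2n: a node of [S] contributes the
   row (P_i | 0), (P_i | P_i) or (0 | P_i) according to its color, a node of [Y] two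
   rows spanning (P_i | 0) and (0 | P_i).  The identity is the three-term Plucker
   relation between six such determinants, whose signs agree because the four nodes
   meet all colors. *)
Require Import Defs.
From HB Require Import structures.
From mathcomp Require Import all_boot all_order all_algebra all_fingroup.
From mathcomp Require Import zify ring.
From mathcomp Require mpoly.
Import Order.TTheory GRing.Theory Num.Theory.

Set Implicit Arguments.
Unset Strict Implicit.
Unset Printing Implicit Defensive.

(** * Even subgraphs in genus 0 *)

(** The vertex convention in [cov] makes the black/white colors vanish: by a parity count, the edges
    of a path can be shared between two covers exactly when one and only one of its ends has its
    label in [A], whatever the colors of the ends. This is why a single function of label sets obeys
    the Plucker relations for every color pattern.

    The same convention produces the six determinants. A deleted node has to be covered twice, so a
    white one belongs to both label sets and gives two rows, a black one to neither and gives none.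
    Deleting a black node thus drops its row, while deleting a white node adds one. The six words
    therefore share a common base and differ by the choice of two rows out of four: those of x and
    w, and the additional ones of y and v.

    Two obstacles remain. The labels are linearly ordered while the statement is cyclic; besides the
    rotation, two of the four positions of the cut require exchanging (x, y) with (w, v). And minors
    represent the dimer count only after clearing denominators; the resulting scalars enter all
    products with the same degree, so only the nonzero one has to be cancelled. *)

Section Homology.
Local Open Scope ring_scope.

Lemma F2_addrr (x : 'F_2) : x + x = 0.
Proof. by rewrite -mulr2n -mulr_natl pchar_Fp_0 // mul0r. Qed.

Lemma F2_natr (n : nat) : (n%:R : 'F_2) = (odd n)%:R.
Proof.
rewrite -[in LHS](odd_double_half n) natrD -muln2 natrM.
by rewrite (pchar_Fp_0 (p := 2)) // mulr0 addr0.
Qed.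

Lemma F2_eq (x y : 'F_2) : x + y = 0 -> x = y.
Proof. by move=> h; rewrite -[x]addr0 -(F2_addrr y) addrA h add0r. Qed.

(** The hypothesis confines the left kernel to the line of constant vectors. Below it expresses
    connectedness, once for faces and once for vertices. *)
Lemma rank_constant_kernel (F : fieldType) m n (M : 'M[F]_(m, n)) :
  (forall c : 'rV_m, c *m M = 0 -> forall i j, c 0 i = c 0 j) ->
  (m <= (\rank M).+1)%N.
Proof.
move=> h.
have h2 : (kermx M <= (const_mx 1 : 'rV[F]_m))%MS.
  apply/row_subP => k.
  have /h hk : row k (kermx M) *m M = 0 by rewrite -row_mul mulmx_ker row0.
  case: (posnP m) => [m0|m0].
    by move: (row k _); rewrite m0 => u; rewrite thinmx0 sub0mx.
  have -> : row k (kermx M) = row k (kermx M) 0 (Ordinal m0) *: const_mx 1.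
    by apply/rowP => j; rewrite !mxE mulr1; have := hk j (Ordinal m0); rewrite !mxE.
  by rewrite scalemx_sub.
have := mxrankS h2; rewrite mxrank_ker => /leq_trans/(_ (rank_leq_row _)).
by have := rank_leq_row M; lia.
Qed.

Variables (T : finType) (adj : rel T) (nxt : T -> T -> T) (z : T).
Hypothesis adjC : symmetric adj.
Hypothesis adjI : irreflexive adj.
Hypothesis rot_adj : forall a b, adj a b -> adj a (nxt a b).
Hypothesis rot_conn :
  forall a b b', adj a b -> adj a b' -> fconnect (nxt a) b b'.

Let fstep (d : T * T) : T * T := (d.2, nxt d.2 d.1).
Let swap (d : T * T) : T * T := (d.2, d.1).
Let C := [set b | connect adj z b].
Let D := [set d : T * T | adj d.1 d.2 && (d.1 \in C)].
Let Fc := [set [set d' | fconnect fstep d d'] | d in D].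
Hypothesis euler : (2 * #|C| + 2 * #|Fc| = #|D| + 4)%N.

(** Transitivity on neighbours brings [nxt a b] back to [b], and the last step of that orbit
    supplies a preimage; finiteness then gives injectivity. *)
Lemma nxt_image a : nxt a @: [set b | adj a b] = [set b | adj a b].
Proof.
apply/setP => b; rewrite inE; apply/imsetP/idP => [[c]|ab].
  by rewrite inE => /rot_adj ac ->.
have /iter_findex := rot_conn (rot_adj ab) ab.
rewrite -iterSr iterS; set c := iter _ _ _ => h; exists c => //.
rewrite inE /c; elim: (findex _ _ _) => //= k; exact: rot_adj.
Qed.

Lemma nxt_inj a : {in [set b | adj a b] &, injective (nxt a)}.
Proof. by apply/imset_injP; rewrite nxt_image. Qed.

Lemma connC a b : adj a b -> (a \in C) = (b \in C).
Proof.
move=> ab; rewrite !inE; apply/idP/idP => h; apply: (connect_trans h).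
  exact: connect1.
by apply: connect1; rewrite adjC.
Qed.

Lemma dartE a b : ((a, b) \in D) = adj a b && (a \in C).
Proof. by rewrite inE. Qed.

Lemma swap_dart d : (swap d \in D) = (d \in D).
Proof.
case: d => a b; rewrite /swap !dartE /= adjC.
by case ab: (adj a b) => //=; rewrite (connC ab).
Qed.

Lemma fstep_dart d : d \in D -> fstep d \in D.
Proof.
case: d => a b; rewrite /fstep !dartE /= => /andP[ab aC].
by rewrite rot_adj 1?adjC // -(connC ab) aC.
Qed.

Lemma fstep_inj : {in D &, injective fstep}.
Proof.
move=> [a b] [a' b']; rewrite !dartE => /andP[ab _] /andP[ab' _].
rewrite /fstep /= => -[e]; subst b' => /nxt_inj h.
by rewrite h // inE adjC.
Qed.

Let face d := [set d' | fconnect fstep d d'].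

(** Faces are orbits, but [fconnect] is known to be symmetric only inside [D], where [fstep] is
    injective. *)
Lemma face_fstep d : d \in D -> face (fstep d) = face d.
Proof.
move=> dD; apply/setP => d'; rewrite !inE.
have sym := fconnect_sym_in fstep_dart fstep_inj.
apply/idP/idP => h; first by apply: connect_trans h; apply: fconnect1.
apply: connect_trans h; rewrite sym ?fconnect1 //; exact: fstep_dart.
Qed.

Let Dp := [set d in D | (enum_rank d.1 < enum_rank d.2)%N].

Lemma half_darts (h : T * T -> 'F_2) :
  \sum_(d in Dp) (h d + h (swap d)) = \sum_(d in D) h d.
Proof.
rewrite big_split /= [RHS](bigID (fun d : T * T => enum_rank d.1 < enum_rank d.2)%N) /=.
congr (_ + _); first by apply: eq_bigl => d; rewrite inE.
rewrite [LHS](reindex_inj (h := swap)); last first.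
  by move=> [a b] [c d] [-> ->].
apply: eq_big => [[a b]|[a b] _]; last by [].
rewrite inE swap_dart /= -leqNgt; case abD: (_ \in D) => //=.
rewrite ltn_neqAle; case: eqP => //= /ord_inj /enum_rank_inj e.
by move: abD; rewrite e dartE adjI.
Qed.

Lemma card_darts : #|D| = (2 * #|Dp|)%N.
Proof.
rewrite -!sum1_card [LHS](bigID (fun d : T * T => enum_rank d.1 < enum_rank d.2)%N) /=.
rewrite mul2n -addnn; congr (_ + _)%N.
  by apply: eq_bigl => d; rewrite [RHS]inE.
rewrite [LHS](reindex_inj (h := swap)); last first.
  by move=> [a b] [c d] [-> ->].
apply: eq_bigl => -[a b].
rewrite [RHS]inE swap_dart /= -leqNgt; case abD: (_ \in D) => //=.
rewrite leq_eqVlt; case: eqP => //= /ord_inj /enum_rank_inj e.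
by move: abD; rewrite e dartE adjI.
Qed.

Let ev {S : {set T * T}} (j : 'I_#|S|) : T * T := enum_val j.
(** [M2] and [M1] are the boundary maps of the cell complex over F_2, from faces to edges and from
    edges to vertices; [Dp] holds one dart per edge. *)
Let M2 : 'M['F_2]_(#|Fc|, #|Dp|) := \matrix_(i, j)
  ((enum_val i == face (ev j))%:R + (enum_val i == face (swap (ev j)))%:R).
Let M1 : 'M['F_2]_(#|Dp|, #|C|) := \matrix_(j, k)
  (((ev j).1 == enum_val k)%:R + ((ev j).2 == enum_val k)%:R).

Lemma sum_darts_at (h : T * T -> 'F_2) v : v \in C ->
  \sum_(d in D) h d * (d.1 == v)%:R = \sum_(b | adj v b) h (v, b).
Proof.
move=> vC; rewrite [RHS](reindex_onto (fun d : T * T => d.2) (pair v)) //=.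
rewrite (bigID (fun d : T * T => d.1 == v)) /= addrC big1 ?add0r; last first.
  by move=> d /andP[_ /negPf ->]; rewrite mulr0.
apply: eq_big => [[a b]|[a b]] /=.
  rewrite dartE xpair_eqE eqxx andbT eq_sym; case: eqP => [<-|]; last by rewrite !andbF.
  by rewrite vC !andbT.
by move=> /andP[_ /eqP ->]; rewrite eqxx mulr1.
Qed.

(** At a vertex [v], the dart entering from [b] and the dart leaving towards [nxt v b] lie on the
    same face. As [nxt v] permutes the neighbours, incoming and outgoing contributions agree and
    cancel mod 2. *)
Lemma boundary_boundary : M2 *m M1 = 0.
Proof.
apply/matrixP => i k; rewrite !mxE.
pose h d : 'F_2 := (enum_val i == face d)%:R.
pose v := enum_val k; have vC : v \in C by apply: enum_valP.
transitivity (\sum_(d in Dp) ((h d + h (swap d)) * (d.1 == v)%:R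
                       + (h (swap d) + h (swap (swap d))) * ((swap d).1 == v)%:R)).
  rewrite [RHS]big_enum_val; apply: eq_bigr => j _; rewrite !mxE /ev.
  rewrite -/v -/(h _) -/(h _); case: (enum_val j) => a b; rewrite /swap /=.
  by rewrite [h (b, a) + _]addrC -mulrDr.
rewrite (half_darts (fun d => (h d + h (swap d)) * (d.1 == v)%:R)).
rewrite (sum_darts_at (fun d => h d + h (swap d)) vC) big_split /=.
have -> : \sum_(b | adj v b) h (swap (v, b)) = \sum_(b | adj v b) h (v, b).
  transitivity (\sum_(b in [set b | adj v b]) h (v, nxt v b)).
    apply: eq_big => [b|b vb]; first by rewrite inE.
    rewrite /h -(@face_fstep (swap (v, b))) // swap_dart dartE vb; exact: vC.
  rewrite -(big_imset (fun b => h (v, b)) (@nxt_inj v)) nxt_image.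
  by apply: eq_bigl => b; rewrite inE.
exact: F2_addrr.
Qed.

Lemma constant_on_C (V : eqType) (l : T -> V) :
  (forall a b, (a, b) \in D -> l a = l b) -> {in C, forall a, l a = l z}.
Proof.
move=> h a; rewrite inE => /connectP[p].
have zC : z \in C by rewrite inE connect0.
elim: p z zC => [|b p IH] u uC /=; first by move=> _ ->.
move=> /andP[ub hp] e; rewrite (IH b _ hp e) ?(h u b) ?dartE ?ub //.
by rewrite -(connC ub).
Qed.

(** The coefficient of [c] at the face containing [d]: a chain of faces read as a function of
    darts. *)
Let s_of (c : 'rV['F_2]_#|Fc|) d := \sum_i c 0 i * (enum_val i == face d)%:R.

Lemma s_of_fstep c d : d \in D -> s_of c (fstep d) = s_of c d.
Proof. by move=> dD; rewrite /s_of face_fstep. Qed.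

Lemma mul_s_of c j : (c *m M2) 0 j = s_of c (ev j) + s_of c (swap (ev j)).
Proof. by rewrite mxE -big_split; apply: eq_bigr => i _; rewrite mxE mulrDr. Qed.

Lemma dart_half d : d \in D -> (d \in Dp) || (swap d \in Dp).
Proof.
move=> dD; rewrite [d \in Dp]inE [_ d \in Dp]inE swap_dart dD /=.
case: ltngtP => // /ord_inj /enum_rank_inj e.
by move: dD; rewrite [d]surjective_pairing e dartE adjI.
Qed.

Lemma s_of_swap c (X : T * T -> 'F_2) :
  (forall d, X (swap d) = X d) ->
  (forall j, (c *m M2) 0 j = X (ev j)) ->
  forall d, d \in D -> s_of c d + s_of c (swap d) = X d.
Proof.
move=> XC h d dD.
have main d' : d' \in Dp -> s_of c d' + s_of c (swap d') = X d'.
  move=> dp; have := h (enum_rank_in dp d').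
  by rewrite mul_s_of /ev enum_rankK_in.
case/orP: (dart_half dD) => [|/main]; first exact: main.
by rewrite XC addrC; case: (d).
Qed.

(** A chain without boundary takes equal values on the two sides of each edge, hence is constant
    around each vertex and, by connectedness, everywhere. *)
Lemma rank_M2 : (#|Fc| <= (\rank M2).+1)%N.
Proof.
apply: rank_constant_kernel => c c0.
have sw d : d \in D -> s_of c d = s_of c (swap d).
  move=> dD; apply: F2_eq; apply: (s_of_swap (X := fun=> 0)) => // j.
  by rewrite c0 mxE.
have rotE a b : (a, b) \in D -> s_of c (a, nxt a b) = s_of c (a, b).
  move=> abD; rewrite (sw _ abD); apply: (@s_of_fstep c (b, a)).
  by move: abD; rewrite -swap_dart.
have ver a b b' : (a, b) \in D -> (a, b') \in D -> s_of c (a, b) = s_of c (a, b').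
  rewrite !dartE => /andP[ab aC] /andP[ab' _].
  have /iter_findex <- := rot_conn ab ab'.
  elim: findex => //= k ->; rewrite rotE // dartE aC andbT.
  elim: k => //= k; exact: rot_adj.
pose l a := if [pick b | (a, b) \in D] is Some b then s_of c (a, b) else 0.
have lE a b : (a, b) \in D -> l a = s_of c (a, b).
  move=> abD; rewrite /l; case: pickP => [b' ab'|/(_ b)]; last by rewrite abD.
  exact: ver.
have lC : {in C, forall a, l a = l z}.
  apply: constant_on_C => a b abD; rewrite (lE a b) // sw // (lE b a) //.
  by rewrite (swap_dart (a, b)).
have val_c i : c 0 i = l z.
  have /imsetP[[a b] abD e] := enum_valP i.
  transitivity (s_of c (a, b)).
    rewrite /s_of (bigD1 i) //= /face e eqxx mulr1 big1 ?addr0 // => k ki.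
    by rewrite -e (inj_eq enum_val_inj) (negPf ki) mulr0.
  rewrite -(lE a b) // lC //; by move: abD; rewrite dartE => /andP[].
by move=> i j; rewrite !val_c.
Qed.

Lemma rank_M1 : (#|C| <= (\rank M1).+1)%N.
Proof.
rewrite -mxrank_tr; apply: rank_constant_kernel => c c0.
pose l a := \sum_k c 0 k * (a == enum_val k)%:R.
have lC : {in C, forall a, l a = l z}.
  have main d : d \in Dp -> l d.1 = l d.2.
    move=> dp; have /rowP/(_ (enum_rank_in dp d)) := c0.
    rewrite !mxE => e; apply: F2_eq; rewrite -[RHS]e -big_split.
    by apply: eq_bigr => k _; rewrite !mxE /ev enum_rankK_in // mulrDr.
  apply: constant_on_C => a b abD.
  by case/orP: (dart_half abD) => /main /=.
have val_c i : c 0 i = l z.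
  rewrite -(lC (enum_val i)) ?enum_valP // /l (bigD1 i) //= eqxx mulr1.
  rewrite big1 ?addr0 // => k ki.
  by rewrite (inj_eq enum_val_inj) eq_sym (negPf ki) mulr0.
by move=> i j; rewrite !val_c.
Qed.

(* In genus 0 an even subgraph is the boundary of a set of faces; [s] is the
   indicator function of that set, as a function of darts. *)
Lemma even_subgraph_bounds (X : {set T * T}) :
  (forall a b, ((a, b) \in X) = ((b, a) \in X)) ->
  {in C, forall v, ~~ odd #|[set b | adj v b & (v, b) \in X]|} ->
  exists s : T * T -> 'F_2,
    (forall d, d \in D -> s (d.2, nxt d.2 d.1) = s d) /\
    (forall a b, adj a b -> a \in C ->
       s (a, b) + s (b, a) = ((a, b) \in X)%:R).
Proof.
move=> XC Xe.
pose x : 'rV['F_2]_#|Dp| := \row_j (ev j \in X)%:R.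
have xk : x *m M1 = 0.
  apply/rowP => k; rewrite !mxE.
  pose h d : 'F_2 := (d \in X)%:R.
  pose v := enum_val k; have vC : v \in C by apply: enum_valP.
  transitivity (\sum_(d in Dp) (h d * (d.1 == v)%:R
                         + h (swap d) * ((swap d).1 == v)%:R)).
    rewrite [RHS]big_enum_val; apply: eq_bigr => j _; rewrite !mxE /ev.
    by case: (enum_val j) => a b; rewrite /h /swap /= [(b, a) \in X]XC mulrDr.
  rewrite (half_darts (fun d => h d * (d.1 == v)%:R)) sum_darts_at //.
  rewrite -natr_sum F2_natr.
  have -> : (\sum_(b | adj v b) ((v, b) \in X) =
             #|[set b | adj v b & (v, b) \in X]|)%N.
    rewrite -sum1dep_card [RHS]big_mkcondr; apply: eq_bigr => b _.
    by case: (_ \in X).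
  by rewrite (negPf (Xe v vC)).
have sub : (M2 <= kermx M1)%MS by apply/sub_kermxP; apply: boundary_boundary.
have /submxP[c xc] : (x <= M2)%MS.
  have sx : (x <= kermx M1)%MS by apply/sub_kermxP.
  (* Euler's formula gives |E| = (|V| - 1) + (|F| - 1), so the two rank bounds force the image of
     [M2] to fill the kernel of [M1]. *)
  apply: submx_trans sx _; rewrite -(geq_leqif (mxrank_leqif_sup sub)) mxrank_ker.
  have := rank_M1; have := rank_M2; have := card_darts; have := rank_leq_row M1.
  by move: euler; lia.
exists (s_of c); split; first by move=> d /(s_of_fstep c).
move=> a b ab aC.
apply: (@s_of_swap c (fun d => (d \in X)%:R) _ _ (a, b)).
- by move=> [u v]; rewrite /swap /= XC.
- by move=> j; rewrite -xc mxE.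
- by rewrite dartE ab.
Qed.

End Homology.

Lemma odd_sum (I : finType) (P : pred I) (F : I -> nat) :
  odd (\sum_(i | P i) F i) = odd #|[set i | P i & odd (F i)]|.
Proof.
rewrite -sum1dep_card big_mkcondr /=.
rewrite (eq_bigr (fun i => odd (F i) + (F i)./2.*2)%N); last first.
  by move=> i _; rewrite odd_double_half.
rewrite big_split oddD /= [X in _ (+) X](_ : _ = false) ?addbF; last first.
  by apply: (big_ind (fun n => odd n = false)) => // [a b|i _];
    rewrite ?oddD ?odd_double // => -> ->.
by congr odd; apply: eq_bigr => i _; case: odd.
Qed.

(** * Noncrossing paths *)

Section Configurations.
Variables (V1 V2 : finType).
Local Notation VT := (V1 + V2)%type.
Local Notation mset := {ffun V1 * V2 -> 'I_3}.

Definition inc (u : VT) (e : V1 * V2) := (inl e.1 == u) || (inr e.2 == u).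
Definition deg (x : {set V1 * V2}) (u : VT) := #|[set e in x | inc u e]|.
Definition single (m : mset) := [set e | m e == 1%N :> nat].
Definition double (m : mset) := [set e | m e == 2%N :> nat].

Lemma sum_inc (F : V1 * V2 -> nat) (u : VT) :
  (\sum_(e | inc u e) F e =
   match u with inl b => \sum_w F (b, w) | inr w => \sum_b F (b, w) end)%N.
Proof.
case: u => [b|w].
  rewrite (reindex_onto (pair b) snd) /=; last first.
    by move=> [b' w'] /=; rewrite /inc orbF => /eqP[->].
  by apply: eq_bigl => w; rewrite /inc !eqxx.
rewrite (reindex_onto (fun b => (b, w)) fst) /=; last first.
  by move=> [b' w'] /=; rewrite /inc /= => /eqP[->].
by apply: eq_bigl => b; rewrite /inc !eqxx orbT.
Qed.

Lemma mdegE m (u : VT) : mdeg m u = (\sum_(e | inc u e) m e)%N.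
Proof. by rewrite sum_inc; case: u. Qed.

Lemma degE x (u : VT) : deg x u = (\sum_(e | inc u e) (e \in x))%N.
Proof.
rewrite /deg -sum1dep_card big_mkcondl /=.
by apply: eq_bigr => e _; case: (e \in x).
Qed.

Lemma mdeg_split m (u : VT) :
  mdeg m u = (deg (single m) u + 2 * deg (double m) u)%N.
Proof.
rewrite mdegE !degE big_distrr -big_split /=; apply: eq_bigr => e _.
by rewrite !inE; case: (m e) => [[|[|[|]]]].
Qed.

Lemma supp_adjC (m : mset) : symmetric (supp_adj m).
Proof. by move=> [b|w] [b'|w']. Qed.

Lemma supp_connC (m : mset) u v : connect (supp_adj m) u v = connect (supp_adj m) v u.
Proof. exact/sym_connect_sym/supp_adjC. Qed.

(* Both sides count the edges of the component with multiplicity. *)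
Lemma handshake (m : mset) (K : {pred VT}) : closed (supp_adj m) K ->
  (\sum_(b | inl b \in K) mdeg m (inl b) =
   \sum_(w | inr w \in K) mdeg m (inr w))%N.
Proof.
move=> Kc; rewrite /= big_mkcond /=.
rewrite (eq_bigr (fun b => \sum_w if inl b \in K then m (b, w) : nat else 0)%N); last first.
  by move=> b _; case: (_ \in K) => //; rewrite big1.
rewrite exchange_big [RHS]big_mkcond /=; apply: eq_bigr => w _.
transitivity (\sum_b if inr w \in K then m (b, w) : nat else 0)%N; last first.
  by case: (_ \in K) => //; rewrite big1.
apply: eq_bigr => b _; case: (posnP (m (b, w))) => [->|mbw]; first by rewrite !if_same.
by rewrite (Kc (inl b) (inr w)).
Qed.

Lemma even_odd_vertices (m : mset) (K : {pred VT}) : closed (supp_adj m) K ->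
  ~~ odd #|[set u in K | odd (mdeg m u)]|.
Proof.
by move=> Kc; rewrite -odd_sum big_sumType /= oddD (handshake Kc) addbb.
Qed.

Section Noncrossing.
Variables (E : {set V1 * V2}) (N : nat) (node : 'I_N -> VT).
Hypothesis planar : planar_nodes_outer E node.
Variable m : mset.
Hypothesis mE : forall e, (0 < m e)%N -> e \in E.
Hypothesis m_ends : forall u, odd (mdeg m u) -> exists i, node i = u.

Let conn := connect (supp_adj m).
Let adj := adjz E node.

Lemma adjzC : symmetric adj.
Proof. by move=> [[b|w]|] [[b'|w']|]. Qed.

Lemma adjzI : irreflexive adj.
Proof. by move=> [[b|w]|]. Qed.

Lemma supp_adjz u v : supp_adj m u v -> adj (Some u) (Some v).
Proof. by case: u v => [b|w] [b'|w'] //= /mE. Qed.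

Variable i0 : 'I_N.
Let K := conn (node i0).

(** The component of [node i0] taken mod 2, so that doubled edges vanish, and closed up by the edges
    from [z] to its ends. *)
Let X : {set option VT * option VT} := [set d : option VT * option VT |
  match d.1, d.2 with
  | Some u, Some v =>
      match u, v with
      | inl b, inr w | inr w, inl b => ((b, w) \in single m) && (inl b \in K)
      | _, _ => false
      end
  | None, Some u | Some u, None => odd (mdeg m u) && (u \in K)
  | None, None => false
  end].

Lemma closedK : closed (supp_adj m) K.
Proof. exact/connect_closed/sym_connect_sym/supp_adjC. Qed.

Lemma X_sym a b : ((a, b) \in X) = ((b, a) \in X).
Proof. by rewrite !in_set; case: a b => [[?|?]|] [[?|?]|]. Qed.

Lemma single_closed b w : (b, w) \in single m -> (inl b \in K) = (inr w \in K).
Proof. by rewrite inE => /eqP h; apply: closedK; rewrite /= h. Qed.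

Lemma X_out u b : u \notin K -> ((Some u, b) \in X) = false.
Proof.
move=> h; have {h}uK : (u \in K) = false by apply/negbTE.
rewrite in_set /=; case: b => [v|]; last by rewrite uK andbF.
case: u v uK => [b|w] [b'|w'] // uK; first by rewrite uK andbF.
by apply/negbTE/negP => /andP[/single_closed -> ]; rewrite uK.
Qed.

(** At [z] this is the evenness of the number of odd vertices in a component; elsewhere the edge to
    [z] is present exactly when the number of single edges is odd. *)
Lemma X_even v : ~~ odd #|[set b | adj v b & (v, b) \in X]|.
Proof.
case: v => [u|]; last first.
  have -> : [set b | adj None b & (None, b) \in X] =
            Some @: [set u in K | odd (mdeg m u)].
    apply/setP => -[u|]; rewrite !in_set /=; last by apply/esym/negbTE/imsetP => -[].
    rewrite mem_imset; last by move=> ? ? [].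
    rewrite !inE [RHS]andbC; case/boolP: (odd _) => [/m_ends[i <-]|]; last by rewrite andbF.
    suff -> : [exists k, node k == node i] by [].
    by apply/existsP; exists i.
  rewrite card_imset; last by move=> ? ? [].
  exact: even_odd_vertices closedK.
have [uK|uK] := boolP (u \in K); last first.
  by rewrite (_ : [set _ | _ & _] = set0) ?cards0 //; apply/setP => b; rewrite [LHS]inE X_out // andbF inE.
have hN : odd (mdeg m u) -> [exists i, node i == u].
  by move=> /m_ends[i <-]; apply/existsP; exists i.
pose other (u : VT) (e : V1 * V2) : option VT :=
  Some (if u is inl _ then inr e.2 else inl e.1).
set S := [set b | _ & _].
have -> : #|S| = (odd (mdeg m u) + deg (single m) u)%N.
  rewrite (cardsD1 None); congr (_ + _)%N.
    rewrite !in_set /= uK andbT; case ou: (odd _); last by rewrite andbF.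
    by rewrite (hN ou).
  rewrite -[RHS](card_in_imset (f := other u)); last first.
    move=> [b w] [b' w']; rewrite !inE /other /inc /= => /andP[_ e1] /andP[_ e2].
    by case: (u) e1 e2 => ? /=; rewrite ?orbF => /eqP[->] /eqP[->] [->].
  congr #|pred_of_set _|; apply/setP => -[v|]; rewrite in_setD1; last first.
    by rewrite eqxx; apply/esym/imsetP => -[].
  rewrite /= in_set; apply/idP/imsetP => [/andP[uv]|[[b w]]].
    rewrite in_set /=.
    case: (u) (v) uv uK => [b|w] [b'|w'] //= uv uK /andP[h _].
      by exists (b, w') => //; apply/setIdP; rewrite /inc eqxx.
    by exists (b', w) => //; apply/setIdP; rewrite /inc eqxx orbT.
  case/setIdP => h.
  have bwE : (b, w) \in E by apply: mE; move: h; rewrite inE => /eqP ->.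
  have wK := single_closed h; rewrite in_set /inc /other.
  case: (u) uK => a /= aK; rewrite ?orbF => /eqP[ea] [->] /=; subst a.
    by rewrite bwE; apply/andP; split=> //; apply/andP.
  by rewrite bwE wK; apply/andP; split=> //; apply/andP.
by rewrite mdeg_split mul2n !oddD odd_double addbF; case: (odd (deg _ _)).
Qed.

Let is_end (k : 'I_N) := odd (mdeg m (node k)) && (node k \in K).

(* Going around [z], the indicator of the faces bounded by [X] changes exactly at
   the ends of the component [K]; along a component disjoint from [K] it is
   constant. *)
Lemma noncrossing_ends (j l : 'I_N) : (j < l)%N -> conn (node j) (node l) ->
  node j \notin K -> ~~ odd #|[set k | is_end k & (j < k < l)%N]|.
Proof.
move=> jl jconn jK; have [nxt [rot gen out]] := planar.
have zC : None \in [set b | connect adj None b] by rewrite inE connect0.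
have zadj k : adj None (Some (node k)) by apply/existsP; exists k.
have nC k : Some (node k) \in [set b | connect adj None b].
  by rewrite inE connect1.
have D0 : (0 < #|[set d : option VT * option VT |
    adj d.1 d.2 && (d.1 \in [set b | connect adj None b])]|)%N.
  by apply/card_gt0P; exists (None, Some (node j)); rewrite in_set zadj.
have [] := even_subgraph_bounds adjzC adjzI (fun a => (rot a).1) (fun a => (rot a).2)
  (gen None D0) X_sym (fun v _ => X_even v).
move=> s [sface sX].
have swapE u b : u \notin K -> adj (Some u) b -> Some u \in [set b | connect adj None b] ->
    s (b, Some u) = s (Some u, b).
  by move=> uK ub uC; apply/esym/F2_eq; rewrite sX // X_out.
have faceE a b : adj a b -> a \in [set b | connect adj None b] ->
    s (a, nxt a b) = s (b, a).
  move=> ab aC; apply: (sface (b, a)); rewrite in_set /= adjzC ab /=.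
  by move: aC; rewrite !inE => aC; apply: connect_trans aC (connect1 ab).
(* No edge of [X] meets a vertex outside [K], so all faces around it carry the same value. *)
have turn u b b' : u \notin K -> Some u \in [set b | connect adj None b] ->
    adj (Some u) b -> adj (Some u) b' -> s (Some u, b) = s (Some u, b').
  move=> uK uC ub ub'; have /iter_findex <- := (rot (Some u)).2 b b' ub ub'.
  have adjk k : adj (Some u) (iter k (nxt (Some u)) b).
    by elim: k => //= k; apply: (rot (Some u)).1.
  by elim: findex => //= k ->; rewrite faceE ?swapE.
have jend : s (Some (node j), None) = s (None, Some (node j)).
  by rewrite (swapE _ None) // adjzC.
have along u : conn (node j) u -> forall b, adj (Some u) b ->
    s (Some u, b) = s (None, Some (node j)).
  move=> /connectP[p pP ->] {u}.
  have : forall b, adj (Some (node j)) b ->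
      s (Some (node j), b) = s (None, Some (node j)).
    by move=> b jb; rewrite -jend; apply: turn => //; rewrite adjzC.
  elim: p (node j) jK (nC j) pP (s (None, _)) => [|v p IH] u uK uC //= /andP[uv pP] c h.
  have uvz := supp_adjz uv.
  have vK : v \notin K by rewrite -(closedK uv).
  have vC : Some v \in [set b | connect adj None b].
    by move: uC; rewrite !inE => uC; apply: connect_trans uC (connect1 uvz).
  apply: IH => // b vb; rewrite (turn v b (Some u)) // 1?adjzC //.
  by rewrite (swapE u (Some v)) // h.
(* Consecutive edges at [z] border a common face, so [s] changes only when the edge to a node is
   crossed, and exactly when that node is an end. *)
have step t (k : 'I_N) : (k = j + t :> nat)%N ->
    (s (None, Some (node k)) = s (None, Some (node j)) +
      \sum_(i : 'I_N | (j <= i < k)%N) (is_end i)%:R)%R.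
  elim: t k => [|t IH] k kE.
    have -> : k = j by apply: ord_inj; rewrite kE addn0.
    rewrite big_pred0 ?addr0 // => i; apply/negbTE; lia.
  have tN : (j + t < N)%N by move: (ltn_ord k); lia.
  have kN : (k = ((Ordinal tN) + 1) %% N :> nat)%N.
    by rewrite /= modn_small; move: (ltn_ord k); lia.
  have nk := out _ _ kN.
  rewrite -nk faceE // (bigD1 (Ordinal tN)) /=; last by lia.
  rewrite (eq_bigl (fun i : 'I_N => j <= i < Ordinal tN)%N); last first.
    move=> i; rewrite -val_eqE /=; lia.
  rewrite addrCA -(IH (Ordinal tN)) //.
  have -> : ((is_end (Ordinal tN))%:R = s (None, Some (node (Ordinal tN))) +
      s (Some (node (Ordinal tN)), None))%R.
    by rewrite sX // [in RHS]in_set.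
  by rewrite addrAC F2_addrr add0r.
have lK : node l \notin K.
  apply: contra jK => lK; apply: connect_trans lK _.
  by rewrite supp_connC.
have lz k : adj (Some (node k)) None by rewrite adjzC.
have := step (l - j)%N l (esym (subnKC (ltnW jl))).
rewrite (swapE (node l) None lK (lz l) (nC l)) (along _ jconn None (lz l)).
rewrite -[X in X = _]addr0 => /addrI/esym/eqP.
rewrite -natr_sum F2_natr odd_sum.
rewrite (_ : [set _ | _ & _] = [set k | is_end k & (j < k < l)%N]); last first.
  apply/setP => i; rewrite !in_set oddb andbC; case ie: (is_end i) => //=.
  rewrite leq_eqVlt; case: eqP => // /ord_inj ji; move: ie.
  by rewrite /is_end -ji (negPf jK) andbF.
by case: odd.
Qed.

End Noncrossing.
End Configurations.

(** * Superposition of dimer covers *)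

Section EdgeSets.
Variables (V1 V2 : finType).
Local Notation VT := (V1 + V2)%type.
Local Notation mset := {ffun V1 * V2 -> 'I_3}.
Implicit Types (x y z : {set V1 * V2}) (m : mset).

Definition supp m := [set e | (0 < m e)%N].
Definition symdiff x y := [set e | (e \in x) (+) (e \in y)].

Lemma odd_deg_symdiff x y (u : VT) :
  odd (deg (symdiff x y) u) = odd (deg x u) (+) odd (deg y u).
Proof.
rewrite -oddD !degE -big_split !odd_sum; congr odd.
congr #|pred_of_set _|; apply/setP => e; rewrite !inE oddD !oddb.
by case: inc.
Qed.

Lemma symdiffK x y : symdiff x (symdiff x y) = y.
Proof. by apply/setP => e; rewrite !inE addKb. Qed.

Lemma symdiff_sub x y z : x \subset z -> y \subset z -> symdiff x y \subset z.
Proof.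
move=> /subsetP xz /subsetP yz; apply/subsetP => e; rewrite inE.
by case ex: (e \in x); [rewrite xz | move/yz].
Qed.

Lemma deg_set0 (u : VT) : deg set0 u = 0%N.
Proof. by rewrite degE big1 // => e _; rewrite inE. Qed.

Lemma deg_set1 e (u : VT) : deg [set e] u = inc u e.
Proof.
rewrite degE big_mkcond (bigD1 e) //= inE eqxx big1.
  by rewrite addn0; case: inc.
by move=> e' /negPf ne; rewrite inE ne if_same.
Qed.

Lemma supp_adjP m (u v : VT) : supp_adj m u v ->
  exists2 e, e \in supp m & forall w, inc w e = (w == u) || (w == v).
Proof.
case: u v => [b|w] [b'|w'] //= h.
  by exists (b, w'); rewrite ?inE // => w; rewrite /inc eq_sym [inr _ == _]eq_sym.
by exists (b', w); rewrite ?inE // => v; rewrite /inc eq_sym [inr _ == _]eq_sym orbC.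
Qed.

Lemma supp_adj_neq m (u v : VT) : supp_adj m u v -> u != v.
Proof. by case: u v => [b|w] [b'|w']. Qed.

Lemma join_exists m (u v : VT) : connect (supp_adj m) u v ->
  exists2 x : {set V1 * V2}, x \subset supp m & forall w, odd (deg x w) = (w == u) (+) (w == v).
Proof.
move=> /connectP[p pP ->] {v}.
elim: p u pP => [|v p IH] u /=.
  by exists set0; rewrite ?sub0set // => w; rewrite deg_set0 addbb.
move=> /andP[uv /IH[x xm xE]]; have [e em eE] := supp_adjP uv.
exists (symdiff [set e] x); first by rewrite symdiff_sub // sub1set.
move=> w; rewrite odd_deg_symdiff xE deg_set1 eE oddb.
have := supp_adj_neq uv; case: (eqVneq w u) => [->|] /=; last first.
  by move=> _ _; rewrite addKb.
by move=> /negPf ->.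
Qed.

(** Existence of T-joins. A vertex of [b] has a second vertex of [b] in its component, by evenness;
    a path between them is added mod 2 and both are removed from [b]. *)
Lemma tjoin_exists m (b : {set VT}) :
  (forall v, ~~ odd #|[set u in b | connect (supp_adj m) v u]|) ->
  exists2 x : {set V1 * V2}, x \subset supp m & forall w, odd (deg x w) = (w \in b).
Proof.
elim: {b}_.+1 {-2}b (ltnSn #|b|) => // k IH b bk even_b.
have [->|[u ub]] := set_0Vmem b.
  by exists set0; rewrite ?sub0set // => w; rewrite deg_set0 inE.
set S := [set v in b | connect (supp_adj m) u v].
have uS : u \in S by rewrite inE ub connect0.
have [v vS vu] : exists2 v, v \in S & v != u.
  have : (0 < #|S :\ u|)%N by have := even_b u; rewrite -/S (cardsD1 u) uS; case: #|_|.
  by move=> /card_gt0P[v]; rewrite in_setD1 => /andP[vu vS]; exists v.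
move: vS; rewrite inE => /andP[vb uv].
have [x1 x1m x1E] := join_exists uv.
have bE : b = u |: (v |: (b :\ u :\ v)) by rewrite setD1K ?setD1K // in_setD1 vu.
have [|w|x2 x2m x2E] := IH (b :\ u :\ v).
- by move: bk; rewrite (cardsD1 u) ub (cardsD1 v) in_setD1 vu vb /=; lia.
- have cE : connect (supp_adj m) w u = connect (supp_adj m) w v.
    exact: (same_connect_r (sym_connect_sym (supp_adjC m)) uv).
  set S2 := [set _ in _ | _].
  have := even_b w; have -> : [set z in b | connect (supp_adj m) w z] =
      if connect (supp_adj m) w u then u |: (v |: S2) else S2.
    apply/setP => z; rewrite inE {1}bE; case wu: (connect _ w u); rewrite !inE.
      case: (eqVneq z u) => [->|_]; first by rewrite wu.
      by case: (eqVneq z v) => [->|] //; rewrite -cE wu.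
    case: (eqVneq z u) => [->|_]; first by rewrite wu !andbF.
    by case: (eqVneq z v) => [->|] //; rewrite -cE wu !andbF.
  case: connect => //; rewrite !cardsU1 !inE !eqxx ![u == v]eq_sym (negPf vu) /= ?andbF ?orbF.
  by rewrite negbK.
exists (symdiff x1 x2); first exact: symdiff_sub.
move=> w; rewrite odd_deg_symdiff x1E x2E [in RHS]bE !inE.
by case: (eqVneq w u) => [->|] /=; rewrite ?[u == v]eq_sym ?(negPf vu) //; case: (w == v).
Qed.

Lemma inc_eq_or_adj m (u v : VT) e : e \in supp m -> inc u e -> inc v e ->
  u = v \/ supp_adj m u v.
Proof.
case: e => b w; rewrite inE /inc => h /orP[] /eqP <- /orP[] /eqP <-; by [left|right].
Qed.

Lemma inc_connect m (u v : VT) e : e \in supp m -> inc u e -> inc v e ->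
  connect (supp_adj m) u v.
Proof.
by move=> em ue ve; case: (inc_eq_or_adj em ue ve) => [->|/connect1].
Qed.

(** Agreement at each vertex spreads along a component; the agreement itself comes from
    [all_or_none]. *)
Lemma propagate m x (u v : VT) e e' :
  (forall w e1 e2, connect (supp_adj m) u w -> e1 \in supp m -> e2 \in supp m ->
     inc w e1 -> inc w e2 -> (e1 \in x) = (e2 \in x)) ->
  connect (supp_adj m) u v -> e \in supp m -> e' \in supp m ->
  inc u e -> inc v e' -> (e \in x) = (e' \in x).
Proof.
move=> h /connectP[p pP ->] {v}.
elim: p u e h pP => [|v p IH] u e h /=.
  by move=> _ em em' ue ue'; apply: (h u).
move=> /andP[uv pP] em em' ue ve'.
have [d dm dE] := supp_adjP uv.
have ud : inc u d by rewrite dE eqxx.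
have vd : inc v d by rewrite dE eqxx orbT.
rewrite (h u e d) ?connect0 //; apply: (IH v) => // w e1 e2 vw.
by apply: (h w); apply: connect_trans (connect1 uv) vw.
Qed.

Lemma mdeg_ge m x (u : VT) : x \subset supp m -> (deg x u <= mdeg m u)%N.
Proof.
move=> /subsetP xm; rewrite mdegE degE; apply: leq_sum => e _.
by case ex: (e \in x) => //; have := xm _ ex; rewrite inE.
Qed.

(** A support edge outside [x] next to an edge of [x] would make [mdeg m u] exceed [deg x u]; then
    [deg x u] is 1, and the parity hypothesis bounds [mdeg m u] by 1, a contradiction. *)
Lemma all_or_none m x (u : VT) e e' : x \subset supp m -> (mdeg m u <= 2)%N ->
  (odd (deg x u) -> mdeg m u <= 1)%N ->
  e \in supp m -> e' \in supp m -> inc u e -> inc u e' ->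
  (e \in x) = (e' \in x).
Proof.
move=> xm m2 x1 em em' ue ue'.
wlog : e e' em em' ue ue' / (e \in x) && (e' \notin x) => [h|/andP[ex ex']].
  case ex: (e \in x); case ex': (e' \in x) => //.
    by rewrite -ex -ex'; apply: h; rewrite ?ex ?ex'.
  by rewrite -ex -ex'; apply/esym; apply: h; rewrite ?ex ?ex'.
have := @mdeg_ge m (e' |: x) u; rewrite subUset sub1set em' xm => /(_ isT).
have -> : deg (e' |: x) u = (deg x u).+1.
  rewrite !degE (bigD1 e') //= [in RHS](bigD1 e') //= (negPf ex') setU11 add0n add1n.
  by congr _.+1; apply: eq_bigr => d /andP[_ /negPf de]; rewrite in_setU1 de.
have : (0 < deg x u)%N by apply/card_gt0P; exists e; rewrite inE ex.
move: x1; case: (deg x u) => [|[|k]] //= x1 _; last by lia.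
by have := x1 isT; lia.
Qed.

Lemma mdeg_supp m (u : VT) : (0 < mdeg m u)%N -> exists2 e, e \in supp m & inc u e.
Proof.
rewrite mdegE lt0n sum_nat_eq0 negb_forall => /existsP[e].
by rewrite negb_imply -lt0n => /andP[ue em]; exists e; rewrite ?inE.
Qed.

Section Ends.
Variable m : mset.
Hypothesis m2 : forall u : VT, (mdeg m u <= 2)%N.
Let conn := connect (supp_adj m).

Lemma partner_exists (a : VT) : mdeg m a = 1%N ->
  exists b, [/\ b != a, conn a b & mdeg m b = 1%N].
Proof.
move=> a1; have Kc : closed (supp_adj m) (conn a).
  exact: connect_closed (sym_connect_sym (supp_adjC m)) a.
have := even_odd_vertices Kc; set S := [set u in _ | _] => Se.
have aS : a \in S by rewrite inE a1 andbT; apply: connect0.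
have : (0 < #|S :\ a|)%N by move: Se; rewrite (cardsD1 a) aS; case: #|_|.
move=> /card_gt0P[b]; rewrite in_setD1 inE => /and3P[ba ab b1].
by exists b; split=> //; move: (m2 b) b1; case: mdeg => [|[|[|]]].
Qed.

(** A join of [a] and [b] contains the edge at [a]. By propagation it would contain the edge at [c],
    where its degree is even and at most 1, hence 0. *)
Lemma partner_unique (a b c : VT) : mdeg m a = 1%N -> mdeg m b = 1%N -> mdeg m c = 1%N ->
  conn a b -> conn a c -> b != a -> (c == a) || (c == b).
Proof.
move=> a1 b1 c1 ab ac ba; apply/negPn/negP; rewrite negb_or => /andP[ca cb].
have [x xm xE] := join_exists ab.
have [e em ae] : exists2 e, e \in supp m & inc a e by apply: mdeg_supp; rewrite a1.
have [e' em' ce'] : exists2 e, e \in supp m & inc c e by apply: mdeg_supp; rewrite c1.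
have key : forall w e1 e2, conn a w -> e1 \in supp m -> e2 \in supp m ->
     inc w e1 -> inc w e2 -> (e1 \in x) = (e2 \in x).
  move=> w e1 e2 _; apply: all_or_none => //; rewrite xE.
  by case: (eqVneq w a) => [->|]; [rewrite a1 | case: (eqVneq w b) => [->|] //; rewrite b1].
have h := propagate key ac em em' ae ce'.
have : odd (deg x a) by rewrite xE eqxx eq_sym (negPf ba).
have : ~~ odd (deg x c) by rewrite xE (negPf ca) (negPf cb).
have := mdeg_ge c xm; rewrite c1 => dc1 dc0.
have {dc1 dc0}dc : deg x c = 0%N by move: dc1 dc0; case: (deg x c) => [|[]].
have ex' : e' \notin x.
  apply/negP => ex'; have : (0 < deg x c)%N by apply/card_gt0P; exists e'; rewrite inE ex'.
  by rewrite dc.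
suff da : deg x a = 0%N by rewrite da.
apply/eqP; rewrite cards_eq0; apply/eqP/setP => d; rewrite !inE; apply/negP => /andP[dx ad].
have dm := subsetP xm _ dx.
by move: ex'; rewrite -h (key a e d (connect0 _ _) em dm ae ad) dx.
Qed.

End Ends.
End EdgeSets.

(** * Counting the pairs of covers with a given superposition *)

Section Superposition.
Variables (V1 V2 : finType).
Local Notation VT := (V1 + V2)%type.
Local Notation mset := {ffun V1 * V2 -> 'I_3}.
Variables (m : mset) (cA cB : VT -> bool).
Hypothesis mdegAB : forall u, mdeg m u = (cA u + cB u)%N.

Let conn := connect (supp_adj m).
Let ends := [set u | cA u != cB u].
(** For [cA := cov A] and a node, this is membership of its label in [A]. *)
Let lab (u : VT) := is_black u (+) cA u.

(** Candidates for the first of two covers. Prescribing only parities makes them a coset of the even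
    sets; given [mdeg m u = cA u + cB u], the parity already fixes the degree. *)
Definition halves : {set {set V1 * V2}} :=
  [set f : {set V1 * V2} | (f \subset supp m) && [forall u, odd (deg f u) == cA u]].

Lemma in_ends u : (u \in ends) = (mdeg m u == 1%N).
Proof. by rewrite inE mdegAB; case: cA; case: cB. Qed.

Lemma mdeg2 u : (mdeg m u <= 2)%N.
Proof. by rewrite mdegAB; case: cA; case: cB. Qed.

Lemma comp_closed v : closed (supp_adj m) (conn v).
Proof. exact: connect_closed (sym_connect_sym (supp_adjC m)) v. Qed.

(** [Xb] and [Xw] count the black and white vertices covered twice. The handshake identity expresses
    their difference through the ends, which settles the parity of the number of vertices covered by
    [cA]. *)
Lemma cover_parity (K : {pred VT}) : closed (supp_adj m) K ->
  exists Xb Xw : nat,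
    (\sum_(u in K) cA u = Xb + Xw + \sum_(u in K | u \in ends) cA u)%N /\
    (2 * Xb + \sum_(u in K | u \in ends) is_black u =
     2 * Xw + \sum_(u in K | u \in ends) ~~ is_black u)%N.
Proof.
move=> Kc; pose Y (u : VT) : nat := (cA u && cB u).
exists (\sum_(b | inl b \in K) Y (inl b))%N, (\sum_(w | inr w \in K) Y (inr w))%N.
split.
  transitivity (\sum_(u in K) Y u + \sum_(u in K | u \in ends) cA u)%N; last first.
    by congr (_ + _)%N; rewrite big_sumType.
  rewrite big_mkcondr -big_split; apply: eq_bigr => u _ /=; rewrite /Y inE.
  by case: cA; case: cB.
have := handshake Kc; set sb := (X in X = _ -> _); set sw := (X in _ = X -> _).
have -> : sb = (2 * (\sum_(b | inl b \in K) Y (inl b)) +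
                \sum_(u in K | u \in ends) is_black u)%N.
  rewrite big_mkcondr big_sumType /= [X in (_ + (_ + X))%N]big1 ?addn0; last first.
    by move=> w _; rewrite if_same.
  rewrite big_distrr -big_split; apply: eq_bigr => b _ /=.
  by rewrite -/(mdeg m (inl b)) mdegAB /Y inE; case: cA; case: cB.
have -> : sw = (2 * (\sum_(w | inr w \in K) Y (inr w)) +
                \sum_(u in K | u \in ends) ~~ is_black u)%N.
  rewrite big_mkcondr big_sumType /= [X in (_ + (X + _))%N]big1 ?add0n; last first.
    by move=> w _; rewrite if_same.
  rewrite big_distrr -big_split; apply: eq_bigr => w _ /=.
  by rewrite -/(mdeg m (inr w)) mdegAB /Y inE; case: cA; case: cB.
by [].
Qed.

Lemma comp_ends a b : a \in ends -> b \in ends -> conn a b -> b != a ->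
  forall u, (u \in conn a) && (u \in ends) = (u \in [set a; b]).
Proof.
rewrite !in_ends => /eqP a1 /eqP b1 ab ba u.
apply/andP/idP => [[au]|].
  rewrite in_ends !inE => /eqP u1.
  exact: (partner_unique mdeg2 a1 b1 u1 ab au ba).
by move=> /set2P[] ->; split; rewrite ?in_ends ?a1 ?b1 //; apply: connect0.
Qed.

Lemma even_comp a b : a \in ends -> b \in ends -> conn a b -> b != a ->
  odd (\sum_(u in conn a) cA u) = (lab a == lab b).
Proof.
move=> ae be ab ba; have [Xb [Xw [-> h]]] := cover_parity (@comp_closed a).
move: h; rewrite !(eq_bigl _ _ (comp_ends ae be ab ba)).
have ab' : a \notin [set b] by rewrite inE eq_sym.
rewrite !(big_setU1 _ ab') /= !big_set1 /lab.
by case: (is_black a); case: (is_black b); case: (cA a); case: (cA b) => /= h; lia.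
Qed.

Lemma even_comp0 v : (forall u, u \in conn v -> u \notin ends) ->
  ~~ odd (\sum_(u in conn v) cA u).
Proof.
move=> v0; have [Xb [Xw [-> h]]] := cover_parity (@comp_closed v).
have sum0 F : (\sum_(u in conn v | u \in ends) F u = 0)%N.
  by rewrite big_pred0 // => u; apply/negbTE/negP => /andP[/v0/negPf ->].
by move: h; rewrite !sum0; lia.
Qed.

Let split_ends := forall a b, a \in ends -> b \in ends -> conn a b -> b != a ->
  lab a != lab b.

Lemma sum_card (K : {pred VT}) :
  odd (\sum_(u in K) cA u) = odd #|[set u in [set u | cA u] | u \in K]|.
Proof.
rewrite odd_sum; congr odd; congr #|pred_of_set _|; apply/setP => u.
by rewrite !inE oddb andbC.
Qed.

Lemma halves_exist : split_ends -> exists f, f \in halves.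
Proof.
move=> sp; have [v|f fm fE] := @tjoin_exists _ _ m [set u | cA u].
  rewrite -(sum_card (conn v)).
  case: (pickP (fun u => (u \in conn v) && (u \in ends))) => [a /andP[va ae]|h]; last first.
    by apply: even_comp0 => u vu; have := h u; rewrite vu /= => ->.
  have [b [ba ab b1]] : exists b, [/\ b != a, conn a b & mdeg m b = 1%N].
    by apply: (partner_exists mdeg2); apply/eqP; rewrite -in_ends.
  have be : b \in ends by rewrite in_ends b1.
  rewrite (eq_bigl (mem (conn a))) ?(even_comp ae be ab ba) ?sp // => u /=.
  exact: (same_connect (sym_connect_sym (supp_adjC m)) va).
exists f; rewrite inE fm; apply/forallP => u; rewrite fE inE; exact: eqxx.
Qed.

Lemma halves_split f : f \in halves -> split_ends.
Proof.
rewrite inE => /andP[/subsetP fm /forallP fA] a b ae be ab ba.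
rewrite -(even_comp ae be ab ba).
(* Viewed as a multiset, [f] obeys the handshake identity: it has an even number of odd vertices in
   every component of [m]. *)
pose mf : mset := [ffun e => inord (e \in f)].
have mfE e : mf e = (e \in f) :> nat by rewrite ffunE inordK //; case: (_ \in f).
have mfd u : mdeg mf u = deg f u.
  by rewrite mdegE degE; apply: eq_bigr => e _; rewrite mfE.
have Kc : closed (supp_adj mf) (conn a).
  move=> u v uv; apply: (@comp_closed a); move: u v uv.
  case=> [b'|w] [b''|w'] //=; rewrite mfE lt0b => /fm; by rewrite inE.
have := even_odd_vertices Kc; rewrite sum_card.
rewrite (_ : [set _ in _ | odd _] = [set u in [set u | cA u] | u \in conn a]) //.
by apply/setP => u; rewrite !inE mfd (eqP (fA u)) andbC.
Qed.

Let evens : {set {set V1 * V2}} :=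
  [set x : {set V1 * V2} | (x \subset supp m) && [forall u, ~~ odd (deg x u)]].

Lemma card_halves_evens f : f \in halves -> #|halves| = #|evens|.
Proof.
rewrite inE => /andP[fm /forallP fA].
have inj : injective (symdiff f) by apply: can_inj (symdiffK f).
rewrite -(card_imset evens inj); congr #|pred_of_set _|; apply/setP => g.
apply/idP/imsetP => [|[x]]; rewrite inE => /andP[gm /forallP gA].
  exists (symdiff f g); last by rewrite symdiffK.
  rewrite inE symdiff_sub //; apply/forallP => u.
  by rewrite odd_deg_symdiff (eqP (fA u)) (eqP (gA u)) addbb.
move=> ->; rewrite inE symdiff_sub //; apply/forallP => u.
by rewrite odd_deg_symdiff (eqP (fA u)) (negPf (gA u)) addbF.
Qed.

Variable Np : {set VT}.
Hypothesis NpE : forall u, (u \in Np) = (u \in ends).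

Let comp v := [set u | connect (supp_adj m) v u].
Let loops := [set C in dd_comps m | [disjoint C & Np] && (2 < #|C|)%N].

Lemma comp_eq u v : conn u v -> comp u = comp v.
Proof.
move=> uv; apply/setP => w; rewrite !inE.
exact: (same_connect (sym_connect_sym (supp_adjC m)) uv).
Qed.

Lemma comp_loops v : (comp v \in loops) = [disjoint comp v & Np] && (2 < #|comp v|)%N.
Proof. by rewrite inE [X in X && _]imset_f. Qed.

Lemma even_propagate x u v e e' : x \in evens -> conn u v ->
  e \in supp m -> e' \in supp m -> inc u e -> inc v e' -> (e \in x) = (e' \in x).
Proof.
rewrite inE => /andP[xm /forallP xe]; apply: propagate => w e1 e2 _.
by apply: all_or_none; rewrite ?mdeg2 // (negPf (xe w)).
Qed.

Lemma inc1 (e : V1 * V2) : inc (inl e.1) e. Proof. by rewrite /inc eqxx. Qed.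
Lemma inc2 (e : V1 * V2) : inc (inr e.2) e. Proof. by rewrite /inc eqxx orbT. Qed.

(** An even set is constant on a component. An end of a path would have degree 1 in it; evenness at
    the black endpoint of [e] yields a second edge there, hence a third vertex. *)
Lemma even_comp_loop x e : x \in evens -> e \in x -> comp (inl e.1) \in loops.
Proof.
move=> xE ex; have := xE; rewrite inE => /andP[xm /forallP xe].
have em := subsetP xm e ex.
rewrite comp_loops; apply/andP; split.
  apply/pred0P => c /=; apply/negbTE/negP => /andP[]; rewrite inE NpE in_ends => ec /eqP c1.
  have [e' em' ce'] : exists2 e, e \in supp m & inc c e by apply: mdeg_supp; rewrite c1.
  have := even_propagate xE ec em em' (inc1 e) ce'; rewrite ex => /esym ex'.
  have d0 : (0 < deg x c)%N by apply/card_gt0P; exists e'; rewrite inE ex'.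
  by have := xe c; have := mdeg_ge c xm; rewrite c1; move: d0; case: deg => [|[]].
have : (1 < #|[set e' in x | inc (inl e.1) e']|)%N.
  have := xe (inl e.1); rewrite /deg; have : (0 < #|[set e' in x | inc (inl e.1) e']|)%N.
    by apply/card_gt0P; exists e; rewrite inE ex inc1.
  by case: #|_| => [|[]].
rewrite (cardsD1 e) inE ex inc1 /= ltnS => /card_gt0P[e']; rewrite !inE.
move=> /and3P[ne ex' ie'].
have e1 : e'.1 = e.1 by move: ie'; rewrite /inc orbF => /eqP[].
have sub : [set inl e.1; inr e.2; inr e'.2] \subset comp (inl e.1).
  have em' := subsetP xm e' ex'.
  apply/subsetP => u; rewrite !inE => /orP[/orP[]|] /eqP ->; first exact: connect0.
    exact: (inc_connect em (inc1 e) (inc2 e)).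
  exact: (inc_connect em' ie' (inc2 e')).
apply: leq_trans (subset_leq_card sub).
rewrite -setUA cardsU1 cards2 !inE /=.
have -> : (inr e.2 != inr e'.2 :> VT).
  apply: contra ne => /eqP[e2]; rewrite [e]surjective_pairing [e']surjective_pairing.
  by rewrite e1 e2.
by [].
Qed.

(** Multiplicity 2 exhausts the degree of both endpoints, so no other edge leaves them. *)
Lemma comp_double e u : m e = 2%N :> nat -> inc u e -> (#|comp u| <= 2)%N.
Proof.
move=> e2 ue; have em : e \in supp m by rewrite inE e2.
have only w e' : e' \in supp m -> inc w e -> inc w e' -> e' = e.
  move=> em' we we'; apply/eqP/negPn/negP => ne.
  have := mdeg2 w; rewrite mdegE (bigD1 e) //= (bigD1 e') /=; last by rewrite we' ne.
  by move: em'; rewrite inE e2; lia.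
have Kc : closed (supp_adj m) (mem [set w | inc w e]).
  apply: intro_closed; first exact: sym_connect_sym (supp_adjC m).
  move=> v w vw; rewrite !inE => ve; have [d dm dE] := supp_adjP vw.
  by rewrite -(only v d) ?dE ?eqxx ?orbT.
have sub : comp u \subset [set inl e.1; inr e.2].
  apply/subsetP => w; rewrite inE => /(closed_connect Kc); rewrite !inE ue => /esym.
  by rewrite /inc ![_ == w]eq_sym.
by apply: leq_trans (subset_leq_card sub) _; rewrite cards2.
Qed.

Let of_loops (L : {set {set VT}}) := [set e in supp m | comp (inl e.1) \in L].

Lemma loops_edge C : C \in loops -> exists2 e, e \in supp m & comp (inl e.1) = C.
Proof.
rewrite inE => /andP[/imsetP[v _ ->] /andP[_]]; rewrite -/(comp v) => c2.
have : (0 < #|comp v :\ v|)%N by move: c2; rewrite (cardsD1 v (comp v)); case: (v \in comp v) => /=; lia.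
move=> /card_gt0P[u]; rewrite !inE => /andP[uv] /connectP[[|w p]] /=.
  by move=> _ e; rewrite e eqxx in uv.
move=> /andP[vw _] _; have [e em eE] := supp_adjP vw; exists e => //.
apply/esym/comp_eq; apply: (inc_connect em _ (inc1 e)).
by rewrite eE eqxx.
Qed.

Lemma of_loops_inj : {in powerset loops &, injective of_loops}.
Proof.
move=> L L'; rewrite !inE => /subsetP Ll /subsetP Ll' e.
apply/setP => C; apply/idP/idP => CL.
  have [d dm dC] := loops_edge (Ll _ CL).
  have : d \in of_loops L by rewrite in_set dm dC.
  by rewrite e in_set dC => /andP[].
have [d dm dC] := loops_edge (Ll' _ CL).
have : d \in of_loops L' by rewrite in_set dm dC.
by rewrite -e in_set dC => /andP[].
Qed.

Lemma of_loops_even (L : {set {set VT}}) : L \subset loops -> of_loops L \in evens.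
Proof.
move=> /subsetP Ll; rewrite inE; apply/andP; split.
  by apply/subsetP => e; rewrite inE => /andP[].
apply/forallP => u.
have compE e : e \in supp m -> inc u e -> comp (inl e.1) = comp u.
  by move=> em ue; apply/esym/comp_eq; apply: (inc_connect em ue (inc1 e)).
case uL : (comp u \in L); last first.
  rewrite degE big1 // => e ue; rewrite inE; case em: (e \in supp m) => //=.
  by rewrite compE // uL.
have := Ll _ uL; rewrite comp_loops => /andP[d2 c2].
have -> : deg (of_loops L) u = mdeg m u.
  rewrite mdegE degE; apply: eq_bigr => e ue; rewrite inE.
  case em: (e \in supp m); last first.
    by move: em; rewrite inE; case: (nat_of_ord (m e)).
  rewrite compE // uL.
  move: em; rewrite inE; have := ltn_ord (m e).
  have : nat_of_ord (m e) <> 2%N by move=> e2; have := comp_double e2 ue; lia.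
  by case: (nat_of_ord (m e)) => [|[|[|]]].
have : u \notin ends.
  by rewrite -NpE; move/pred0P: d2 => /(_ u) /=; rewrite inE connect0 /= => ->.
by rewrite in_ends; move: (mdeg2 u); case: mdeg => [|[|[|]]].
Qed.

(** Even subsets of the support are the unions of loops: on a loop all multiplicities are 1 and all
    degrees 2. *)
Lemma card_evens : #|evens| = (2 ^ nloops Np m)%N.
Proof.
rewrite -[nloops Np m]/(#|loops|) -card_powerset -(card_in_imset of_loops_inj).
congr #|pred_of_set _|; apply/setP => x; apply/idP/imsetP => [xE|[L]]; last first.
  by rewrite inE => Ll ->; apply: of_loops_even.
have xm : x \subset supp m by move: xE; rewrite inE => /andP[].
exists [set comp (inl e.1) | e in x].
  by rewrite inE; apply/subsetP => C /imsetP[e ex ->]; apply: even_comp_loop xE ex.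
apply/setP => e; rewrite inE; apply/idP/andP => [ex|[em /imsetP[e' ex' cE]]].
  by rewrite (subsetP xm) //; split=> //; apply: imset_f.
have ee' : conn (inl e.1) (inl e'.1).
  have : inl e'.1 \in comp (inl e'.1) by rewrite inE connect0.
  by rewrite -cE inE.
by rewrite (even_propagate xE ee' em (subsetP xm _ ex') (inc1 e) (inc1 e')).
Qed.

(** A candidate exists if and only if every component holds an even number of vertices to be
    covered, a condition on the ends of paths only; the candidates then form a coset of the even
    sets. This is the origin of the factor 2 per loop. *)
Lemma card_halves :
  #|halves| = (if [forall a, forall b, [&& a \in ends, b \in ends, conn a b & b != a] ==>
                     (lab a != lab b)] then 2 ^ nloops Np m else 0)%N.
Proof.
case: ifPn => [/forallP h|h].
  have [|f fh] := halves_exist; last by rewrite (card_halves_evens fh) card_evens.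
  move=> a b ae be ab ba; have /forallP/(_ b)/implyP := h a; apply.
  by rewrite ae be ba ab.
apply/eqP; rewrite cards_eq0; apply/eqP/setP => f; rewrite [RHS]inE.
apply/negbTE; apply: contra h => fh; apply/forallP => a; apply/forallP => b.
by apply/implyP => /and4P[ae be ab ba]; apply: halves_split fh _ _ ae be ab ba.
Qed.

End Superposition.

(** * Products of weighted dimer counts *)

Section Dimers.
Variables (V1 V2 : finType) (E : {set V1 * V2}) (N : nat).
Variable node : 'I_N -> (V1 + V2)%type.
Local Notation VT := (V1 + V2)%type.
Local Notation mset := {ffun V1 * V2 -> 'I_3}.
Hypothesis node_inj : injective node.
Variables (R : comNzRingType) (wt : V1 * V2 -> R).
Implicit Types (A B : {set 'I_N}) (m : mset).

(* A set [A] of labels prescribes the vertices to be covered: every vertex that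
   is not a node, the white nodes in [A] and the black nodes outside [A]. *)
Definition cov A (u : VT) : bool :=
  if [pick i | node i == u] is Some i then is_black u (+) (i \in A) else true.

Definition covers A : {set {set V1 * V2}} :=
  [set f : {set V1 * V2} | (f \subset E) && [forall u, deg f u == cov A u]].

Definition dimer A : R := (\sum_(f in covers A) \prod_(e in f) wt e)%R.

Definition config A B m :=
  [forall e, (0 < m e)%N ==> (e \in E)] &&
  [forall u, mdeg m u == (cov A u + cov B u)%N].

Definition splits A B m :=
  [forall i, forall j, [&& (i \in A) != (i \in B), (j \in A) != (j \in B), i != j &
     connect (supp_adj m) (node i) (node j)] ==> ((i \in A) != (j \in A))].

Lemma cov_node A i : cov A (node i) = is_black (node i) (+) (i \in A).
Proof.
rewrite /cov; case: pickP => [j /eqP /node_inj -> //|/(_ i)].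
by rewrite eqxx.
Qed.

Lemma cov_not_node A u : (forall i, node i != u) -> cov A u = true.
Proof. by move=> h; rewrite /cov; case: pickP => // i; rewrite (negPf (h i)). Qed.

Lemma nodeP u : (exists i, u = node i) \/ (forall i, node i != u).
Proof.
have [/existsP[i /eqP <-]|] := boolP [exists i, node i == u]; first by left; exists i.
by rewrite negb_exists => /forallP; right.
Qed.

Lemma cov_neq A B u : (cov A u != cov B u) =
  (u \in node @: [set i | (i \in A) != (i \in B)]).
Proof.
case: (nodeP u) => [[i ->]|h].
  by rewrite mem_imset // inE !cov_node; case: is_black; case: (_ \in A); case: (_ \in B).
rewrite !cov_not_node // eqxx; apply/esym/negbTE/imsetP => -[i _ e].
by have := h i; rewrite -e eqxx.
Qed.

(** On nodes, [is_black] added to [cov A] is membership in [A], so the end condition of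
    [card_halves] loses every reference to the colors. *)
Lemma splitsE A B m :
  splits A B m = [forall a, forall b, [&& a \in [set u | cov A u != cov B u],
     b \in [set u | cov A u != cov B u], connect (supp_adj m) a b & b != a] ==>
       (is_black a (+) cov A a != is_black b (+) cov A b)].
Proof.
apply/idP/idP => h; apply/forallP => a; apply/forallP => b; apply/implyP => /and4P.
  rewrite !inE !cov_neq => -[/imsetP[i iAB ->] /imsetP[j jAB ->] ij ji].
  rewrite !cov_node !addKb; move/forallP/(_ i)/forallP/(_ j)/implyP: h; apply.
  rewrite ij andbT; move: iAB jAB; rewrite !inE => -> -> /=.
  by apply: contra ji => /eqP ->.
move=> [aAB bAB ab cab].
move/forallP/(_ (node a))/forallP/(_ (node b))/implyP: h.
rewrite !cov_node !addKb; apply.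
rewrite !inE !cov_node cab (inj_eq node_inj) [b == a]eq_sym ab.
by move: aAB bAB; do 2![case: is_black => /=];
  do 2![case: (_ \in A)]; do 2![case: (_ \in B)].
Qed.

(** The pairs of covers superposing to [m] correspond to the elements of [halves], by the first
    component; their number contributes the loop factor of the weight. *)
Lemma dimer_mul A B :
  (dimer A * dimer B =
   \sum_(m | config A B m && splits A B m)
      config_weight wt (node @: [set i | (i \in A) != (i \in B)]) m)%R.
Proof.
pose M (p : {set V1 * V2} * {set V1 * V2}) : mset :=
  [ffun e => inord ((e \in p.1) + (e \in p.2))].
have ME p e : M p e = ((e \in p.1) + (e \in p.2))%N :> nat.
  by rewrite ffunE inordK //; case: (_ \in _); case: (_ \in _).
have Mdeg p u : mdeg (M p) u = (deg p.1 u + deg p.2 u)%N.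
  by rewrite mdegE !degE -big_split; apply: eq_bigr => e _; rewrite ME.
rewrite /dimer big_distrl /=.
under eq_bigr do rewrite big_distrr /=.
rewrite pair_big /= (partition_big M (config A B)) /=; last first.
  move=> [f1 f2] /= /andP[]; rewrite !inE => /andP[/subsetP s1 /forallP d1].
  move=> /andP[/subsetP s2 /forallP d2]; apply/andP; split; apply/forallP => x.
    apply/implyP; rewrite ME /=; case e1: (x \in f1); first by rewrite s1.
    by case e2: (x \in f2); first by rewrite s2.
  by rewrite Mdeg /= (eqP (d1 x)) (eqP (d2 x)).
rewrite [RHS]big_mkcondr /=; apply: eq_bigr => m /andP[/forallP mE /forallP mAB].
have mdegAB u : mdeg m u = (cov A u + cov B u)%N by apply/eqP.
transitivity ((\prod_e wt e ^+ m e) *+ #|halves m (cov A)|)%R; last first.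
  rewrite (card_halves mdegAB (Np := node @: [set i | (i \in A) != (i \in B)])).
    rewrite splitsE; case: ifP => _; last by rewrite mulr0n.
    by rewrite -mulr_natr natrX.
  by move=> u; rewrite inE cov_neq.
rewrite -[RHS]sumr_const.
(* The second cover, recovered from [m] and the first. *)
pose compl (f : {set V1 * V2}) := [set e | (m e - (e \in f))%N == 1%N].
have complM f : f \in halves m (cov A) -> M (f, compl f) = m.
  rewrite inE => /andP[/subsetP fm /forallP fA].
  apply/ffunP => e; apply: val_inj; rewrite /= ME /= inE.
  have := ltn_ord (m e); case ef: (e \in f) => /=.
    by have := fm _ ef; rewrite inE; case: (nat_of_ord (m e)) => [|[|[|]]].
  (* An edge of multiplicity 2 outside [f] would use up its black endpoint; that vertex has to be
     covered by [f], yet [f] would have degree 0 there. *)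
  suff : nat_of_ord (m e) <> 2%N by case: (nat_of_ord (m e)) => [|[|[|]]].
  move=> e2; have := mdegAB (inl e.1); rewrite mdegE (bigD1 e) /=; last by rewrite inc1.
  have -> : cov A (inl e.1) = odd (deg f (inl e.1)) by rewrite (eqP (fA _)).
  suff -> : deg f (inl e.1) = 0%N by rewrite e2; case: (cov B _); lia.
  rewrite degE big1 // => d ud; case df: (d \in f) => //.
  have := mdegAB (inl e.1); rewrite mdegE (bigD1 e) /= ?inc1 // (bigD1 d) /=.
    by have := fm _ df; rewrite inE e2; case: (cov A _); case: (cov B _); lia.
  by rewrite ud; apply/eqP => de; rewrite de ef in df.
have sm f : f \in halves m (cov A) -> forall u, deg f u = cov A u.
  rewrite inE => /andP[fm /forallP fA] u; have := fA u; have := mdeg_ge u fm.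
  rewrite mdegAB; have fP : f \in halves m (cov A) by rewrite inE fm; apply/forallP.
  have := Mdeg (f, compl f) u; rewrite complM // mdegAB /=.
  by case: (cov A u); case: (cov B u); case: (deg f u) => [|[|[|]]] //=; lia.
rewrite (reindex_onto (fun f => (f, compl f)) fst) /=; last first.
  move=> [f1 f2] /= /andP[/andP[_ _] /eqP fm]; congr pair.
  by apply/setP => e; rewrite inE -fm ME /= addKn; case: (_ \in _).
apply: eq_big => [f|f].
  rewrite eqxx andbT; apply/idP/idP => [/andP[/andP[]]|fh].
    rewrite !inE => /andP[_ /forallP fA] _ /eqP fm; apply/andP; split.
      by apply/subsetP => e ef; rewrite inE -fm ME /= ef.
    by apply/forallP => u; rewrite (eqP (fA u)) oddb.
  rewrite complM // eqxx andbT; have fE e : e \in supp m -> e \in E.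
    by rewrite inE => /(implyP (mE e)).
  have dC u : deg (compl f) u = cov B u.
    by have := Mdeg (f, compl f) u; rewrite complM // mdegAB /= (sm f) //; lia.
  rewrite !inE; apply/andP; split; apply/andP; split; try apply/forallP => u.
  - apply/subsetP => e ef; apply: fE; move: fh; rewrite inE => /andP[/subsetP + _].
    exact.
  - by rewrite sm.
  - apply/subsetP => e; rewrite inE => ec; apply: fE; rewrite inE.
    by case: (nat_of_ord (m e)) ec.
  - by rewrite dC.
move=> /andP[/andP[_ /eqP fm] _].
rewrite ![X in (X * _)%R = _]big_mkcond [X in (_ * X)%R = _]big_mkcond -big_split /=.
apply: eq_bigr => e _.
have -> : nat_of_ord (m e) = ((e \in f) + (e \in compl f))%N by rewrite -(ME (f, compl f)) fm.
by rewrite exprD; do 2![case: (e \in _)].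
Qed.

End Dimers.

(** * Sign-reversing involutions and noncrossing matchings *)

(** The predicate [b] singles out one element of each orbit, so that terms cancel in pairs. Without
    it only twice the sum would vanish, which says nothing in characteristic 2. *)
Lemma sum_involution (V : zmodType) (T : finType) (P b : pred T) (s : T -> T)
    (F : T -> V) :
  (forall x, P x ->
     [/\ P (s x), b (s x) = ~~ b x, s (s x) = x & F (s x) = (- F x)%R]) ->
  (\sum_(x | P x) F x = 0)%R.
Proof.
move=> h; rewrite (bigID b) /=.
rewrite [X in (_ + X)%R](reindex_onto s s) /=; last first.
  by move=> x /andP[/h[_ _ e _] _].
rewrite [X in (_ + X)%R](eq_bigl (fun x => P x && b x)) /=; last first.
  move=> x; apply/idP/idP => [/andP[/andP[Psx bsx] /eqP e]|/andP[Px bx]].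
    by have [Px bE _ _] := h _ Psx; rewrite e in Px bE; rewrite Px bE bsx.
  by have [Psx -> -> _] := h _ Px; rewrite Psx bx eqxx.
by rewrite -big_split big1 //= => x /andP[/h[_ _ _ ->] _]; exact: addrN.
Qed.

Definition rank_in (N : nat) (T : {set 'I_N}) (i : nat) := #|[set k in T | (k < i)%N]|.

(** Noncrossing perfect matchings as involutions; the values of [s] outside [T] are arbitrary. *)
Record nc_pairing (N : nat) (T : {set 'I_N}) (s : 'I_N -> 'I_N) : Prop := {
  nc_in : forall i, i \in T -> s i \in T;
  nc_neq : forall i, i \in T -> s i != i;
  nc_inv : forall i, i \in T -> s (s i) = i;
  nc_nest : forall i k, i \in T -> k \in T -> (i < k < s i)%N -> (i < s k < s i)%N }.

Section NcPairing.
Variables (N : nat) (T : {set 'I_N}) (s : 'I_N -> 'I_N).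
Hypothesis nc : nc_pairing T s.

Lemma nc_between i k : i \in T -> k \in T -> (i < k < s i)%N = (i < s k < s i)%N.
Proof.
move=> iT kT; apply/idP/idP; first exact: nc_nest nc _ _ iT kT.
by move=> /(nc_nest nc iT (nc_in nc kT)); rewrite (nc_inv nc kT).
Qed.

(** The elements enclosed by a pair are matched among themselves. *)
Lemma even_between i : i \in T -> ~~ odd #|[set k in T | (i < k < s i)%N]|.
Proof.
move=> iT; set S := [set _ in _ | _].
have sS k : k \in S -> s k \in S.
  by rewrite !inE => /andP[kT ik]; rewrite (nc_in nc kT) -(nc_between iT kT).
rewrite -(cardsID [set k : 'I_N | (k < s k)%N] S).
suff -> : #|S :\: [set k : 'I_N | (k < s k)%N]| = #|S :&: [set k : 'I_N | (k < s k)%N]|.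
  by rewrite addnn odd_double.
have inj : {in S :\: [set k : 'I_N | (k < s k)%N] &, injective s}.
  move=> k l; rewrite !inE => /andP[_ /andP[kT _]] /andP[_ /andP[lT _]] e.
  by rewrite -(nc_inv nc kT) e (nc_inv nc lT).
rewrite -(card_in_imset inj); congr #|pred_of_set _|; apply/setP => k.
apply/imsetP/idP => [[l + ->]|].
  rewrite in_setD in_setI => /andP[ls lS]; rewrite sS // !inE.
  have lT : l \in T by move: lS; rewrite inE => /andP[].
  rewrite (nc_inv nc) //; move: ls; rewrite inE -leqNgt leq_eqVlt => /orP[|] //.
  by rewrite val_eqE (negPf (nc_neq nc lT)).
rewrite in_setI => /andP[kS ks]; exists (s k); last first.
  by rewrite (nc_inv nc) //; move: kS; rewrite inE => /andP[].
rewrite in_setD sS // andbT !inE (nc_inv nc) //; last by move: kS; rewrite inE => /andP[].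
by move: ks; rewrite inE; lia.
Qed.

Lemma rank_in_lt i j : i \in T -> (i < j)%N ->
  rank_in T j = (rank_in T i + #|[set k in T | (i < k < j)%N]|).+1.
Proof.
move=> iT ij; rewrite /rank_in.
rewrite (cardsD1 i) inE iT ij add1n; congr _.+1.
rewrite -(cardsID [set k : 'I_N | (k < i)%N]); congr (_ + _)%N.
  congr #|pred_of_set _|; apply/setP => k; rewrite !inE.
  by case: (k \in T); rewrite ?andbF ?andbT //= -val_eqE /=; lia.
congr #|pred_of_set _|; apply/setP => k; rewrite !inE.
by case: (k \in T); rewrite ?andbF ?andbT //= -val_eqE /=; lia.
Qed.

(** Source of the sign reversals in both involutions below, for [dimer_plucker] and for
    [inner_sum]. *)
Lemma odd_rank_partner i : i \in T ->
  odd (rank_in T (s i)) = ~~ odd (rank_in T i).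
Proof.
move=> iT; have := nc_neq nc iT; rewrite -val_eqE neq_ltn => /orP[] h.
  have siT := nc_in nc iT; have := even_between siT.
  by rewrite (nc_inv nc) // (rank_in_lt siT h) /= oddD => /negPf ->; rewrite addbF negbK.
by rewrite (rank_in_lt iT h) /= oddD (negPf (even_between iT)) addbF.
Qed.

End NcPairing.

(** * Plucker relations for dimer counts *)

Section DimerPlucker.
Variables (V1 V2 : finType) (E : {set V1 * V2}) (N : nat).
Variable node : 'I_N -> (V1 + V2)%type.
Local Notation mset := {ffun V1 * V2 -> 'I_3}.
Hypothesis node_inj : injective node.
Hypothesis planar : planar_nodes_outer E node.
Variables (R : comNzRingType) (wt : V1 * V2 -> R).
Implicit Types (A B Q : {set 'I_N}) (m : mset).

(** A path has two ends. If [i < k < s i], the number of ends of the path of [k] between [i] and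
    [s i] is even and counts [k], so it counts [s k] as well. *)
Lemma config_pairing A B m : config E node A B m ->
  exists2 s, nc_pairing [set i | (i \in A) != (i \in B)] s &
    forall i j, (i \in A) != (i \in B) -> (j \in A) != (j \in B) -> i != j ->
      connect (supp_adj m) (node i) (node j) = (j == s i).
Proof.
move=> /andP[/forallP mE /forallP mAB].
have mdegAB u : mdeg m u = (cov node A u + cov node B u)%N by apply/eqP.
set T := [set i | _].
have m2 u : (mdeg m u <= 2)%N by rewrite mdegAB; do 2![case: cov].
have endE u : (mdeg m u == 1%N) = (u \in node @: T).
  by rewrite -(cov_neq node_inj) mdegAB; do 2![case: cov].
have endT i : (mdeg m (node i) == 1%N) = (i \in T) by rewrite endE mem_imset.
have oddE u : odd (mdeg m u) = (u \in node @: T).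
  by rewrite -endE; move: (m2 u); case: mdeg => [|[|[|]]].
have ex i : exists j, (i \in T) ==>
    [&& j \in T, j != i & connect (supp_adj m) (node i) (node j)].
  case iT: (i \in T); last by exists i.
  have [b [ba ab b1]] : exists b, [/\ b != node i, connect (supp_adj m) (node i) b & mdeg m b = 1%N].
    by apply: (partner_exists m2); apply/eqP; rewrite endT.
  move/eqP: b1; rewrite endE => /imsetP[j jT bj]; subst b; exists j.
  by rewrite jT ab -(inj_eq node_inj) ba.
pose s i := xchoose (ex i).
have sP i : i \in T -> [/\ s i \in T, s i != i & connect (supp_adj m) (node i) (node (s i))].
  by move=> iT; have /implyP/(_ iT)/and3P := xchooseP (ex i).
have uniq_s i j : i \in T -> j \in T -> i != j ->
    connect (supp_adj m) (node i) (node j) -> j = s i.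
  move=> iT jT ij cij; have [siT sii ci] := sP i iT.
  have [i1 j1 si1] : [/\ mdeg m (node i) = 1%N, mdeg m (node j) = 1%N &
      mdeg m (node (s i)) = 1%N] by split; apply/eqP; rewrite endT.
  have := partner_unique m2 i1 si1 j1 ci cij; rewrite !(inj_eq node_inj) sii.
  by move=> /(_ isT); rewrite eq_sym (negPf ij) => /eqP.
have sK i : i \in T -> s (s i) = i.
  move=> iT; have [siT sii ci] := sP i iT.
  by apply/esym/uniq_s => //; rewrite supp_connC.
exists s; last first.
  move=> i j; rewrite -![_ != (_ \in B)](in_set (fun i => (i \in A) != (i \in B))).
  move=> iT jT ij; apply/idP/eqP => [|->]; first exact: uniq_s.
  by have [] := sP i iT.
split=> [i /sP[]|i /sP[]|i /sK|] // i k iT kT /andP[ik ks].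
have [siT sii ci] := sP i iT; have [skT skk ck] := sP k kT.
have mE' e : (0 < m e)%N -> e \in E by apply/implyP.
have m_ends u : odd (mdeg m u) -> exists i, node i = u.
  by rewrite oddE => /imsetP[j _ ->]; exists j.
have nconn : node i \notin connect (supp_adj m) (node k).
  have ki : k != i by rewrite -val_eqE gtn_eqF.
  apply/negP => /(uniq_s k i kT iT ki) e.
  by move: ks; rewrite e sK // ltnn.
have := noncrossing_ends planar mE' m_ends (ltn_trans ik ks) ci nconn.
apply: contraR => out.
suff -> : [set j | odd (mdeg m (node j)) && (node j \in connect (supp_adj m) (node k))
   & (i < j < s i)%N] = [set k] by rewrite cards1.
apply/setP => j; rewrite !inE oddE mem_imset //.
apply/idP/eqP => [/andP[/andP[jT cj] bj]|->]; last by rewrite kT ik ks /= andbT; apply: connect0.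
apply/eqP/negPn/negP; rewrite eq_sym => kj; have e := uniq_s k j kT jT kj cj.
by move: out; rewrite -e bj.
Qed.

Lemma configE A B A' B' m : (forall i, (i \in A) + (i \in B) = (i \in A') + (i \in B'))%N ->
  config E node A B m = config E node A' B' m.
Proof.
move=> h; congr andb; apply: eq_forallb => u; congr (_ == _).
case: (nodeP node u) => [[i ->]|hu]; last by rewrite !cov_not_node.
have := h i; rewrite !cov_node //; do 5![case: (_ \in _) || case: is_black] => //=.
Qed.

(** Moving [q] from [Q] to [B] preserves the total covering, so all terms are sums over parts of one
    family of configurations. In such a configuration the path starting at [q] must end at another
    movable label [s q]. Moving [s q] instead of [q] changes the split of that path only, and
    reverses the sign. *)
Lemma dimer_plucker Q B :
  (\sum_(q in Q :\: B) (-1) ^+ (rank_in Q q + rank_in B q) *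
     (dimer E node wt (Q :\ q) * dimer E node wt (q |: B)) = 0)%R.
Proof.
set T := [set i | (i \in Q) != (i \in B)].
have TE q : q \in Q :\: B -> [set i | (i \in Q :\ q) != (i \in q |: B)] = T.
  rewrite inE => /andP[qB qQ]; apply/setP => i; rewrite !inE.
  by case: (i =P q) => [->|] //=; rewrite qQ (negPf qB).
have cE q m : q \in Q :\: B -> config E node (Q :\ q) (q |: B) m = config E node Q B m.
  rewrite inE => /andP[qB qQ]; apply: configE => i; rewrite !inE.
  by case: (i =P q) => [->|] //=; rewrite qQ (negPf qB).
transitivity (\sum_(m | config E node Q B m) \sum_(q in Q :\: B | splits node (Q :\ q) (q |: B) m)
   (-1) ^+ rank_in T q * config_weight wt (node @: T) m)%R.
  rewrite (exchange_big_dep (mem (Q :\: B))) /=; last by move=> m q _ /andP[].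
  apply: eq_bigr => q qQB; rewrite dimer_mul // big_distrr /=.
  rewrite (eq_bigl (fun m => config E node Q B m && (q \in Q :\: B) && splits node (Q :\ q) (q |: B) m)); last first.
    by move=> m; rewrite cE // qQB andbT.
  rewrite (eq_bigl (fun m => config E node Q B m && splits node (Q :\ q) (q |: B) m)); last first.
    by move=> m; rewrite qQB andbT.
  rewrite [RHS](eq_bigl (fun m => config E node Q B m && splits node (Q :\ q) (q |: B) m)); last first.
    by move=> m; rewrite qQB.
  apply: eq_bigr => m _; rewrite TE //; congr (_ * _)%R.
  (* Labels common to [Q] and [B] count twice, so mod 2 only the symmetric difference [T]
     contributes. *)
  rewrite -[LHS]signr_odd -[RHS]signr_odd; congr (_ ^+ _)%R; congr nat_of_bool.
  rewrite /rank_in -!sum1dep_card !big_mkcondl -big_split /=.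
  rewrite odd_sum [RHS]odd_sum; congr odd; congr #|pred_of_set _|; apply/setP => k.
  by rewrite !inE; case: (k \in Q); case: (k \in B).
rewrite big1 // => m mQB; have [s nc sE] := config_pairing mQB.
have inT i : (i \in T) = ((i \in Q) != (i \in B)) by rewrite inE.
apply: (sum_involution (b := fun q : 'I_N => (q < s q)%N) (s := s)) => q /andP[qQB /forallP sp].
have qT : q \in T by rewrite inE; move: qQB; rewrite inE => /andP[/negPf -> ->].
have sqT := nc_in nc qT; have sqq := nc_neq nc qT; have ssq := nc_inv nc qT.
have sc i : i \in T -> connect (supp_adj m) (node i) (node (s i)).
  move=> iT; rewrite sE -?inT ?eqxx ?(nc_in nc) //.
  by rewrite eq_sym (nc_neq nc).
have inTq q' i : q' \in Q :\: B -> (i \in T) = ((i \in Q :\ q') != (i \in q' |: B)).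
  by move=> h; rewrite -(TE q') // inE.
have sqQ : s q \in Q.
  have /forallP/(_ (s q))/implyP := sp q; rewrite -!inTq // qT sqT eq_sym sqq sc //.
  by rewrite !inE eqxx (negPf sqq) /= => /(_ isT); case: (_ \in Q).
have sqQB : s q \in Q :\: B by move: sqT; rewrite !inE sqQ; case: (_ \in B).
split=> //; last first.
- by rewrite -signr_odd (odd_rank_partner nc qT) -[in RHS]signr_odd signrN mulNr.
- by rewrite ssq; move: sqq; rewrite -val_eqE -leqNgt ltn_neqAle /= => ->.
rewrite sqQB; apply/forallP => i; apply/forallP => j; apply/implyP.
rewrite -!inTq // => /and4P[iT jT ij cij].
have /forallP/(_ j)/implyP := sp i; rewrite -!inTq // iT jT ij cij => /(_ isT).
move: cij; rewrite sE -?inT // => /eqP ->{j jT ij}; rewrite !inE.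
case: (eqVneq i q) => [->|iq].
    by rewrite (negPf sqq) [q == s q]eq_sym (negPf sqq) eqxx; move: qQB; rewrite inE => /andP[_ ->].
case: (eqVneq i (s q)) => [->|isq].
  by rewrite ssq eqxx [q == s q]eq_sym (negPf sqq); move: qQB; rewrite inE => /andP[_ ->].
have -> : (s i == q) = false by apply: contraNF isq => /eqP <-; rewrite (nc_inv nc iT).
have -> : (s i == s q) = false; last by [].
by apply: contraNF iq => /eqP e; rewrite -(nc_inv nc iT) e ssq.
Qed.

End DimerPlucker.

Lemma perm_swap_eq (T : eqType) (V : Type) (f : seq T -> V) :
  (forall p a b q, f (p ++ a :: b :: q) = f (p ++ b :: a :: q)) ->
  forall s t, perm_eq s t -> f s = f t.
Proof.
move=> h s; elim: s f h => [|a s IH] f h t.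
  by rewrite perm_sym => /perm_nilP ->.
move=> st; have : a \in t by rewrite -(perm_mem st) mem_head.
move=> /splitPr at_; case: at_ st => t1 t2 st.
have {}st : perm_eq s (t1 ++ t2).
  by rewrite -(perm_cons a) (permPl st); apply/permEl/(perm_catCA t1 [:: a] t2).
rewrite (IH (fun l => f (a :: l)) _ _ st) => [|p b c q]; last exact: (h (a :: p)).
elim: t1 f h {st} => //= b t1 IH1 f h.
rewrite (h [::]) /=; apply: (IH1 (fun l => f (b :: l))) => p c d q.
exact: (h (b :: p)).
Qed.

(** * Plucker relations and minors *)

Section Words.
Local Open Scope ring_scope.
Variables (T : eqType) (key : T -> nat).
Hypothesis key_inj : injective key.
Variable R : comNzRingType.
Implicit Types (a b q x : T) (p s t l : seq T).

Definition sg a b : R := if (key a < key b)%N then 1 else if a == b then 0 else -1.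

(** For distinct letters, the sign of the permutation sorting the word by [key]; for a repeated
    letter, 0. *)
Fixpoint sgs s : R := if s is a :: l then (\prod_(b <- l) sg a b) * sgs l else 1.

Lemma sgC a b : sg b a = - sg a b.
Proof.
rewrite /sg [b == a]eq_sym -(inj_eq key_inj).
by case: ltngtP => _; rewrite ?opprK ?oppr0.
Qed.

Lemma sgs_cat s t : sgs (s ++ t) = sgs s * (\prod_(a <- s) \prod_(b <- t) sg a b) * sgs t.
Proof.
elim: s => [|a s IH] /=; first by rewrite big_nil !mul1r.
by rewrite IH big_cat big_cons /=; ring.
Qed.

Lemma sgs_swap p a b t : sgs (p ++ b :: a :: t) = - sgs (p ++ a :: b :: t).
Proof.
rewrite !sgs_cat /= !big_cons (sgC a b).
have -> : \prod_(c <- p) \prod_(d <- [:: b, a & t]) sg c d =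
          \prod_(c <- p) \prod_(d <- [:: a, b & t]) sg c d.
  by apply: eq_bigr => c _; rewrite !big_cons mulrCA.
by ring.
Qed.

Lemma sgs_cons a l : uniq (a :: l) ->
  sgs (a :: l) = (-1) ^+ count (fun x => (key x < key a)%N) l * sgs l.
Proof.
move=> /= /andP[al _]; congr (_ * _).
elim: l al => [|b l IH]; first by rewrite big_nil.
rewrite inE negb_or big_cons exprD /= => /andP[ab /IH ->]; congr (_ * _).
rewrite /sg (negPf ab) ltnNge leq_eqVlt (inj_eq key_inj) eq_sym (negPf ab) /=.
by case: (_ < _)%N.
Qed.

Lemma sgs_sqr s : uniq s -> sgs s * sgs s = 1.
Proof.
elim: s => [|a s IH] us; first exact: mulr1.
rewrite sgs_cons // mulrACA -expr2 sqrr_sign mul1r IH //.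
by case/andP: us.
Qed.

Lemma sgs_dup s : ~~ uniq s -> sgs s = 0.
Proof.
elim: s => //= a s IH; rewrite negb_and negbK => /orP[|/IH ->]; last exact: mulr0.
case/splitPr => s1 s2; rewrite big_cat big_cons /=.
by rewrite {2}/sg eqxx ltnn mul0r mulr0 mul0r.
Qed.

Definition rep q a s := [seq if x == q then a else x | x <- s].

Lemma rep_notin q a s : q \notin s -> rep q a s = s.
Proof.
move=> qs; rewrite /rep -[RHS]map_id; apply/eq_in_map => x xs /=.
by case: eqP xs qs => // -> ->.
Qed.

Lemma size_rep q a s : size (rep q a s) = size s. Proof. exact: size_map. Qed.

Lemma perm_rep q a s : uniq s -> q \in s -> perm_eq (rep q a s) (a :: rem q s).
Proof.
move=> us qs; have h := perm_to_rem qs.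
have qr : q \notin rem q s by rewrite mem_rem_uniqF.
rewrite (permPl (perm_map _ h)) /= eqxx perm_cons.
by rewrite -/(rep q a (rem q s)) rep_notin.
Qed.

Lemma sgs_rep q a s : uniq s -> q \in s -> a \notin s ->
  sgs (rep q a s) * sgs s =
  (-1) ^+ (count (fun x => (key x < key a)%N) (rem q s) +
           count (fun x => (key x < key q)%N) (rem q s)).
Proof.
move=> us qs as_; pose h t := sgs (rep q a t) * sgs t.
have qr : q \notin rem q s by rewrite mem_rem_uniqF.
have ar : a \notin rem q s by apply: contra as_ => /mem_rem.
have ur : uniq (rem q s) by rewrite rem_uniq.
have -> : sgs (rep q a s) * sgs s = h (q :: rem q s).
  apply: (perm_swap_eq (f := h)) (perm_to_rem qs) => p b c t.
  by rewrite /h /rep !map_cat /= sgs_swap [sgs (p ++ _)]sgs_swap mulrNN.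
rewrite /h /= eqxx -/(rep q a _) rep_notin // -!/(sgs (_ :: _)).
by rewrite !sgs_cons /= ?ar ?qr // mulrACA sgs_sqr // mulr1 exprD.
Qed.

Variable n : nat.
Implicit Types (V : T -> 'rV[R]_n).

(** Words shorter than [n] are padded with zero rows and longer ones are truncated. *)
Definition rowdet V s : R := \det (\matrix_(i < n) nth 0 [seq V x | x <- s] i).

Lemma rowdet_swap V p a b t : size (p ++ a :: b :: t) = n ->
  rowdet V (p ++ b :: a :: t) = - rowdet V (p ++ a :: b :: t).
Proof.
rewrite size_cat /= => sz.
have i0P : (size p < n)%N by lia.
have i1P : ((size p).+1 < n)%N by lia.
have ne : Ordinal i0P != Ordinal i1P by rewrite -val_eqE /=; lia.
pose M := \matrix_(i < n) nth 0 [seq V x | x <- p ++ a :: b :: t] i.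
rewrite /rowdet (_ : \matrix_i _ = xrow (Ordinal i0P) (Ordinal i1P) M).
  by rewrite xrowE det_mulmx det_perm odd_tperm ne expr1 mulN1r.
apply/row_matrixP => i; rewrite xrowEsub !rowK.
rewrite /M; apply/rowP => j; rewrite !mxE !map_cat /= !nth_cat !size_map.
case: tpermP => [->|->|/eqP i0 /eqP i1] /=.
- by rewrite ltnn subnn ltnNge leqnSn /= subSnn.
- by rewrite ltnn subnn ltnNge leqnSn /= subSnn.
case: ltnP => // pi; have : (i - size p = (i - size p).-2.+2)%N.
  by move: i0 i1; rewrite -!val_eqE /=; lia.
by move=> ->.
Qed.

Lemma rowdet_dup V s : size s = n -> ~~ uniq s -> rowdet V s = 0.
Proof.
case: s => // x0 s; move: (x0 :: s) => {}s sz /(uniqPn x0)[i [j [ij js e]]].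
have jn : (j < n)%N by rewrite -sz.
have jn' := ltn_trans ij jn.
apply: (determinant_alternate (i1 := Ordinal jn') (i2 := Ordinal jn)).
  by rewrite -val_eqE /= ltn_eqF.
by move=> k; rewrite !mxE /= !(nth_map x0) ?e //; lia.
Qed.

Lemma rowdet_perm V s t : perm_eq s t -> size s = n ->
  sgs s * rowdet V s = sgs t * rowdet V t.
Proof.
move=> st sz; pose f u := if size u == n then sgs u * rowdet V u else 0.
have : f s = f t.
  apply: perm_swap_eq st => p a b q; rewrite /f.
  have -> : size (p ++ b :: a :: q) = size (p ++ a :: b :: q) by rewrite !size_cat.
  by case: eqP => // h; rewrite [in RHS]sgs_swap [in RHS]rowdet_swap // mulrNN.
by rewrite /f -(perm_size st) sz eqxx.
Qed.

Lemma cramer_row (M : 'M[R]_n) (v : 'rV[R]_n) (r : 'I_n) :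
  \det (\matrix_i if i == r then v else row i M) = (v *m \adj M) 0 r.
Proof.
rewrite (expand_det_row _ r) mxE; apply: eq_bigr => j _.
rewrite !mxE eqxx; congr (_ * (_ * \det _)).
by apply/matrixP => i k; rewrite !mxE eq_sym (negPf (neq_lift _ _)) mxE.
Qed.

Lemma rowdet_cons V l : (size l).+1 = n ->
  exists c : 'I_n -> R, forall x, rowdet V (x :: l) = \sum_j V x 0 j * c j.
Proof.
move=> sz; have n0 : (0 < n)%N by rewrite -sz.
(* Cofactors along the first row ignore that row, hence the placeholder 0. *)
exists (fun j => cofactor (\matrix_(i < n) nth 0 (0 :: [seq V x | x <- l]) i)
  (Ordinal n0) j).
move=> x; rewrite /rowdet (expand_det_row _ (Ordinal n0)); apply: eq_bigr => j _.
rewrite !mxE; congr (_ * (_ * \det _)).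
by apply/matrixP => i k; rewrite !mxE.
Qed.

Lemma rowdet_rep V s a (r : 'I_n) : uniq s -> size s = n ->
  rowdet V (rep (nth a s r) a s) =
  (V a *m \adj (\matrix_(i < n) nth 0 [seq V x | x <- s] i)) 0 r.
Proof.
move=> us sz; rewrite -cramer_row; congr (\det _); apply/row_matrixP => i; rewrite !rowK.
rewrite -map_comp (nth_map a) ?sz // /= nth_uniq ?sz //.
by rewrite val_eqE; case: eqP => // _; rewrite (nth_map a) ?sz.
Qed.

(** Cramer's rule: the entries of [V a *m \adj M] are the determinants with one row replaced by
    [V a], and multiplying by [M] gives back [\det M *: V a]. The other determinant is linear in its
    first row. *)
Lemma rowdet_exchange V s a l : uniq s -> size s = n -> (size l).+1 = n ->
  rowdet V s * rowdet V (a :: l) =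
  \sum_(q <- s) rowdet V (rep q a s) * rowdet V (q :: l).
Proof.
move=> us sz szl; have [c cE] := rowdet_cons V szl.
pose M := \matrix_(i < n) nth 0 [seq V x | x <- s] i.
rewrite (big_nth a) big_mkord sz.
under eq_bigr => r _ do rewrite rowdet_rep // cE.
have : (V a *m \adj M) *m M = rowdet V s *: V a.
  by rewrite -mulmxA mul_adj_mx mul_mx_scalar.
move=> /rowP h.
under eq_bigr => r _ do rewrite big_distrr.
rewrite exchange_big /= cE big_distrr; apply: eq_bigr => j _ /=.
have := h j; rewrite !mxE => e; rewrite mulrA -e big_distrl.
apply: eq_bigr => r _; rewrite /M !mxE (nth_map a) ?sz //.
by rewrite mulrA.
Qed.

End Words.

(** * Solutions of the Plucker relations as minors *)

Section Realization.
Local Open Scope ring_scope.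
Variables (N : nat) (R : idomainType) (g : {set 'I_N} -> R).
Hypothesis plucker : forall Q B : {set 'I_N},
  \sum_(q in Q :\: B) (-1) ^+ (rank_in Q q + rank_in B q) *
     (g (Q :\ q) * g (q |: B)) = 0.
Implicit Types (a q : 'I_N) (s l : seq 'I_N).

(** The alternating extension of [g] to words, the form comparable with [rowdet]. *)
Definition gword s : R := sgs val R s * g [set i in s].

Lemma rank_in_seq s q : uniq s ->
  rank_in [set i in s] q = count (fun x : 'I_N => (x < q)%N) s.
Proof.
move=> us; rewrite /rank_in -size_filter -(card_uniqP (filter_uniq _ us)).
by apply: eq_card => i; rewrite !inE mem_filter andbC.
Qed.

Lemma set_cons a l : [set i in a :: l] = a |: [set i in l].
Proof. by apply/setP => i; rewrite !inE. Qed.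

Lemma gword_dup s : ~~ uniq s -> gword s = 0.
Proof. by move=> /(sgs_dup val R); rewrite /gword => ->; rewrite mul0r. Qed.

Lemma set_rep q a s : uniq s -> q \in s -> [set i in rep q a s] = a |: ([set i in s] :\ q).
Proof.
move=> us qs; apply/setP => i; rewrite !inE (perm_mem (perm_rep a us qs)) inE.
by rewrite (mem_rem_uniq _ us) inE.
Qed.

Lemma gword_exchange s a l : uniq s -> uniq (a :: l) -> a \notin s ->
  gword s * gword (a :: l) = \sum_(q <- s) gword (rep q a s) * gword (q :: l).
Proof.
move=> us ual as_; have [al ul] := andP ual.
set Q := a |: [set i in s]; set B := [set i in l].
have := plucker Q B; rewrite (bigD1 a) /=; last by rewrite !inE eqxx al.
have -> : Q :\ a = [set i in s] by rewrite setU1K // inE.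
rewrite -[a |: B]set_cons => e.
have sg2 k : (-1) ^+ k * (-1) ^+ k = 1 :> R by rewrite -expr2 sqrr_sign.
(* The sign that turns the term of [a] into [gword s * gword (a :: l)]. *)
pose c : R := sgs val R s * sgs val R (a :: l) * (-1) ^+ (rank_in Q a + rank_in B a).
have cE : c * (-1) ^+ (rank_in Q a + rank_in B a) = sgs val R s * sgs val R (a :: l).
  by rewrite /c -[LHS]mulrA sg2 mulr1.
transitivity (- \sum_(q in Q :\: B | q != a) c * ((-1) ^+ (rank_in Q q + rank_in B q) *
     (g (Q :\ q) * g (q |: B)))).
  rewrite -big_distrr /= -mulrN; move/eqP: e; rewrite addr_eq0 => /eqP <-.
  by rewrite [RHS]mulrA cE /gword mulrACA.
rewrite -sumrN (big_uniq _ us) /=.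
rewrite [RHS](bigID (fun q => q \in l)) /= [X in _ = X + _]big1 ?add0r; last first.
  by move=> q /andP[_ ql]; rewrite [gword (q :: l)]gword_dup ?mulr0 //= ql.
apply: eq_big => [q|q].
  rewrite !inE; case: (eqVneq q a) => [->|] /=; first by rewrite (negPf as_) andbF.
  by rewrite andbT andbC.
rewrite !inE => /andP[/andP[ql]]; case: (eqVneq q a) => //= qa qs _.
have uql : uniq (q :: l) by rewrite /= ql.
have h : sgs val R (rep q a s) * sgs val R s =
    (-1) ^+ (count (fun x : 'I_N => (x < a)%N) (rem q s) +
             count (fun x : 'I_N => (x < q)%N) (rem q s)).
  exact (sgs_rep val_inj R us qs as_).
have -> : gword (rep q a s) = sgs val R s * (sgs val R (rep q a s) * sgs val R s) * g (Q :\ q).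
  rewrite [X in _ = X * _]mulrCA (sgs_sqr val_inj) // mulr1 /gword set_rep //; congr (_ * g _).
  by apply/setP => i; rewrite !inE; case: (eqVneq i a) => [->|] //; rewrite eq_sym qa.
have rQ (x : 'I_N) : rank_in Q x = ((a < x) + ((q < x) + count (fun y : 'I_N => (y < x)%N) (rem q s)))%N.
  have -> : Q = [set i in a :: s] by rewrite set_cons.
  rewrite rank_in_seq /= ?as_ //.
  by rewrite (seq.permP (perm_to_rem qs)).
have sB x : uniq (x :: l) -> sgs val R (x :: l) = (-1) ^+ rank_in B x * sgs val R l.
  by move=> uxl; rewrite (sgs_cons val_inj R uxl) rank_in_seq //; case/andP: uxl.
rewrite h /c /gword !set_cons -/B !sB //.
rewrite !rQ !ltnn; set ca := count _ _; set cq := count _ _.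
have -> : (q < a)%N = ~~ (a < q)%N by rewrite -leqNgt ltn_neqAle val_eqE qa.
rewrite !exprD; set sl := sgs val R l; set ss := sgs val R s.
case: (a < q)%N => /=; rewrite !expr0 !expr1.
  transitivity (- (ss * ((-1) ^+ rank_in B a * (-1) ^+ rank_in B a) * sl * -1 * (-1) ^+ ca * (-1) ^+ cq *
    (-1) ^+ rank_in B q * (g (Q :\ q) * g (q |: B)))); first by ring.
  by rewrite sg2; ring.
transitivity (- (ss * ((-1) ^+ rank_in B a * (-1) ^+ rank_in B a) * sl * -1 * (-1) ^+ ca * (-1) ^+ cq *
    (-1) ^+ rank_in B q * (g (Q :\ q) * g (q |: B)))); first by ring.
by rewrite sg2; ring.
Qed.

Lemma gword_perm s t : perm_eq s t -> sgs val R s * gword s = sgs val R t * gword t.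
Proof.
move=> st; have [us|us] := boolP (uniq s); last first.
  by rewrite !gword_dup ?mulr0 // -(perm_uniq st).
rewrite /gword !mulrA !(sgs_sqr val_inj) -?(perm_uniq st) //; congr (_ * g _).
by apply/setP => i; rewrite !inE (perm_mem st).
Qed.

Variable n : nat.

Section Rigidity.
Variables (P : 'I_N -> 'rV[R]_n) (s0 : seq 'I_N).
Let D := rowdet P.
Hypotheses (us0 : uniq s0) (sz0 : size s0 = n).
Hypotheses (F0 : gword s0 != 0) (D0 : D s0 != 0).
Hypothesis near : forall q a, q \in s0 -> a \notin s0 ->
  D s0 * gword (rep q a s0) = gword s0 * D (rep q a s0).

(** Exchanging against [s0] replaces a letter of [t] outside [s0] by one of [s0], so everything is
    determined by the words one replacement away from [s0]. The values at [s0] are cancelled, which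
    requires a domain. *)
Lemma rigidity t : uniq t -> size t = n -> D s0 * gword t = gword s0 * D t.
Proof.
have [k] := ubnP (count (fun x => x \notin s0) t).
elim: k t => // k IH t tk ut szt.
have lift t' : perm_eq t t' -> D s0 * gword t' = gword s0 * D t' ->
    D s0 * gword t = gword s0 * D t.
  move=> tt' e; have ut' : uniq t' by rewrite -(perm_uniq tt').
  have gE : gword t = sgs val R t * (sgs val R t' * gword t').
    by rewrite -(gword_perm tt') mulrA (sgs_sqr val_inj) // mul1r.
  have dE : D t = sgs val R t * (sgs val R t' * D t').
    by rewrite /D -(rowdet_perm val_inj P tt' szt) mulrA (sgs_sqr val_inj) // mul1r.
  rewrite gE dE.
  transitivity (sgs val R t * sgs val R t' * (D s0 * gword t')); first by ring.
  by rewrite e; ring.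
have [/allP ts|/allPn[a at_ as_]] := boolP (all (fun x => x \in s0) t).
  apply: (lift s0); last by rewrite mulrC.
  apply: uniq_perm => // x; apply: (uniq_min_size ut ts _).2.
  by rewrite sz0 szt.
apply: (lift _ (perm_to_rem at_)); set l := rem a t.
have ual : uniq (a :: l) by rewrite -(perm_uniq (perm_to_rem at_)).
have szl : (size l).+1 = n by rewrite -szt (perm_size (perm_to_rem at_)).
have lk : (count (fun x => x \notin s0) l < k)%N.
  by move: tk; rewrite (seq.permP (perm_to_rem at_)) -/l /= as_ add1n ltnS.
have FE := gword_exchange us0 ual as_.
have DE := rowdet_exchange P a us0 sz0 szl.
apply: (mulfI (mulf_neq0 F0 D0)).
transitivity (D s0 * D s0 * (gword s0 * gword (a :: l))); first by ring.
transitivity (gword s0 * gword s0 * (D s0 * D (a :: l))); last by rewrite mulrACA.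
rewrite FE DE [LHS]big_distrr [RHS]big_distrr /=; apply: eq_big_seq => q qs.
have [ql|ql] := boolP (q \in l).
  have dup : ~~ uniq (q :: l) by rewrite /= ql.
  by rewrite (gword_dup dup) (rowdet_dup P _ dup) ?mulr0.
transitivity ((D s0 * gword (rep q a s0)) * (D s0 * gword (q :: l))); first by rewrite mulrACA.
rewrite near // IH; first by rewrite mulrACA.
- by rewrite /= qs.
- by rewrite /= ql; case/andP: ual.
by rewrite /=.
Qed.

End Rigidity.

Lemma realization : exists c h : R, exists P : 'I_N -> 'rV[R]_n,
  c != 0 /\ forall s, uniq s -> size s = n -> c * gword s = h * rowdet P s.
Proof.
have [|no] := boolP [exists t : n.-tuple 'I_N, uniq t && (gword t != 0)]; last first.
  exists 1, 0, (fun=> 0); split=> [|s us sz]; first exact: oner_neq0.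
  rewrite mul0r mul1r; apply/eqP; move: no; apply: contraNT => gs.
  have szP : size s == n by apply/eqP.
  by apply/existsP; exists (Tuple szP); rewrite us.
move=> /existsP[t /andP[ut F0]]; set s0 : seq 'I_N := t.
have sz0 : size s0 = n by rewrite size_tuple.
(* Up to the factor [gword s0], kept to avoid a division, these are the coordinates of [j] in the
   basis [s0]. At [s0] itself the matrix is scalar, since an entry off the diagonal comes from a
   word with a repeated letter. *)
pose P j : 'rV[R]_n := \row_(r < n) gword (rep (nth j s0 r) j s0).
have ME : \matrix_(i < n) nth 0 [seq P x | x <- s0] i = (gword s0)%:M.
  apply/matrixP => i r; rewrite !mxE.
  have x0 : 'I_N by move: (tnth t i).
  rewrite (nth_map x0) ?sz0 // mxE (set_nth_default x0) ?sz0 //.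
  have [->|ir] := eqVneq i r.
    rewrite mulr1n; congr gword; rewrite /rep -[RHS]map_id; apply/eq_map => x /=.
    by case: eqP.
  rewrite mulr0n gword_dup //; apply/(uniqPn x0).
  have key (k k' : 'I_n) : (k = i /\ k' = r) \/ (k = r /\ k' = i) ->
      nth x0 (rep (nth x0 s0 r) (nth x0 s0 i) s0) k = nth x0 s0 i.
    move=> h; rewrite (nth_map x0) ?sz0 // nth_uniq ?sz0 //.
    by case: h => -[-> _]; rewrite ?eqxx // val_eqE (negPf ir).
  have ki := key i r (or_introl (conj erefl erefl)).
  have kr := key r i (or_intror (conj erefl erefl)).
  move: ir; rewrite -val_eqE neq_ltn => /orP[] lt.
    by exists i, r; rewrite size_rep sz0 ki kr.
  by exists r, i; rewrite size_rep sz0 ki kr.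
have DE : rowdet P s0 = gword s0 ^+ n by rewrite /rowdet ME det_scalar.
exists (rowdet P s0), (gword s0), P; split; first by rewrite DE expf_neq0.
apply: rigidity => //; first by rewrite DE expf_neq0.
move=> q a qs as_; have [r rn <-] : exists2 r, (r < n)%N & nth a s0 r = q.
  by exists (index q s0); rewrite ?nth_index // -sz0 index_mem.
rewrite (rowdet_rep P a (Ordinal rn)) // ME.
have adjE : gword s0 *: \adj ((gword s0)%:M : 'M_n) = (gword s0 ^+ n)%:M.
  by rewrite -det_scalar -mul_adj_mx mul_mx_scalar.
transitivity ((P a *m (gword s0 *: \adj ((gword s0)%:M : 'M_n))) 0 (Ordinal rn)).
  by rewrite adjE mul_mx_scalar mxE DE mxE.
by rewrite -scalemxAr mxE.
Qed.

End Realization.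

(** * Laplace expansion in two blocks and the three-term relation *)

Section Laplace.
Local Open Scope ring_scope.
Variables (T : finType) (key : T -> nat).
Hypothesis key_inj : injective key.
Variables (R : comNzRingType) (n : nat).
Implicit Types (s l : seq T) (C : {set T}).

Lemma rowdet_short (V : T -> 'rV[R]_n) s : (size s < n)%N -> rowdet V s = 0.
Proof.
move=> sn; rewrite /rowdet (expand_det_row _ (Ordinal sn)) big1 // => j _.
by rewrite mxE nth_default ?size_map //= mxE mul0r.
Qed.

Variables X Y : T -> 'rV[R]_n.

Definition row_choice C x : 'rV[R]_(n + n) :=
  if x \in C then row_mx (X x) 0 else row_mx 0 (Y x).

(** No length is imposed on [c1]: if it is not [n], one of the two words is too short, and the
    matching diagonal block has a zero row, so both sides vanish. *)
Lemma rowdet_block C c1 c2 : size (c1 ++ c2) = (n + n)%N ->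
  {subset c1 <= C} -> {in c2, forall x, x \notin C} ->
  rowdet (row_choice C) (c1 ++ c2) = rowdet X c1 * rowdet Y c2.
Proof.
rewrite size_cat => sz c1C c2C.
pose M := \matrix_(i < n + n) nth 0 [seq row_choice C x | x <- c1 ++ c2] i.
have rowE (i : nat) : nth 0 [seq row_choice C x | x <- c1 ++ c2] i =
    row_mx (nth 0 [seq X x | x <- c1] i)
           (if (i < size c1)%N then 0 else nth 0 [seq Y x | x <- c2] (i - size c1)).
  rewrite map_cat nth_cat size_map; case: ltnP => ic.
    have x0 : T by case: (c1) ic => // x.
    by rewrite !(nth_map x0) // /row_choice c1C // mem_nth.
  rewrite [nth 0 [seq X x | x <- c1] i]nth_default ?size_map //.
  case: (ltnP (i - size c1) (size c2)) => ic2; last first.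
    by rewrite !nth_default ?size_map // row_mx0.
  have x0 : T by case: (c2) ic2 => // x.
  by rewrite !(nth_map x0) // /row_choice (negPf (c2C _ _)) // mem_nth.
have ulE : ulsubmx M = \matrix_(i < n) nth 0 [seq X x | x <- c1] i.
  by apply/matrixP => i j; rewrite !mxE rowE row_mxEl.
have MB : M = block_mx (ulsubmx M) (ursubmx M) (dlsubmx M) (drsubmx M) by rewrite submxK.
have detM : \det M = \det (ulsubmx M) * \det (drsubmx M).
  case: (leqP n (size c1)) => h.
    have ur0 : ursubmx M = 0.
      by apply/matrixP => i j; rewrite !mxE rowE row_mxEr (leq_trans (ltn_ord i) h) mxE.
    by rewrite {1}MB ur0 det_lblock.
  have dl0 : dlsubmx M = 0.
    apply/matrixP => i j; rewrite !mxE rowE row_mxEl nth_default ?mxE // size_map.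
    exact: leq_trans (ltnW h) (leq_addr _ _).
  by rewrite {1}MB dl0 det_ublock.
transitivity (\det M); first by [].
rewrite detM ulE -[\det (\matrix_i _)]/(rowdet X c1).
case: (ssrnat.ltngtP (size c1) n) => h.
- by rewrite rowdet_short // !mul0r.
- rewrite [rowdet Y c2]rowdet_short ?mulr0; last first.
    by rewrite -(ltn_add2l (size c1)) sz ltn_add2r.
  have n0 : (0 < n)%N by case: (n) sz h; case: (c1).
  rewrite (expand_det_row _ (Ordinal n0)) big1 ?mulr0 // => j _.
  by rewrite !mxE rowE row_mxEr /= addn0 h mxE mul0r.
congr (_ * \det _); apply/matrixP => i j; rewrite !mxE rowE row_mxEr /=.
by rewrite h ltnNge leq_addr /= addKn.
Qed.

(** Each row is the sum of its left and right halves; multilinearity gives a sum over the set [C] of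
    rows that keep the left half, and bringing these to the front makes the matrix block
    triangular. *)
Lemma laplace s : uniq s -> size s = (n + n)%N ->
  sgs key R s * rowdet (fun x => row_mx (X x) (Y x)) s =
  \sum_(C : {set T} | C \subset s)
    sgs key R ([seq x <- s | x \in C] ++ [seq x <- s | x \notin C]) *
    (rowdet X [seq x <- s | x \in C] * rowdet Y [seq x <- s | x \notin C]).
Proof.
move=> us sz.
transitivity (\sum_(C : {set T} | C \subset s) sgs key R s * rowdet (row_choice C) s); last first.
  apply: eq_bigr => C _.
  have h : perm_eq s ([seq x <- s | x \in C] ++ [seq x <- s | x \notin C]).
    by rewrite perm_sym; apply/permEl/(perm_filterC (mem C)).
  rewrite (rowdet_perm key_inj _ h) // rowdet_block //.
  - by rewrite -(perm_size h).
  - by move=> x; rewrite mem_filter => /andP[].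
  - by move=> x; rewrite mem_filter => /andP[].
rewrite -big_distrr /=; congr (_ * _).
have [n0|n0] := posnP n.
  have s0 : s = [::] by apply: size0nil; rewrite sz n0.
  rewrite (big_pred1 set0) => [|C]; last first.
    by rewrite s0; apply/subsetP/eqP => [h|-> x]; [apply/setP => x; rewrite inE; apply/negP => /h | rewrite inE].
  by rewrite s0 /rowdet; congr (\det _); apply/matrixP => i; have := ltn_ord i; rewrite [X in (_ < X)%N]n0.
have x0 : T by case: (s) sz => [|x] //; rewrite /= -[in RHS](prednK n0).
pose F (J : {set 'I_(n + n)}) (i : 'I_(n + n)) : 'rV[R]_(n + n) :=
  if i \in J then row_mx (X (nth x0 s i)) 0 else row_mx 0 (Y (nth x0 s i)).
transitivity (\sum_(J : {set 'I_(n + n)}) \det (\matrix_i F J i)).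
  rewrite exchange_big /=; apply: eq_bigr => p _; rewrite -big_distrr /=; congr (_ * _).
  transitivity (\prod_(i < n + n) (row_mx (X (nth x0 s i)) 0 0 (p i) + row_mx 0 (Y (nth x0 s i)) 0 (p i))).
    apply: eq_bigr => i _; rewrite mxE (nth_map x0) ?sz //.
    by rewrite -[X in row_mx X _]addr0 -[X in row_mx _ X]add0r -add_row_mx mxE.
  rewrite bigA_distr; apply: eq_bigr => J _; apply: eq_bigr => i _.
  by rewrite mxE /F; case: (i \in J).
rewrite (reindex_onto (fun C : {set T} => [set i : 'I_(n + n) | nth x0 s i \in C])
                      (fun J : {set 'I_(n + n)} => [set nth x0 s i | i : 'I_(n + n) in J])) /=; last first.
  move=> J _; apply/setP => i; rewrite inE; apply/imsetP/idP => [[j jJ e]|iJ]; last by exists i.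
  suff -> : i = j by [].
  by apply/val_inj/eqP; rewrite /= -(@nth_uniq _ x0 s i j) ?sz ?ltn_ord //; apply/eqP.
apply: eq_big => [C|C _].
  apply/eqP/subsetP => [<- x /imsetP[i _ ->]|Cs]; first by rewrite mem_nth ?sz.
  apply/setP => x; apply/imsetP/idP => [[i]|xC]; first by rewrite inE => ? ->.
  have ix : (index x s < n + n)%N by rewrite -sz index_mem Cs.
  by exists (Ordinal ix); rewrite ?inE /= nth_index // Cs.
congr (\det _); apply/row_matrixP => i; rewrite !rowK /F inE.
by rewrite (nth_map x0) ?sz.
Qed.

End Laplace.

Section ThreeTerm.
Local Open Scope ring_scope.
Variables (T : eqType) (key : T -> nat).
Variables (R : comNzRingType) (n : nat) (V : T -> 'rV[R]_n).
Let D s := sgs key R s * rowdet V s.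

(** Exchange of [b] into [[:: a, c & l]] against [d :: l], the letters of [l] contributing repeated
    rows. Signs involving [l] are the same in the three products; the hypotheses on [sg] equate the
    others. *)
Lemma three_term a b c d l : uniq [:: a, b, c, d & l] -> (size l).+2 = n ->
  sg key R a c * sg key R b d = sg key R b c * sg key R a d ->
  sg key R a c * sg key R b d = sg key R a b * sg key R c d ->
  D [:: a, c & l] * D [:: b, d & l] =
  D [:: a, b & l] * D [:: c, d & l] + D [:: a, d & l] * D [:: b, c & l].
Proof.
move=> /= /and5P[+ + + dl ul]; rewrite !inE !negb_or.
move=> /and4P[ab ac ad al] /and3P[bc bd bl] /andP[cd cl] szl e1 e2.
have uacl : uniq [:: a, c & l] by rewrite /= inE negb_or ac al cl.
have := rowdet_exchange V b uacl szl (l := d :: l) szl.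
have ra : rep a b [:: a, c & l] = [:: b, c & l].
  by rewrite /rep /= eqxx [c == a]eq_sym (negPf ac) -/(rep a b l) rep_notin.
have rc : rep c b [:: a, c & l] = [:: a, b & l].
  by rewrite /rep /= (negPf ac) eqxx -/(rep c b l) rep_notin.
rewrite !big_cons ra rc big1_seq ?addr0; last first.
  move=> q /andP[_ ql]; rewrite [rowdet V [:: q, d & l]]rowdet_dup ?mulr0 //.
  by rewrite /= inE negb_or ql andbF.
move=> e.
rewrite /D /= !big_cons.
set pa := \prod_(x <- l) sg key R a x; set pb := \prod_(x <- l) sg key R b x.
set pc := \prod_(x <- l) sg key R c x; set pd := \prod_(x <- l) sg key R d x.
set z := sgs key R l.
transitivity (sg key R a c * sg key R b d * (pa * pb * pc * pd * z * z) *
   (rowdet V [:: a, c & l] * rowdet V [:: b, d & l])); first by ring.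
rewrite e mulrDr {1}e1 e2; ring.
Qed.

End ThreeTerm.

(** * The tripartite sum *)

Definition ranksum (N : nat) (S A : {set 'I_N}) := (\sum_(a in A) rank_in S a)%N.

Section RankSums.
Variable N : nat.
Implicit Types (S A B : {set 'I_N}).

Lemma rank_inE S i : rank_in S i = (\sum_(k in S) (k < i))%N.
Proof.
rewrite /rank_in -sum1dep_card big_mkcondr /=; apply: eq_bigr => k _.
by case: (_ < _)%N.
Qed.

Lemma ranksum_self A : ranksum A A = 'C(#|A|, 2).
Proof.
have e : (\sum_(a in A) rank_in A a = \sum_(a in A) \sum_(k in A) (a < k))%N.
  by under eq_bigr do rewrite rank_inE; rewrite exchange_big.
have h : (ranksum A A + ranksum A A = #|A| * #|A|.-1)%N.
  rewrite {2}/ranksum e /ranksum -big_split /= -sum_nat_const; apply: eq_bigr => a aA.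
  rewrite rank_inE -big_split /= (bigD1 a) //= ltnn add0n.
  rewrite (cardD1 a) aA /= -sum1_card; apply: eq_big => [k|k /andP[_]].
    by rewrite inE /= andbC.
  by rewrite -val_eqE /=; case: ssrnat.ltngtP.
by rewrite bin2 -h addnn doubleK.
Qed.

End RankSums.

Section Tripartite.
Variables (N p q : nat) (S : {set 'I_N}).
Hypothesis pq : (p <= q)%N.
Definition cls (i : nat) : nat := (p <= i) + (q <= i).
Let RS := [set i in S | (i < p)%N].
Let BS := [set i in S | (q <= i)%N].

Lemma cls_mono (i j : nat) : (i <= j)%N -> (cls i <= cls j)%N.
Proof. by rewrite /cls; lia. Qed.

Section OnePairing.
Variable s : 'I_N -> 'I_N.
Hypothesis nc : nc_pairing S s.
Hypothesis bi : {in S, forall i : 'I_N, cls i != cls (s i)}.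
Let Op := [set i in S | (i < s i)%N].
Let GO := [set i in S | (p <= i < q)%N && (i < s i)%N].
Let GC := [set i in S | (p <= i < q)%N && (s i < i)%N].

Lemma lt_partner i : i \in S -> (s i < i)%N = ~~ (i < s i)%N.
Proof.
by move=> iS; have := nc_neq nc iS; rewrite -val_eqE -leqNgt ltn_neqAle /= => ->.
Qed.

Lemma open_R i : i \in S -> (i < p)%N -> (i < s i)%N.
Proof.
move=> iS ip; have := bi iS; have := @cls_mono (s i) i.
by rewrite /cls; lia.
Qed.

Lemma close_B i : i \in S -> (q <= i)%N -> (s i < i)%N.
Proof.
move=> iS ip; have := bi iS; have := @cls_mono i (s i); have := nc_neq nc iS.
by rewrite -val_eqE /cls /=; lia.
Qed.

(** The partner of [j] lies below [p], so [i] is enclosed by that pair, and its partner, which is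
    not in the middle, lies below [p] too. Thus closers precede openers in the middle interval. *)
Lemma close_G_first i j : i \in S -> j \in S -> (p <= i)%N -> (i < j < q)%N ->
  (s j < j)%N -> (s i < i)%N.
Proof.
move=> iS jS pi /andP[ij jq] sj.
have sjS := nc_in nc jS; have siS := nc_in nc iS.
have bj := bi jS; have b_i := bi iS.
have sjp : (s j < p)%N by move: bj; rewrite /cls; lia.
have : (s j < i < s (s j))%N by rewrite (nc_inv nc jS) ij andbT; lia.
move=> /(nc_nest nc sjS iS); rewrite (nc_inv nc jS) => /andP[_ sij].
by move: b_i; rewrite /cls; lia.
Qed.

Lemma card_open : (#|Op| + #|Op| = #|S|)%N.
Proof.
have inj : {in Op &, injective s}.
  move=> i j; rewrite !inE => /andP[iS _] /andP[jS _] e.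
  by rewrite -(nc_inv nc iS) e (nc_inv nc jS).
rewrite -{2}(card_in_imset inj) -(cardsID Op S); congr (_ + _)%N.
  by apply: eq_card => i; rewrite !inE; case: (i \in S).
apply: eq_card => i; apply/imsetP/idP => [[j + ->]|].
  rewrite !inE => /andP[jS js]; rewrite (nc_in nc jS) (nc_inv nc jS) andbT.
  by rewrite /= -leqNgt ltnW.
rewrite !inE => /andP[io iS]; rewrite iS /= -lt_partner // in io.
by exists (s i); rewrite ?(nc_inv nc iS) // inE (nc_in nc iS) (nc_inv nc iS).
Qed.

Lemma OpE : Op = RS :|: GO.
Proof.
apply/setP => i; rewrite !inE; case iS: (i \in S) => //=.
case: (ltnP i p) => ip; first by rewrite open_R.
case: (ltnP i q) => iq //=; have := close_B iS iq.
by rewrite lt_partner // => /negPf ->.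
Qed.

Lemma CpE : S :\: Op = BS :|: GC.
Proof.
apply/setP => i; rewrite !inE; case iS: (i \in S); rewrite ?andbF //= andbT lt_partner //.
case: (ltnP i p) => ip /=; first by rewrite open_R //=; lia.
case: (ltnP i q) => iq //=; have := close_B iS iq.
by rewrite lt_partner // => ->.
Qed.

Lemma card_GO : (#|RS| + #|GO| = #|Op|)%N.
Proof.
rewrite OpE cardsU disjoint_setI0 ?cards0 ?subn0 //.
apply/pred0P => i /=; rewrite !inE; lia.
Qed.

Lemma card_GC : (#|BS| + #|GC| = #|Op|)%N.
Proof.
have -> : #|Op| = #|S :\: Op|.
  have := card_open; rewrite -(cardsID Op S).
  suff -> : S :&: Op = Op by lia.
  by apply/setP => i; rewrite !inE; case: (i \in S).
rewrite CpE cardsU disjoint_setI0 ?cards0 ?subn0 //.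
apply/pred0P => i /=; rewrite !inE; lia.
Qed.

(** A middle opener lies above every middle closer and no other closer; an opener below [p] lies
    above none. *)
Lemma cross_open : (\sum_(a in Op) rank_in (S :\: Op) a = #|GO| * #|GC|)%N.
Proof.
rewrite (bigID (fun i : 'I_N => i < p)%N) /= big1 ?add0n; last first.
  move=> i /andP[_ ip]; rewrite rank_inE big1 // => k; rewrite CpE !inE => kC.
  by apply/eqP; rewrite eqb0; lia.
rewrite -sum_nat_const; apply: eq_big => [i|i].
  rewrite !inE -leqNgt; case iS: (i \in S) => //=.
  case: (ltnP i q) => iq; first by rewrite andbT andbC.
  have := close_B iS iq; rewrite lt_partner // => /negPf ->.
  by rewrite !andbF.
rewrite inE -leqNgt => /andP[/andP[iS io] ip].
have iq : (i < q)%N.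
  by rewrite ltnNge; apply: contraL io => /(close_B iS); rewrite lt_partner.
apply: eq_card => k; rewrite inE CpE !inE.
case kS: (k \in S) => //=; case: (ltnP k i) => ki; rewrite ?andbT ?andbF.
  case: (leqP q k) => qk /=; first by lia.
  by rewrite andbT.
apply/esym/negbTE/negP => /andP[/andP[pk kq] ks].
move: ki; rewrite leq_eqVlt => /orP[/eqP/ord_inj ik|ki].
  by move: io ks; rewrite ik; lia.
have := close_G_first iS kS ip _ ks; rewrite ki kq => /(_ isT).
by rewrite lt_partner // io.
Qed.

(** [GO] and [GC] have |Op| - |RS| and |Op| - |BS| elements, so the sign depends on cardinalities
    alone and is common to all configurations. *)
Lemma odd_ranksum_open :
  odd (ranksum S Op) = odd ('C(#|Op|, 2) + (#|Op| + #|BS|) * (#|Op| + #|RS|)).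
Proof.
have -> : ranksum S Op = (ranksum Op Op + \sum_(a in Op) rank_in (S :\: Op) a)%N.
  rewrite /ranksum -big_split /=; apply: eq_bigr => a aO.
  rewrite !rank_inE (bigID (mem Op)) /=; congr (_ + _)%N; apply: eq_bigl => k; rewrite !inE.
    by case: (k \in S).
  by rewrite andbC.
rewrite ranksum_self cross_open !oddD; congr (_ (+) _).
rewrite !oddM !oddD; have := card_GO; have := card_GC.
move=> hC hO; rewrite -{1}hC -{1}hO !oddD.
by case: (odd #|BS|); case: (odd #|RS|); case: (odd #|GC|); case: (odd #|GO|).
Qed.

(** A bichromatic pair has an end in an outer class, where membership in [A] is prescribed; the
    split decides the other end. *)
Lemma in_open_split (A : {set 'I_N}) : A \subset S -> RS \subset A -> [disjoint A & BS] ->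
  {in S, forall i, (i \in A) != (s i \in A)} -> A = Op.
Proof.
move=> /subsetP AS /subsetP RA /pred0P AB sp; apply/setP => i.
have notB k : k \in S -> (q <= k)%N -> k \notin A.
  by move=> kS qk; have := AB k; rewrite /= inE kS qk /= andbT => ->.
have inR k : k \in S -> (k < p)%N -> k \in A.
  by move=> kS kp; apply: RA; rewrite inE kS.
case iS: (i \in S); last first.
  by rewrite inE iS; apply/negbTE/negP => /AS; rewrite iS.
have siS := nc_in nc iS; have h := sp i iS; have b := bi iS.
rewrite inE iS /=.
case: (ltnP i p) => ip; first by rewrite inR // open_R.
case: (leqP q i) => iq.
  by rewrite (negPf (notB _ iS iq)); apply/esym/negbTE; rewrite -lt_partner // close_B.
case: (ltnP i (s i)) => lt.
  have qs : (q <= s i)%N by move: b; rewrite /cls; lia.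
  by move: h; rewrite (negPf (notB _ siS qs)); case: (i \in A).
have sp' : (s i < p)%N by move: b; rewrite /cls; lia.
by move: h; rewrite (inR _ siS sp'); case: (i \in A).
Qed.

Lemma open_split : [/\ Op \subset S, RS \subset Op, [disjoint Op & BS] &
  {in S, forall i, (i \in Op) != (s i \in Op)}].
Proof.
split.
- by apply/subsetP => i; rewrite inE => /andP[].
- by rewrite OpE subsetUl.
- by apply/pred0P => i /=; rewrite OpE !inE; lia.
move=> i iS; rewrite !inE iS (nc_in nc iS) (nc_inv nc iS) /= lt_partner //.
by case: (_ < _)%N.
Qed.

End OnePairing.

(** The middle closers are an initial segment of the middle interval whose length is fixed by the
    cardinalities. Hence both matchings have the same openers, and a word of brackets determines its
    matching. *)
Lemma tripartite_unique s s' : nc_pairing S s -> nc_pairing S s' ->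
  {in S, forall i : 'I_N, cls i != cls (s i)} -> {in S, forall i : 'I_N, cls i != cls (s' i)} ->
  {in S, s =1 s'}.
Proof.
have GCsub s1 s2 : nc_pairing S s1 -> nc_pairing S s2 ->
    {in S, forall i : 'I_N, cls i != cls (s1 i)} -> {in S, forall i : 'I_N, cls i != cls (s2 i)} ->
    forall i : 'I_N, i \in S -> (p <= i < q)%N -> (s1 i < i)%N -> (s2 i < i)%N.
  move=> n1 n2 b1 b2 i iS /andP[pi iq] s1i; rewrite (lt_partner n2) //; apply/negP => s2i.
  have := card_GC n1 b1; have := card_GC n2 b2.
  have := card_open n1; have := card_open n2.
  set c1 := #|[set j in S | (p <= j < q)%N & (s1 j < j)%N]|.
  set c2 := #|[set j in S | (p <= j < q)%N & (s2 j < j)%N]|.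
  (* The counts give [c1 = c2]. But if [i] opens for [s2], all middle closers of [s2] lie before [i]
     and also close for [s1], which closes at [i] in addition. *)
  suff : (c2 < c1)%N by lia.
  apply/proper_card/properP; split; last first.
    by exists i; rewrite !inE iS pi iq //= (lt_partner n2) // s2i.
  apply/subsetP => j; rewrite !inE => /andP[jS /andP[/andP[pj jq] s2j]].
  rewrite jS pj jq /=; case: (ssrnat.ltngtP j i) => ji.
  - by apply: (close_G_first n1 b1 (j := i)) => //; rewrite ji.
  - have := close_G_first n2 b2 iS jS pi _ s2j; rewrite ji jq => /(_ isT).
    by rewrite (lt_partner n2) // s2i.
  by rewrite (ord_inj ji).
move=> n1 n2 b1 b2.
have op (i : 'I_N) : i \in S -> (i < s i)%N = (i < s' i)%N.
  move=> iS; case: (ltnP i p) => ip.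
    by rewrite (open_R b1) // (open_R b2).
  case: (leqP q i) => qi.
    have := close_B n1 b1 iS qi; have := close_B n2 b2 iS qi.
    by rewrite (lt_partner n1) // (lt_partner n2) // => /negPf -> /negPf ->.
  apply/negb_inj; rewrite -(lt_partner n1) // -(lt_partner n2) //.
  have h : (p <= i < q)%N by rewrite ip.
  by apply/idP/idP; apply: GCsub.
have close k : forall j : 'I_N, (j < k)%N -> j \in S -> (s j < j)%N -> s j = s' j.
  elim: k => // k IH j jk jS sj.
  (* The label [i = s2 j] would be enclosed by the [s1]-pair of [j], so [s1 i] would be a closer
     before [j]. Both matchings agree there by induction, whence [s2 i = s1 i], which is not [j]. *)
  have half s1 s2 : nc_pairing S s1 -> nc_pairing S s2 ->
      (forall i : 'I_N, i \in S -> (i < s1 i)%N = (i < s2 i)%N) ->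
      (forall i : 'I_N, (i < j)%N -> i \in S -> (s1 i < i)%N -> s1 i = s2 i) ->
      (s1 j < j)%N -> ~ (s1 j < s2 j < j)%N.
    move=> m1 m2 o12 ih s1j lt; set i := s2 j in lt.
    have iS : i \in S by apply: nc_in m2 _ jS.
    have s1S := nc_in m1 jS.
    have := nc_nest m1 s1S iS; rewrite (nc_inv m1 jS) => /(_ lt) /andP[_ s1i].
    have io : (i < s1 i)%N.
      by rewrite o12 // /i (nc_inv m2 jS); case/andP: lt.
    have := ih _ s1i (nc_in m1 iS); rewrite (nc_inv m1 iS) => /(_ io) e.
    have : s2 i = s1 i by rewrite {1}e (nc_inv m2) // (nc_in m1).
    by rewrite /i (nc_inv m2 jS) => e'; rewrite e' ltnn in s1i.
  have s'j : (s' j < j)%N by rewrite (lt_partner n2) // -op // -(lt_partner n1).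
  have ih (i : 'I_N) : (i < j)%N -> i \in S -> (s i < i)%N -> s i = s' i.
    by move=> ij; apply: IH; lia.
  apply: ord_inj; case: (ssrnat.ltngtP (s j) (s' j)) => // lt.
    by case: (half s s' n1 n2 op ih sj); rewrite lt.
  have [] // := half s' s n2 n1 (fun i iS => esym (op i iS)) _ s'j; last by rewrite lt.
  move=> i ij iS s'i; apply/esym/ih => //.
  by rewrite (lt_partner n1) // op // -(lt_partner n2).
move=> i iS; case lt: (s i < i)%N; first exact: (close i.+1).
have := lt; rewrite (lt_partner n1) // => /negbFE; rewrite op // => lt'.
have e := close (s' i).+1 (s' i) (ltnSn _) (nc_in n2 iS).
have : (s (s' i) < s' i)%N.
  rewrite (lt_partner n1) ?op ?(nc_in n2) // (nc_inv n2 iS).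
  by rewrite -leqNgt ltnW.
move=> /e; rewrite (nc_inv n2 iS) => e'.
by rewrite -{1}e' (nc_inv n1) // (nc_in n2).
Qed.

End Tripartite.

(** * Pairings as set partitions and as involutions *)

Section PairingSets.
Variables (N : nat) (S : {set 'I_N}).
Implicit Types (s : 'I_N -> 'I_N) (tau : {set {set 'I_N}}).

Lemma pairing_of_set tau : is_pairing S tau -> planar_pairing tau ->
  exists2 s, nc_pairing S s &
    forall i j, i \in S -> i != j -> ([set i; j] \in tau) = (j == s i).
Proof.
move=> /andP[part /forallP sz] /forallP pl.
have [/eqP cov_tau triv n0] := and3P part.
have blockP i : i \in S -> (pblock tau i \in tau) && (i \in pblock tau i).
  by move=> iS; rewrite mem_pblock pblock_mem cov_tau.
pose s i := odflt i [pick j in pblock tau i | j != i].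
have sP i : i \in S -> pblock tau i = [set i; s i] /\ s i != i.
  move=> iS; have /andP[bt ib] := blockP i iS.
  have b2 : #|pblock tau i| = 2 by apply/eqP/(implyP (sz _)).
  rewrite /s; case: pickP => [j /andP[jb ji]|h] /=; last first.
    have : (0 < #|pblock tau i :\ i|)%N by move: b2; rewrite (cardsD1 i) ib; lia.
    by move=> /card_gt0P[j]; rewrite in_setD1 andbC; have := h j; rewrite /= => ->.
  split=> //; apply/esym/eqP; rewrite eqEcard cards2 b2 eq_sym ji andbT.
  by apply/subsetP => k /set2P[] ->.
have sS i : i \in S -> s i \in S.
  move=> iS; have [bE _] := sP i iS; have /andP[bt _] := blockP i iS.
  by rewrite -cov_tau; apply/bigcupP; exists (pblock tau i); rewrite // bE !inE eqxx orbT.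
have same i : i \in S -> pblock tau (s i) = pblock tau i.
  move=> iS; have [bE _] := sP i iS; have /andP[bt _] := blockP i iS.
  by apply: def_pblock => //; rewrite bE !inE eqxx orbT.
have sK i : i \in S -> s (s i) = i.
  move=> iS; have [bE si] := sP i iS; have [bE' si'] := sP _ (sS i iS).
  have : i \in pblock tau (s i) by rewrite same // bE !inE eqxx.
  by rewrite bE' !inE eq_sym (negPf si) /= => /eqP.
have inj i k : i \in S -> k \in S -> k != i -> k != s i -> (s k != i) && (s k != s i).
  move=> iS kS ki ksi; apply/andP; split; apply/eqP => e.
    by move: ksi; rewrite -e sK // eqxx.
  by move: ki; rewrite -(sK k kS) e sK // eqxx.
exists s.
  split=> [//|i iS|//|i k iS kS /andP[ik ks]]; first by have [] := sP i iS.
  have [bi si] := sP i iS; have [bk sk] := sP k kS.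
  have /andP[ti _] := blockP i iS; have /andP[tk _] := blockP k kS.
  have ki : k != i by rewrite -val_eqE gtn_eqF.
  have ksi : k != s i by rewrite -val_eqE ltn_eqF.
  have /andP[ne1 ne2] := inj i k iS kS ki ksi.
  have pl2 := fun B1 B2 h1 h2 => implyP (forallP (implyP (pl B1) h1) B2) h2.
  apply/negPn/negP => out; case: (ltnP (s k) i) => h.
    have := pl2 _ _ tk ti; rewrite bi bk => /negP; apply.
    apply/existsP; exists (s k); apply/existsP; exists i; apply/existsP; exists k.
    by apply/existsP; exists (s i); rewrite setUC !eqxx h ik ks.
  have := pl2 _ _ ti tk; rewrite bi bk => /negP; apply.
  apply/existsP; exists i; apply/existsP; exists k; apply/existsP; exists (s i).
  apply/existsP; exists (s k); rewrite !eqxx ik ks /=.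
  rewrite ltn_neqAle eq_sym val_eqE ne2 /= leqNgt; apply: contra out => lt.
  by rewrite lt andbT ltn_neqAle eq_sym val_eqE ne1.
move=> i j iS ij; have [bE si] := sP i iS; have /andP[bt _] := blockP i iS.
apply/idP/eqP => [ijt|->]; last by rewrite -bE.
have : pblock tau i = [set i; j] by apply: def_pblock => //; rewrite !inE eqxx.
rewrite bE => /setP/(_ j); rewrite !inE eqxx orbT eq_sym (negPf ij) /= => /eqP //.
Qed.

Lemma set_of_pairing s : nc_pairing S s ->
  let tau := [set [set i; s i] | i in S] in
  is_pairing S tau /\ planar_pairing tau.
Proof.
move=> nc tau.
have share i j k : i \in S -> j \in S -> k \in [set i; s i] -> k \in [set j; s j] ->
    [set i; s i] = [set j; s j].
  have E a b : a \in S -> b \in [set a; s a] -> [set a; s a] = [set b; s b].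
    by move=> aS /set2P[] -> //; rewrite (nc_inv nc aS) setUC.
  by move=> iS jS /(E _ _ iS) -> /(E _ _ jS) ->.
split.
  apply/andP; split; last first.
    apply/forallP => B; apply/implyP => /imsetP[i iS ->].
    by rewrite cards2 [i == _]eq_sym (nc_neq nc iS).
  apply/and3P; split.
  - apply/eqP/setP => i; apply/bigcupP/idP => [[B /imsetP[j jS ->]]|iS].
      by move=> /set2P[] -> //; apply: nc_in nc _ jS.
    by exists [set i; s i]; [apply: imset_f | rewrite !inE eqxx].
  - apply/trivIsetP => A B /imsetP[i iS ->] /imsetP[j jS ->] ne.
    apply/pred0P => k /=; apply/negbTE/negP => /andP[ki kj].
    by rewrite (share i j k) ?eqxx in ne.
  by apply/imsetP => -[i iS /setP/(_ i)]; rewrite !inE eqxx.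
apply/forallP => A; apply/implyP => /imsetP[i iS ->].
apply/forallP => B; apply/implyP => /imsetP[j jS ->].
apply/negP => /existsP[a] /existsP[b] /existsP[c] /existsP[d].
move=> /and5P[/eqP ac /eqP bd ab bc cd].
have pairE x y z : x \in S -> [set x; s x] = [set y; z] -> y != z -> y \in S /\ z = s y.
  move=> xS e yz; have : y \in [set x; s x] by rewrite e !inE eqxx.
  have : z \in [set x; s x] by rewrite e !inE eqxx orbT.
  case/set2P => zE /set2P[] yE; subst y z; rewrite ?eqxx // in yz.
  by rewrite (nc_in nc xS) (nc_inv nc xS).
have ac_neq : a != c by rewrite -val_eqE ltn_eqF // (ltn_trans ab).
have bd_neq : b != d by rewrite -val_eqE ltn_eqF // (ltn_trans bc).
have [aS cE] := pairE _ _ _ iS ac ac_neq.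
have [bS dE] := pairE _ _ _ jS bd bd_neq.
have := nc_nest nc aS bS; rewrite -cE -dE ab bc => /(_ isT); lia.
Qed.

End PairingSets.

Section PairingSum.
Local Open Scope ring_scope.
Variables (V1 V2 : finType) (E : {set V1 * V2}) (N : nat).
Variable node : 'I_N -> (V1 + V2)%type.
Local Notation mset := {ffun V1 * V2 -> 'I_3}.
Hypothesis node_inj : injective node.
Hypothesis planar : planar_nodes_outer E node.
Variables (R : comNzRingType) (wt : V1 * V2 -> R).
Variables (col : 'I_N -> 'I_3) (S Y : {set 'I_N}).
Hypothesis YE : forall i, (i \in Y) = (i \notin S) && ~~ is_black (node i).

Definition monochromatic (m : mset) :=
  [exists i in S, exists j in S, [&& i != j, connect (supp_adj m) (node i) (node j) &
     col i == col j]].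

Lemma split_diff (A : {set 'I_N}) : A \subset S ->
  [set i | (i \in A :|: Y) != (i \in (S :\: A) :|: Y)] = S.
Proof.
move=> /subsetP AS; apply/setP => i; rewrite !inE YE.
case iA: (i \in A) => /=; first by rewrite AS.
by case: (i \in S); rewrite ?orbF //= eqxx.
Qed.

(** Deleted nodes come out with degree 2: white ones lie in both label sets, black ones in
    neither. *)
Lemma config_dd (A : {set 'I_N}) m : A \subset S ->
  config E node (A :|: Y) ((S :\: A) :|: Y) m = is_dd_config E (node @: S) m.
Proof.
move=> /subsetP AS; congr andb; apply: eq_forallb => u; congr (_ == _).
case: (nodeP node u) => [[i ->]|hu]; last first.
  rewrite !cov_not_node //; case: imsetP => // -[i _ e].
  by have := hu i; rewrite e eqxx.
rewrite mem_imset // !cov_node // !inE YE.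
case iA: (i \in A) => /=; first by rewrite AS //; case: is_black.
by case: (i \in S); case: is_black.
Qed.

Lemma dd_pairing m : is_dd_config E (node @: S) m ->
  exists2 s, nc_pairing S s & forall i j, i \in S -> j \in S -> i != j ->
      connect (supp_adj m) (node i) (node j) = (j == s i).
Proof.
rewrite -(@config_dd S) // => h; have [s nc sE] := config_pairing node_inj planar h.
have inS i : ((i \in S :|: Y) != (i \in (S :\: S) :|: Y)) = (i \in S).
  by have /setP/(_ i) := split_diff (subxx S); rewrite inE.
exists s; first by move: nc; rewrite split_diff.
by move=> i j iS jS; apply: sE; rewrite inS.
Qed.

Lemma mono_pairing m s : nc_pairing S s ->
  (forall i j, i \in S -> j \in S -> i != j ->
      connect (supp_adj m) (node i) (node j) = (j == s i)) ->
  ~~ monochromatic m <-> {in S, forall i, col i != col (s i)}.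
Proof.
move=> nc sE; split=> [h i iS|h].
  apply: contra h => cE; apply/existsP; exists i; rewrite iS /=; apply/existsP.
  have siS := nc_in nc iS; have si := nc_neq nc iS.
  by exists (s i); rewrite siS eq_sym si /= sE ?eqxx // eq_sym.
apply/existsP => -[i /andP[iS /existsP[j /and4P[jS ij cij cE]]]].
by move: (h i iS) cE; rewrite sE // in cij; rewrite (eqP cij) => /negPf ->.
Qed.

Hypothesis unique : forall s s', nc_pairing S s -> nc_pairing S s' ->
  {in S, forall i, col i != col (s i)} -> {in S, forall i, col i != col (s' i)} ->
  {in S, s =1 s'}.

(** Every configuration induces a noncrossing matching, and by uniqueness one without monochromatic
    pair is the tripartite one. If no tripartite pairing exists the sum is empty, in accordance with
    the convention. *)
Lemma Ztri_sum : Ztri E node wt col S =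
  \sum_(m | is_dd_config E (node @: S) m && ~~ monochromatic m) config_weight wt (node @: S) m.
Proof.
rewrite /Ztri; case: pickP => [tau|none]; last first.
  rewrite big_pred0 // => m; apply/negbTE/negP => /andP[dd nm].
  have [s nc sE] := dd_pairing dd; have bi := (mono_pairing nc sE).1 nm.
  have [isp pl] := set_of_pairing nc.
  have := none [set [set i; s i] | i in S]; rewrite /tripartite isp pl /=.
  move=> /negbT/negP; apply; apply/forallP => B; apply/implyP => /imsetP[i iS ->].
  apply/forallP => j; apply/implyP => jB; apply/forallP => k; apply/implyP => kB.
  apply/implyP => jk.
  by case/set2P: jB jk => ->; case/set2P: kB => ->; rewrite ?eqxx // => _;
    [|rewrite eq_sym]; apply: bi.
move=> /and3P[isp pl /forallP bc]; have [t nt tE] := pairing_of_set isp pl.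
have bt : {in S, forall i, col i != col (t i)}.
  move=> i iS; have ti := nc_neq nt iS.
  have B : [set i; t i] \in tau by rewrite tE ?eqxx // eq_sym.
  have /forallP/(_ i)/implyP := implyP (bc _) B; rewrite !inE eqxx => /(_ isT).
  move=> /forallP/(_ (t i))/implyP; rewrite !inE eqxx orbT => /(_ isT).
  by rewrite eq_sym ti.
apply: eq_bigl => m; case dd: (is_dd_config _ _ _) => //=.
have [s nc sE] := dd_pairing dd; have mP := mono_pairing nc sE.
apply/idP/idP => [/forallP jb|/mP bi].
  apply/mP => i iS.
  have si := nc_neq nc iS; have siS := nc_in nc iS.
  have /forallP/(_ (s i))/implyP/(_ siS)/implyP := implyP (jb i) iS.
  rewrite eq_sym si sE ?eqxx // 1?eq_sym // tE // 1?eq_sym // => /(_ isT)/eqP/esym/eqP ->.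
  exact: bt.
apply/forallP => i; apply/implyP => iS; apply/forallP => j; apply/implyP => jS.
apply/implyP => ij; rewrite sE // tE // (unique nc nt bi bt iS).
exact: eqxx.
Qed.

End PairingSum.

(** * The signed sum over label sets *)

Section TripartiteSum.
Local Open Scope ring_scope.
Variables (V1 V2 : finType) (E : {set V1 * V2}) (N : nat).
Variable node : 'I_N -> (V1 + V2)%type.
Hypothesis node_inj : injective node.
Hypothesis planar : planar_nodes_outer E node.
Variables (R : comNzRingType) (wt : V1 * V2 -> R).
Variables (p q : nat) (col : 'I_N -> 'I_3).
Hypothesis pq : (p <= q)%N.
Hypothesis colE : forall i j, (col i == col j) = (cls p q i == cls p q j).

Lemma colored_unique (S : {set 'I_N}) s s' : nc_pairing S s -> nc_pairing S s' ->
  {in S, forall i, col i != col (s i)} -> {in S, forall i, col i != col (s' i)} ->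
  {in S, s =1 s'}.
Proof.
move=> n1 n2 b1 b2; apply: (tripartite_unique pq n1 n2) => i iS.
  by rewrite -colE b1.
by rewrite -colE b2.
Qed.

Variables S Y : {set 'I_N}.
Hypothesis YE : forall i, (i \in Y) = (i \notin S) && ~~ is_black (node i).
Let RS := [set i in S | (i < p)%N].
Let BS := [set i in S | (q <= i)%N].
Local Notation mono := (monochromatic node col S).
Let good (A : {set 'I_N}) := [&& A \subset S, RS \subset A & [disjoint A & BS]].
Let k := #|S|./2.

(** A monochromatic pair in an outer class is never split by a good [A]; if it lies in the middle,
    exchanging its ends in [A] reverses the sign. Without monochromatic pairs the set of openers is
    the only good split. *)
Lemma inner_sum m s : nc_pairing S s ->
  (forall i j, i \in S -> j \in S -> i != j ->
      connect (supp_adj m) (node i) (node j) = (j == s i)) ->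
  \sum_(A : {set 'I_N} | good A && [forall i in S, (i \in A) != (s i \in A)])
     (-1) ^+ ranksum S A =
  (if mono m then 0 else (-1) ^+ ('C(k, 2) + (k + #|BS|) * (k + #|RS|))) :> R.
Proof.
move=> nc sE; case: ifPn => [/existsP[i /andP[iS]]|nm]; last first.
  have bi : {in S, forall i : 'I_N, cls p q i != cls p q (s i)}.
    by move=> i iS; rewrite -colE; apply: (mono_pairing col nc sE).1 nm i iS.
  rewrite (big_pred1 [set i in S | (i < s i)%N]).
    rewrite -signr_odd (odd_ranksum_open pq nc bi) signr_odd /k -(card_open nc).
    by rewrite addnn doubleK.
  move=> A; apply/idP/eqP => [/andP[/and3P[AS RA AB] /forallP sp]|->].
    by apply: (in_open_split pq nc bi AS RA AB) => i iS; apply: (implyP (sp i)).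
  have [h1 h2 h3 h4] := open_split pq nc bi; rewrite /good h1 h2 h3 /=.
  by apply/forallP => i; apply/implyP; apply: h4.
move=> /existsP[j /and4P[jS ij]]; rewrite sE // colE => /eqP ->{j jS ij} /eqP cE.
have siS := nc_in nc iS; have si := nc_neq nc iS; have ssi := nc_inv nc iS.
have mid A : good A && [forall i in S, (i \in A) != (s i \in A)] ->
    [&& (p <= i)%N, (i < q)%N, (p <= s i)%N & (s i < q)%N].
  move=> /andP[/and3P[_ /subsetP RA /pred0P AB] /forallP/(_ i)]; rewrite iS /= => sp.
  have := RA i; have := RA (s i); have := AB i; have := AB (s i).
  rewrite /= !inE iS siS /=; move: cE; rewrite /cls => cE.
  by move: sp; case: (i \in A); case: (s i \in A) => //=; lia.
pose flip (A : {set 'I_N}) : {set 'I_N} := [set x | (x \in A) (+) ((x == i) || (x == s i))].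
have flipK A : flip (flip A) = A.
  by apply/setP => x; rewrite !inE -addbA addbb addbF.
apply: (sum_involution (b := fun A : {set 'I_N} => i \in A) (s := flip)) => A hA.
have mA := mid A hA; move: hA => /andP[/and3P[/subsetP AS /subsetP RA /pred0P AB] /forallP sp].
have spi := implyP (sp i) iS.
split=> //; first last.
- have addE (B : {set 'I_N}) : i \in B -> s i \notin B -> ranksum S B =
      (rank_in S i + ranksum S (B :\ i))%N.
    by move=> iB _; rewrite /ranksum (big_setD1 i).
  have main (B : {set 'I_N}) : i \in B -> s i \notin B ->
      odd (ranksum S (flip B)) = ~~ odd (ranksum S B).
    move=> iB siB; rewrite (addE B) // oddD.
    rewrite /ranksum (big_setD1 (s i)) /=; last by rewrite inE eqxx orbT (negPf siB).
    rewrite oddD (odd_rank_partner nc iS) -addNb; congr (_ (+) odd _).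
    apply: eq_bigl => x; rewrite !inE.
    case: (eqVneq x i) => [->|xi]; first by rewrite iB eq_sym si.
    by case: (eqVneq x (s i)) => [->|xs] /=; rewrite ?(negPf siB) ?addbF.
  rewrite -signr_odd -[in RHS]signr_odd -signrN; congr (_ ^+ _); congr nat_of_bool.
  case iA: (i \in A).
    by apply: main => //; move: spi; rewrite iA; case: (s i \in A).
  have := main (flip A); rewrite flipK !inE !eqxx iA orbT /=.
  have -> : s i \in A by move: spi; rewrite iA; case: (s i \in A).
  by move=> /(_ isT isT) ->; rewrite negbK.
- by rewrite inE eqxx addbT.
apply/andP; split.
  apply/and3P; split.
  - apply/subsetP => x; rewrite inE; case: (eqVneq x i) => [->|] //=.
    by case: (eqVneq x (s i)) => [->|] //= _ _; rewrite addbF; apply: AS.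
  - apply/subsetP => x xR; rewrite inE RA //=; move: xR; rewrite inE => /andP[xS xp].
    by apply/norP; rewrite -!val_eqE /=; lia.
  apply/pred0P => x; have := AB x; rewrite /= !inE; case: (x \in S) => //=; rewrite ?andbF //.
  by case: (leqP q x) => qx; rewrite ?andbT ?andbF // -!val_eqE /= => ->; lia.
apply/forallP => x; apply/implyP => xS; have := implyP (sp x) xS; rewrite !inE.
case: (eqVneq x i) => [->|xi]; first by rewrite eqxx orbT; case: (i \in A); case: (s i \in A).
case: (eqVneq x (s i)) => [->|xs].
  by rewrite ssi eqxx; case: (i \in A); case: (s i \in A).
have -> : (s x == i) = false by apply: contraNF xs => /eqP <-; rewrite (nc_inv nc xS).
have -> : (s x == s i) = false.
  by apply: contraNF xi => /eqP e; rewrite -(nc_inv nc xS) e ssi.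
by rewrite !addbF.
Qed.

Lemma tripartite_sum :
  \sum_(A : {set 'I_N} | good A)
     (-1) ^+ ranksum S A *
     (dimer E node wt (A :|: Y) * dimer E node wt ((S :\: A) :|: Y)) =
  (-1) ^+ ('C(k, 2) + (k + #|BS|) * (k + #|RS|)) * Ztri E node wt col S :> R.
Proof.
transitivity (\sum_(A : {set 'I_N} | good A)
   \sum_(m | is_dd_config E (node @: S) m && splits node (A :|: Y) ((S :\: A) :|: Y) m)
     (-1) ^+ ranksum S A * config_weight wt (node @: S) m).
  apply: eq_bigr => A /and3P[AS _ _]; rewrite dimer_mul // big_distrr /= (split_diff YE) //.
  by apply: eq_bigl => m; rewrite (config_dd _ node_inj YE).
rewrite (exchange_big_dep (is_dd_config E (node @: S))) /=; last by move=> A m _ /andP[].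
rewrite (Ztri_sum node_inj planar wt YE (@colored_unique S)) big_distrr /= [RHS]big_mkcondr /=; apply: eq_bigr => m dd.
have [s nc sE] := dd_pairing node_inj planar YE dd.
rewrite -big_distrl /= (eq_bigl (fun A : {set 'I_N} => good A &&
    [forall i in S, (i \in A) != (s i \in A)])) ?(inner_sum nc sE).
  by case: (mono m); rewrite ?mul0r.
move=> A; case gA: (good A) => //=; rewrite dd /=; have /and3P[AS _ _] := gA.
have inS i : ((i \in A :|: Y) != (i \in (S :\: A) :|: Y)) = (i \in S).
  by have /setP/(_ i) := split_diff YE AS; rewrite inE.
have inA i : i \in S -> (i \in A :|: Y) = (i \in A).
  by move=> iS; rewrite inE YE iS orbF.
apply/forallP/forallP => [h i|h i].
  apply/implyP => iS; have siS := nc_in nc iS; have si := nc_neq nc iS.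
  have /forallP/(_ (s i))/implyP := h i; rewrite !inS iS siS eq_sym si !inA //; apply.
  by rewrite sE ?eqxx // eq_sym.
apply/forallP => j; apply/implyP; rewrite !inS => /and4P[iS jS ij].
by rewrite sE // => /eqP ->; rewrite !inA ?(nc_in nc) //; apply: (implyP (h i)).
Qed.

End TripartiteSum.

(** Two consecutive keys per label, because a deleted white node has two rows. *)
Definition dkey (N : nat) (x : 'I_N * bool) : nat := x.1.*2 + x.2.

Lemma dkey_inj N : injective (@dkey N).
Proof.
move=> [i b] [j d]; rewrite /dkey /= => e; congr pair.
  by apply: ord_inj; move: b d e => [] []; lia.
by move: b d e => [] [] //; lia.
Qed.

Lemma dkey_lt N (x y : 'I_N * bool) : x.1 != y.1 -> (dkey x < dkey y)%N = (x.1 < y.1)%N.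
Proof.
rewrite -val_eqE /dkey /= => xy.
by case: x y xy => [i []] [j []] /=; lia.
Qed.

(** * The tripartite sum as a determinant *)

Section Expansion.
Local Open Scope ring_scope.
Variables (V1 V2 : finType) (E : {set V1 * V2}) (N n : nat).
Variable node : 'I_N -> (V1 + V2)%type.
Hypothesis node_inj : injective node.
Hypothesis planar : planar_nodes_outer E node.
Variables (R : idomainType) (wt : V1 * V2 -> R).
Variables (p q : nat).
Hypothesis pq : (p <= q)%N.
Local Notation g := (dimer E node wt).
Variables (c h : R) (P : 'I_N -> 'rV[R]_n).
Hypothesis cP : forall s, uniq s -> size s = n -> c * gword g s = h * rowdet P s.

Local Notation T := ('I_N * bool)%type.
Implicit Types (A S Y : {set 'I_N}) (C : {set T}) (s : seq T).

(* The row [(a P_i | b P_i)] attached to a key: [(1, 0)] or [(1, 1)] for the even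
   key of [i], the latter when [i] lies in the middle interval, and [(0, 1)] for
   the odd one. *)
Definition rowX (x : T) : 'rV[R]_n := if x.2 then 0 else P x.1.
Definition rowY (x : T) : 'rV[R]_n := if x.2 || (p <= x.1 < q)%N then P x.1 else 0.
Definition rowV (x : T) : 'rV[R]_(n + n) := row_mx (rowX x) (rowY x).
Definition keys S Y : {set T} :=
  [set x | (x.1 \in S) && (x.2 == (q <= x.1)%N) || (x.1 \in Y)].

Definition bracket s := sgs (@dkey N) R s * rowdet rowV s.

Lemma sgs_labels s : uniq [seq x.1 | x <- s] -> sgs (@dkey N) R s = sgs val R [seq x.1 | x <- s].
Proof.
elim: s => //= x s IH /andP[xs us]; rewrite IH //; congr (_ * _).
rewrite big_map; apply: eq_big_seq => y ys.
have xy : x.1 != y.1 by apply: contra xs => /eqP ->; apply: map_f.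
rewrite /sg dkey_lt // (negPf xy).
by have -> : (x == y) = false by apply: contraNF xy => /eqP ->.
Qed.

Lemma rowdet_zero m (V : T -> 'rV[R]_m) s x : size s = m -> x \in s -> V x = 0 -> rowdet V s = 0.
Proof.
move=> sz xs V0; have ix : (index x s < m)%N by rewrite -sz index_mem.
rewrite /rowdet (expand_det_row _ (Ordinal ix)) big1 // => j _.
by rewrite mxE (nth_map x) ?index_mem //= nth_index // V0 mxE mul0r.
Qed.

Lemma rowdet_labels m (V : T -> 'rV[R]_m) (V' : 'I_N -> 'rV[R]_m) s :
  {in s, forall x, V x = V' x.1} -> rowdet V s = rowdet V' [seq x.1 | x <- s].
Proof.
by move=> e; rewrite /rowdet -map_comp; have -> : map V s = map (V' \o fst) s by apply/eq_in_map.
Qed.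

Variables S Y : {set 'I_N}.
Hypothesis SY : [disjoint S & Y].
Hypothesis szSY : (#|S| + #|Y|.*2 = n + n)%N.
Let RS := [set i in S | (i < p)%N].
Let BS := [set i in S | (q <= i)%N].
Let good A := [&& A \subset S, RS \subset A & [disjoint A & BS]].
Let K := keys S Y.
Let inC C := [seq x <- enum K | x \in C].
Let outC C := [seq x <- enum K | x \notin C].

Lemma SYF i : i \in S -> i \in Y = false.
Proof. by move=> iS; have /pred0P/(_ i) := SY; rewrite /= iS. Qed.

Lemma card_keys : #|K| = (n + n)%N.
Proof.
rewrite -szSY; have -> : K = [set (i, (q <= i)%N) | i : 'I_N in S] :|: setX Y [set: bool].
  apply/setP => -[i b]; rewrite !inE /= andbT; congr (_ || _).
  apply/andP/imsetP => [[iS /eqP ->]|[j jS [-> ->]]]; first by exists i.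
  by rewrite jS eqxx.
rewrite cardsU disjoint_setI0 ?cards0 ?subn0; last first.
  apply/pred0P => -[i b]; rewrite /= !inE andbT; apply/negbTE/negP => /andP[/imsetP[j jS [-> _]]].
  by rewrite SYF.
by rewrite card_imset ?cardsX ?cardsT ?card_bool ?muln2 // => i j [].
Qed.

Let lift A : {set T} := [set x | ~~ x.2 && (x.1 \in A :|: Y)].
Let label C : {set 'I_N} := [set i in S | (i, false) \in C].

Lemma label_lift A : A \subset S -> label (lift A) = A.
Proof.
move=> /subsetP AS; apply/setP => i; rewrite !inE /=.
case iA: (i \in A) => /=; first by rewrite AS.
by case iS: (i \in S) => //=; rewrite SYF.
Qed.

Lemma size_parts C : (size (inC C) + size (outC C) = n + n)%N.
Proof. by rewrite !size_filter count_predC -card_keys cardE. Qed.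

Lemma keys_even i : i \in S -> (q <= i)%N = false -> (i, false) \in K.
Proof. by move=> iS qi; rewrite inE /= iS qi. Qed.

(** Odd keys have no left part and stay outside [C]; keys without right part must lie in [C]. For a
    deleted node the even key is in [C], as otherwise its row would occur twice on the right. So [C]
    is determined by the labels of [S] it contains. *)
Lemma laplace_support C : C \subset enum K ->
  rowdet rowX (inC C) * rowdet rowY (outC C) != 0 ->
  [/\ size (inC C) = n, size (outC C) = n, C = lift (label C) & good (label C)].
Proof.
move=> /subsetP CK; rewrite mulf_eq0 negb_or => /andP[X0 Y0].
have CK' x : x \in C -> x \in K by move=> /CK; rewrite mem_enum.
have [sX sY] : size (inC C) = n /\ size (outC C) = n.
  have hX : (n <= size (inC C))%N by rewrite leqNgt; apply: contra X0 => /rowdet_short ->.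
  have hY : (n <= size (outC C))%N by rewrite leqNgt; apply: contra Y0 => /rowdet_short ->.
  by have := size_parts C; lia.
have even x : x \in C -> x.2 = false.
  move=> xC; apply/negbTE; apply: contra X0 => x2; apply/eqP.
  apply: (rowdet_zero (x := x)) => //; last by rewrite /rowX x2.
  by rewrite mem_filter xC CK.
have outY x : x \in K -> x \notin C -> x.2 || (p <= x.1 < q)%N.
  move=> xK xC; apply: contraNT Y0 => x2; apply/eqP.
  apply: (rowdet_zero (x := x)) => //; first by rewrite mem_filter xC mem_enum.
  by rewrite /rowY (negPf x2).
have YC i : i \in Y -> (i, false) \in C.
  move=> iY; apply: contraNT Y0 => iC; apply/eqP.
  rewrite (rowdet_labels (V' := P)); last first.
    by move=> x; rewrite mem_filter mem_enum => /andP[xC xK]; rewrite /rowY outY.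
  apply: rowdet_dup; first by rewrite size_map.
  have us : uniq (outC C) by rewrite filter_uniq // enum_uniq.
  apply/negP => um; have inj : {in outC C &, injective fst}.
    by move=> x y xs ys e; apply/eqP; rewrite -(nth_index x xs) -(nth_index x ys);
      apply/eqP; congr nth; apply/eqP;
      rewrite -(nth_uniq x.1 _ _ um) ?size_map ?index_mem // !(nth_map x) ?index_mem // !nth_index // e.
  have i1 : (i, true) \in outC C.
    rewrite mem_filter mem_enum inE /= iY orbT andbT; apply/negP => /even //.
  have i0 : (i, false) \in outC C by rewrite mem_filter mem_enum iC inE /= iY orbT.
  by have := inj _ _ i0 i1 erefl.
have CE : C = lift (label C).
  apply/setP => -[i b]; rewrite !inE /=; apply/idP/idP => [ibC|].
    have := even _ ibC; rewrite /= => b0; rewrite b0 /= in ibC *; rewrite ibC andbT.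
    by have := CK' _ ibC; rewrite inE /= => /orP[/andP[->]|->]; rewrite ?orbT.
  by move=> /andP[/negbTE ->] /orP[/andP[]|/YC].
split=> //; apply/and3P; split.
- by apply/subsetP => i; rewrite inE => /andP[].
- apply/subsetP => i; rewrite !inE => /andP[iS ip]; rewrite iS /=.
  apply/negPn/negP => iC; have qi : (q <= i)%N = false by lia.
  by have := outY _ (keys_even iS qi) iC; rewrite /=; lia.
apply/pred0P => i /=; apply/negbTE/negP; rewrite !inE => /andP[/andP[iS iC] /andP[_ qi]].
by have := CK' _ iC; rewrite inE /= iS qi SYF.
Qed.

Lemma lift_keys A : A \subset S -> [disjoint A & BS] -> lift A \subset enum K.
Proof.
move=> /subsetP AS /pred0P AB; apply/subsetP => -[i b]; rewrite mem_enum !inE /=.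
move=> /andP[/negbTE ->] /orP[iA|->]; last by rewrite orbT.
by have := AB i; rewrite /= inE iA AS //=; case: (q <= i)%N.
Qed.

Lemma labels_in A : A \subset S -> [disjoint A & BS] ->
  perm_eq [seq x.1 | x <- inC (lift A)] (enum (A :|: Y)).
Proof.
move=> AS AB; apply: uniq_perm; rewrite ?enum_uniq //.
  rewrite map_inj_in_uniq ?(filter_uniq _ (enum_uniq _)) // => -[i b] [j d].
  by rewrite !mem_filter !inE /= => /andP[/andP[/negbTE -> _] _] /andP[/andP[/negbTE -> _] _] ->.
move=> i; rewrite mem_enum; apply/mapP/idP => [[x]|iA].
  by rewrite mem_filter inE => /andP[/andP[_ xA] _ ->].
exists (i, false) => //; rewrite mem_filter inE /= iA /=.
by apply: (subsetP (lift_keys AS AB)); rewrite inE /= iA.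
Qed.

Lemma mem_out A x : RS \subset A -> [disjoint A & BS] -> x \in outC (lift A) ->
  [/\ x.1 \in (S :\: A) :|: Y, x.2 = (x.1 \in Y) || (q <= x.1)%N
    & x.2 || (p <= x.1 < q)%N].
Proof.
case: x => i b /subsetP RA /pred0P AB; rewrite mem_filter mem_enum !inE /=.
have := RA i; have := AB i; rewrite /= !inE.
case iY: (i \in Y) => /=.
  have -> : i \in S = false by apply: contraTF iY => /SYF ->.
  by case: b => /= _ _; rewrite orbT.
rewrite !orbF /=; case iS: (i \in S); last by move=> _ _ /andP[].
move=> iA RiA /andP[out /eqP bE]; rewrite bE in out *.
move: iA RiA out; case: (leqP q i) => qi; case: (i \in A) => //= _ RiA _.
by split=> //; rewrite andbT leqNgt; apply/negP => /RiA.
Qed.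

Lemma labels_out A : A \subset S -> RS \subset A -> [disjoint A & BS] ->
  perm_eq [seq x.1 | x <- outC (lift A)] (enum ((S :\: A) :|: Y)).
Proof.
move=> AS RA AB; apply: uniq_perm; rewrite ?enum_uniq //.
  rewrite map_inj_in_uniq ?(filter_uniq _ (enum_uniq _)) // => -[i b] [j d].
  by move=> /(mem_out RA AB)[/= _ -> _] /(mem_out RA AB)[/= _ -> _] ->.
move=> i; rewrite mem_enum; apply/mapP/idP => [[x] /(mem_out RA AB)[? _ _] -> //|iB].
exists (i, (i \in Y) || (q <= i)%N) => //.
rewrite mem_filter mem_enum !inE /=; move: iB; rewrite !inE.
have /pred0P/(_ i) := AB; rewrite /= !inE.
case iY: (i \in Y) => /=; first by move=> _ _; rewrite orbT.
rewrite !orbF; case: (i \in S); case: (i \in A); case: (q <= i)%N => //=.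

Qed.

Lemma gword_labels (s : seq 'I_N) A : perm_eq s (enum A) -> size s = n ->
  h * (sgs val R s * rowdet P s) = c * g A.
Proof.
move=> sA sz; have us : uniq s by rewrite (perm_uniq sA) enum_uniq.
rewrite mulrCA -(cP us sz) /gword mulrCA; congr (_ * _).
rewrite mulrA (sgs_sqr val_inj) // mul1r; congr (dimer _ _ _ _).
by apply/setP => i; rewrite inE (perm_mem sA) mem_enum.
Qed.

(** The two keys of a deleted node fall on different sides, the even one first; this pair has sign
    +1, in agreement with the strict inequality in [rank_in]. *)
Lemma cross_sign A : good A ->
  \prod_(x <- inC (lift A)) \prod_(y <- outC (lift A)) sg (@dkey N) R x y =
  (-1) ^+ \sum_(a in A :|: Y) rank_in ((S :\: A) :|: Y) a.
Proof.
move=> /and3P[AS RA AB]; have lo := labels_out AS RA AB; have li := labels_in AS AB.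
have uo : uniq [seq x.1 | x <- outC (lift A)] by rewrite (perm_uniq lo) enum_uniq.
transitivity (\prod_(x <- inC (lift A)) (-1 : R) ^+ rank_in ((S :\: A) :|: Y) x.1).
  apply: eq_big_seq => -[a b]; rewrite mem_filter inE /= => /andP[/andP[/negbTE -> aA] _].
  have -> : rank_in ((S :\: A) :|: Y) a =
      count (fun y : T => (y.1 < a)%N) (outC (lift A)).
    rewrite -(count_map fst (fun i : 'I_N => (i < a)%N)) -rank_in_seq //.
    by congr (rank_in _ _); apply/setP => i; rewrite [RHS]inE (perm_mem lo) mem_enum.
  have : {in outC (lift A), forall y : T, sg (@dkey N) R (a, false) y = (-1) ^+ (y.1 < a)%N}.
    move=> [i d]; rewrite mem_filter => /andP[+ _]; rewrite inE /= => out.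
    rewrite /sg; have [ia|ai] := eqVneq i a.
      have -> : d = true by move: out; rewrite ia aA andbT negbK.
      by rewrite ia /dkey /= addn0 addn1 ltnS leqnn ltnn expr0.
    have ia : a != i by rewrite eq_sym.
    rewrite dkey_lt //=; case: (ssrnat.ltngtP a i) => // [lt|e]; last first.
      by rewrite (ord_inj e) eqxx in ai.
    by rewrite xpair_eqE (negPf ia) expr1.
  elim: (outC _) => [|y l IH] hl /=; first by rewrite big_nil.
  rewrite big_cons exprD hl ?mem_head // IH // => z zl; apply: hl.
  by rewrite inE zl orbT.
rewrite -(big_map fst xpredT (fun a : 'I_N => (-1 : R) ^+ rank_in ((S :\: A) :|: Y) a)).
rewrite (perm_big _ li) /= big_enum /=.
by elim/big_rec2: _ => [|i x y _ ->]; rewrite ?expr0 // exprD.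
Qed.

(** Adding the ranks inside [A :|: Y], which sum to a binomial coefficient, completes the ranks to
    those in [S] plus twice those in [Y]. *)
Lemma cross_parity A : good A -> #|A :|: Y| = n ->
  odd (\sum_(a in A :|: Y) rank_in ((S :\: A) :|: Y) a) =
  odd ('C(n, 2) + ranksum S Y + ranksum S A).
Proof.
move=> /and3P[AS _ AB] sz.
have dAY : [disjoint A & Y].
  apply/pred0P => i /=; apply/negbTE/negP => /andP[/(subsetP AS) iS iY].
  by rewrite SYF in iY.
have sumU F : (\sum_(a in A :|: Y) F a = \sum_(a in A) F a + \sum_(a in Y) F a)%N.
  by rewrite -bigU //; apply: eq_bigl => i; rewrite inE.
have e : (\sum_(a in A :|: Y) rank_in ((S :\: A) :|: Y) a + ranksum (A :|: Y) (A :|: Y)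
    = ranksum S Y + ranksum S A + (\sum_(a in A :|: Y) rank_in Y a).*2)%N.
  rewrite /ranksum -addnn [X in _ = (X + _)%N]addnC -sumU -!big_split /=.
  apply: eq_bigr => a _; rewrite !rank_inE !(big_mkcond (fun i => i \in _)) -!big_split /=.
  apply: eq_bigr => k _; rewrite !inE; case kA: (k \in A) => /=.
    by rewrite (subsetP AS) // SYF ?(subsetP AS) // !addn0 !add0n.
  case kS: (k \in S) => /=; first by rewrite SYF // !addn0.
  by rewrite add0n.
have := congr1 odd e; rewrite ranksum_self sz !oddD odd_double addbF.
by do 4![case: (odd _)].
Qed.

(** Every path has one end in [A], so [s] exchanges [A] and [S :\: A]. This discards the label sets
    of the wrong size, which the determinant excludes by its shape. *)
Lemma dimer_card A : A \subset S -> g (A :|: Y) * g ((S :\: A) :|: Y) != 0 ->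
  (#|A| + #|A| = #|S|)%N.
Proof.
move=> /subsetP AS gg.
have inS i : ((i \in A :|: Y) != (i \in (S :\: A) :|: Y)) = (i \in S).
  rewrite !inE; case iA: (i \in A) => /=; first by rewrite AS // SYF ?AS.
  by case iS: (i \in S) => /=; [rewrite SYF | rewrite eqxx].
have inA i : i \in S -> (i \in A :|: Y) = (i \in A).
  by move=> iS; rewrite inE (SYF iS) orbF.
case: (pickP (fun m => config E node (A :|: Y) ((S :\: A) :|: Y) m &&
    splits node (A :|: Y) ((S :\: A) :|: Y) m)) => [m|none]; last first.
  by rewrite dimer_mul // big_pred0 ?eqxx in gg.
move=> /andP[mAB /forallP sp]; have [s nc sE] := config_pairing node_inj planar mAB.
have {}nc : nc_pairing S s by move: nc; congr nc_pairing; apply/setP => i; rewrite inE inS.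
have flip i : i \in S -> (i \in A) != (s i \in A).
  move=> iS; have siS := nc_in nc iS; have si := nc_neq nc iS.
  have /forallP/(_ (s i))/implyP := sp i; rewrite !inS iS siS eq_sym si !inA //; apply.
  by rewrite sE ?inS ?eqxx // eq_sym.
have inj (B : {set 'I_N}) : B \subset S -> {in B &, injective s}.
  move=> /subsetP BS' i j iB jB e.
  by rewrite -(nc_inv nc (BS' _ iB)) e (nc_inv nc (BS' _ jB)).
have AS' : A \subset S by apply/subsetP.
have le1 : (#|A| <= #|S :\: A|)%N.
  rewrite -(card_in_imset (inj _ AS')); apply/subset_leq_card/subsetP => k /imsetP[i iA ->].
  by rewrite inE (nc_in nc) ?AS // andbT; have := flip i (AS _ iA); rewrite iA.
have le2 : (#|S :\: A| <= #|A|)%N.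
  rewrite -(card_in_imset (inj _ (subsetDl S A))); apply/subset_leq_card/subsetP => k /imsetP[i].
  by rewrite inE => /andP[iA iS] ->; have := flip i iS; rewrite (negPf iA); case: (s i \in A).
have := cardsID A S; rewrite (setIidPr AS'); lia.
Qed.

Lemma expansion :
  h ^+ 2 * bracket (enum K) =
  c ^+ 2 * \sum_(A : {set 'I_N} | good A) (-1) ^+ ('C(n, 2) + ranksum S Y + ranksum S A) *
     (g (A :|: Y) * g ((S :\: A) :|: Y)).
Proof.
rewrite /bracket laplace ?enum_uniq -?cardE ?card_keys //; last exact: dkey_inj.
rewrite (bigID (fun C => [&& C == lift (label C), good (label C) & #|label C :|: Y| == n])) /=.
rewrite [X in _ + X]big1 ?addr0; last first.
  move=> C /andP[CK]; apply: contraNeq; rewrite mulf_eq0 negb_or => /andP[_ t0].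
  have [sX sY CE gC] := laplace_support CK t0; rewrite -CE eqxx gC /=.
  have /and3P[AS RA AB] := gC.
  by rewrite cardE -(perm_size (labels_in AS AB)) -CE size_map sX.
rewrite [in RHS](bigID (fun A => #|A :|: Y| == n)) /=.
rewrite [X in c ^+ 2 * (_ + X)]big1 ?addr0; last first.
  move=> A /andP[/and3P[AS _ _]]; apply: contraNeq; rewrite mulf_eq0 negb_or => /andP[_ t0].
  have := dimer_card AS t0; rewrite cardsU disjoint_setI0 ?cards0 ?subn0.
    by move: szSY; rewrite -addnn => e1 e2; apply/eqP; lia.
  apply/pred0P => i /=; apply/negbTE/negP => /andP[/(subsetP AS) iS iY].
  by rewrite SYF in iY.
rewrite (reindex_onto lift label) /=; last by move=> C /andP[_ /and3P[/eqP <-]].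
rewrite !big_distrr /=; apply: eq_big => [A|A].
  apply/idP/idP => [/andP[/andP[_ /and3P[_ gA sA]] /eqP e]|/andP[gA sA]].
    by rewrite e in gA sA; rewrite gA.
  have /and3P[AS RA AB] := gA; rewrite label_lift // !eqxx gA sA !andbT.
  exact: lift_keys.
move=> /andP[/andP[_ /and3P[_ gA /eqP sA]] /eqP e]; rewrite e in gA sA.
have /and3P[AS RA AB] := gA.
have li := labels_in AS AB; have lo := labels_out AS RA AB.
have szi : size (inC (lift A)) = n by rewrite -(size_map fst) (perm_size li) -cardE.
have szo : size (outC (lift A)) = n by have := size_parts (lift A); rewrite szi; lia.
rewrite (rowdet_labels (V' := P)); last first.
  by move=> x; rewrite mem_filter inE => /andP[/andP[/negbTE x2 _] _]; rewrite /rowX x2.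
rewrite (rowdet_labels (V := rowY) (V' := P)); last first.
  by move=> x /(mem_out RA AB)[_ _ xo]; rewrite /rowY xo.
rewrite sgs_cat cross_sign // !sgs_labels; last first.
- by rewrite (perm_uniq li) enum_uniq.
- by rewrite (perm_uniq lo) enum_uniq.
rewrite -[in RHS]signr_odd -cross_parity // signr_odd.
have gi := gword_labels li; have go := gword_labels lo.
rewrite size_map szi in gi; rewrite size_map szo in go.
set sgn := (-1) ^+ _; move: (gi erefl) (go erefl).
set si := sgs _ _ _; set so := sgs _ _ _; set di := rowdet _ _; set do_ := rowdet _ _.
move=> e1 e2; transitivity (sgn * ((h * (si * di)) * (h * (so * do_)))); first by ring.
by rewrite e1 e2; ring.
Qed.

End Expansion.

(** Mod 2 the exponents are polynomials in six parities, and all 64 cases are checked. *)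
Ltac parity t b r ry rv :=
  rewrite !(oddD, ssrnat.oddM, oddS, oddb) /=;
  move: (odd 'C(t, 2)) (odd t) (odd b) (odd r) (odd ry) (odd rv);
  do 6![case]; by split.

(* The parity of the exponents: [t.+2], [t.+1] and [t] are the half-cardinals of the
   sets with 0, 2 and 4 nodes removed; [b], [r] count the nodes of the third and
   first color outside the four removed ones; [ry], [rv] are the ranks of [y], [v]. *)
Lemma sign_arith (n t r b ry rv x y w v p q : nat) : (p <= q)%N -> n = t.+2 ->
  (x < y < w)%N && (w < v)%N || (y < w < v)%N && (v < x)%N ->
  [/\ (x < p)%N || (y < p)%N || (w < p)%N || (v < p)%N,
    (p <= x < q)%N || (p <= y < q)%N || (p <= w < q)%N || (p <= v < q)%N &
    (q <= x)%N || (q <= y)%N || (q <= w)%N || (q <= v)%N] ->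
  let e0 := ('C(n, 2) + 0 + ('C(n, 2) +
      (n + (b + ((q <= x) + (q <= y) + ((q <= w) + (q <= v))))) *
      (n + (r + ((x < p) + (y < p) + ((w < p) + (v < p)))))))%N in
  let e4 := ('C(n, 2) + (ry + rv) + ('C(t, 2) + (t + b) * (t + r)))%N in
  let e2 z a c d := ('C(n, 2) + (z + ((a < c) + (d < c))) + ('C(t.+1, 2) +
     (t.+1 + (b + ((q <= a) + (q <= d)))) * (t.+1 + (r + ((a < p) + (d < p))))))%N in
  odd (e0 + e4) = odd (e2 ry w y v + e2 rv x v y)%N /\
  odd (e0 + e4) = odd (e2 ry x y v + e2 rv y v w)%N.
Proof.
move=> pq -> cyc [c1 c2 c3].
have binE m : 'C(m.+1, 2) = ('C(m, 2) + m)%N by rewrite binS bin1.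
move=> e0 e4 e2; rewrite /e0 /e4 /e2 !binE {e0 e4 e2}.
case/orP: cyc => /andP[/andP[h1 h2] h3].
-   have f0 : (x < p)%N = true by lia.
  have f1 : (q <= x)%N = false by lia.
  have f2 : (v < p)%N = false by lia.
  have f3 : (q <= v)%N = true by lia.
  have f4 : (w < y)%N = false by lia.
  have f5 : (v < y)%N = false by lia.
  have f6 : (x < v)%N = true by lia.
  have f7 : (y < v)%N = true by lia.
  have f8 : (x < y)%N = true by lia.
  have f9 : (w < v)%N = true by lia.
  rewrite ?f0 ?f1 ?f2 ?f3 ?f4 ?f5 ?f6 ?f7 ?f8 ?f9.
  have cases : [|| (y < p)%N && (p <= w < q)%N, (p <= y < q)%N && (p <= w < q)%N | (p <= y < q)%N && (q <= w)%N] by lia.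
  case/or3P: cases => /andP[k1 k2].
  + have gy : (y < p)%N = true by lia.
    have ly : (q <= y)%N = false by lia.
    have gw : (w < p)%N = false by lia.
    have lw : (q <= w)%N = false by lia.
    by rewrite ?gy ?ly ?gw ?lw; parity t b r ry rv.
  + have gy : (y < p)%N = false by lia.
    have ly : (q <= y)%N = false by lia.
    have gw : (w < p)%N = false by lia.
    have lw : (q <= w)%N = false by lia.
    by rewrite ?gy ?ly ?gw ?lw; parity t b r ry rv.
  + have gy : (y < p)%N = false by lia.
    have ly : (q <= y)%N = false by lia.
    have gw : (w < p)%N = false by lia.
    have lw : (q <= w)%N = true by lia.
    by rewrite ?gy ?ly ?gw ?lw; parity t b r ry rv.
-   have f0 : (y < p)%N = true by lia.
  have f1 : (q <= y)%N = false by lia.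
  have f2 : (x < p)%N = false by lia.
  have f3 : (q <= x)%N = true by lia.
  have f4 : (w < y)%N = false by lia.
  have f5 : (v < y)%N = false by lia.
  have f6 : (x < v)%N = false by lia.
  have f7 : (y < v)%N = true by lia.
  have f8 : (x < y)%N = false by lia.
  have f9 : (w < v)%N = true by lia.
  rewrite ?f0 ?f1 ?f2 ?f3 ?f4 ?f5 ?f6 ?f7 ?f8 ?f9.
  have cases : [|| (w < p)%N && (p <= v < q)%N, (p <= w < q)%N && (p <= v < q)%N | (p <= w < q)%N && (q <= v)%N] by lia.
  case/or3P: cases => /andP[k1 k2].
  + have gw : (w < p)%N = true by lia.
    have lw : (q <= w)%N = false by lia.
    have gv : (v < p)%N = false by lia.
    have lv : (q <= v)%N = false by lia.
    by rewrite ?gw ?lw ?gv ?lv; parity t b r ry rv.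
  + have gw : (w < p)%N = false by lia.
    have lw : (q <= w)%N = false by lia.
    have gv : (v < p)%N = false by lia.
    have lv : (q <= v)%N = false by lia.
    by rewrite ?gw ?lw ?gv ?lv; parity t b r ry rv.
  + have gw : (w < p)%N = false by lia.
    have lw : (q <= w)%N = false by lia.
    have gv : (v < p)%N = false by lia.
    have lv : (q <= v)%N = true by lia.
    by rewrite ?gw ?lw ?gv ?lv; parity t b r ry rv.
Qed.

(** The scalars enter every product as [c ^+ 4] and [h ^+ 4]; the cancelled factor is [c ^+ 4] with
    the common sign. *)
Lemma three_term_transfer (R : idomainType) (c h d0 d4 dxy dwv dxv dwy : R)
    (s0 s4 sxy swv sxv swy z0 z4 zxy zwv zxv zwy : R) : (c != 0)%R ->
  (h ^+ 2 * d0 = c ^+ 2 * (s0 * z0) -> h ^+ 2 * d4 = c ^+ 2 * (s4 * z4) ->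
   h ^+ 2 * dxy = c ^+ 2 * (sxy * zxy) -> h ^+ 2 * dwv = c ^+ 2 * (swv * zwv) ->
   h ^+ 2 * dxv = c ^+ 2 * (sxv * zxv) -> h ^+ 2 * dwy = c ^+ 2 * (swy * zwy) ->
   d0 * d4 = dxy * dwv + dxv * dwy ->
   s0 * s4 = sxy * swv -> s0 * s4 = sxv * swy -> s0 * s4 != 0 ->
   z0 * z4 = zxy * zwv + zxv * zwy)%R.
Proof.
move=> c0 v0 v4 vxy vwv vxv vwy tt e1 e2 s04.
have c4 : (c ^+ 4 * (s0 * s4) != 0)%R by rewrite mulf_neq0 ?expf_neq0.
apply: (mulfI c4).
transitivity ((c ^+ 2 * (s0 * z0)) * (c ^+ 2 * (s4 * z4)))%R; first by ring.
rewrite -v0 -v4; transitivity (h ^+ 4 * (d0 * d4))%R; first by ring.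
rewrite tt.
transitivity ((h ^+ 2 * dxy) * (h ^+ 2 * dwv) + (h ^+ 2 * dxv) * (h ^+ 2 * dwy))%R.
  by ring.
rewrite vxy vwv vxv vwy.
transitivity (c ^+ 4 * (sxy * swv * (zxy * zwv) + sxv * swy * (zxv * zwy)))%R.
  by ring.
by rewrite -e1 -e2; ring.
Qed.

(** * The identity for colors that are consecutive intervals *)

Section LinearColors.
Local Open Scope ring_scope.
Variables (V1 V2 : finType) (E : {set V1 * V2}) (n : nat).
Variable node : 'I_(2 * n) -> (V1 + V2)%type.
Hypothesis node_inj : injective node.
Hypothesis card_black : #|[set i | is_black (node i)]| = n.
Hypothesis planar : planar_nodes_outer E node.
Variables (R : idomainType) (wt : V1 * V2 -> R).
Variables (p q : nat) (col : 'I_(2 * n) -> 'I_3).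
Hypothesis pq : (p <= q)%N.
Hypothesis colE : forall i j, (col i == col j) = (cls p q i == cls p q j).
Variables x y w v : 'I_(2 * n).
Hypothesis uniq4 : uniq [:: x; y; w; v].
Hypothesis cyc : (x < y < w)%N && (w < v)%N || (y < w < v)%N && (v < x)%N.
Hypothesis colors : forall t, (t < 3)%N ->
  t \in [seq cls p q (i : 'I_(2 * n)) | i <- [:: x; y; w; v]].
Hypotheses (bx : is_black (node x)) (bw : is_black (node w)).
Hypotheses (wy : ~~ is_black (node y)) (wv : ~~ is_black (node v)).
Implicit Types U : {set 'I_(2 * n)}.

Let Yof U := [set i in U | ~~ is_black (node i)].
Let RSof U := [set i in ~: U | (i < p)%N].
Let BSof U := [set i in ~: U | (q <= i)%N].
Let halfcard U := #|~: U|./2.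
(** The first two terms come from the Laplace expansion, the others from the tripartite sum. *)
Let sexp U := ('C(n, 2) + ranksum (~: U) (Yof U) +
  ('C(halfcard U, 2) + (halfcard U + #|BSof U|) * (halfcard U + #|RSof U|)))%N.

Lemma bracket_Ztri (c h : R) (P : 'I_(2 * n) -> 'rV[R]_n) U :
  (forall s, uniq s -> size s = n -> c * gword (dimer E node wt) s = h * rowdet P s) ->
  (#|U| = #|Yof U|.*2)%N ->
  h ^+ 2 * bracket p q P (enum (keys q (~: U) (Yof U))) =
  c ^+ 2 * ((-1) ^+ sexp U * Ztri E node wt col (~: U)).
Proof.
move=> cP sU.
have SY : [disjoint ~: U & Yof U].
  by apply/pred0P => i /=; rewrite !inE; case: (i \in U).
have sz : (#|~: U| + #|Yof U|.*2 = n + n)%N.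
  by rewrite -sU addnC cardsC card_ord mul2n addnn.
rewrite (expansion node_inj planar pq cP SY sz); congr (_ * _).
have YE i : (i \in Yof U) = (i \notin ~: U) && ~~ is_black (node i).
  by rewrite !inE negbK.
rewrite /sexp exprD -mulrA -(tripartite_sum node_inj planar wt pq colE YE) big_distrr.
by apply: eq_bigr => A _; rewrite exprD -mulrA.
Qed.

(** [kk i] is the key of a remaining node, [kk' i] the one gained when a white node is deleted;
    [base] consists of the keys common to all six words. *)
Let kk (i : 'I_(2 * n)) := (i, (q <= i)%N).
Let kk' (i : 'I_(2 * n)) := (i, ~~ (q <= i)%N).
Let base := enum [set z : 'I_(2 * n) * bool |
  [&& z.1 != x, z.1 != w & z.2 == (q <= z.1)%N]].

Lemma size_base : (size base).+2 = (n + n)%N.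
Proof.
rewrite -cardE; have -> : [set z : 'I_(2 * n) * bool |
    [&& z.1 != x, z.1 != w & z.2 == (q <= z.1)%N]] = kk @: (~: [set x; w]).
  apply/setP => -[i b]; rewrite !inE /=; apply/idP/imsetP => [/and3P[ix iw /eqP ->]|[j]].
    by exists i; rewrite // !inE negb_or ix iw.
  by rewrite !inE negb_or => /andP[jx jw] [-> ->]; rewrite jx jw eqxx.
rewrite card_imset; last by move=> i j [].
have := cardsC [set x; w]; rewrite cards2 card_ord.
have -> : x != w by move: uniq4; rewrite /= !inE !negb_or => /and3P[/and3P[]].
lia.
Qed.

Lemma neq4 : [/\ x != y, x != w & x != v] /\ [/\ y != w, y != v & w != v].
Proof.
by move: uniq4; rewrite /= !inE !negb_or => /and4P[/and3P[-> -> ->] /andP[-> ->] -> _].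
Qed.

Lemma bracket_perm (P : 'I_(2 * n) -> 'rV[R]_n) U s :
  (#|U| = #|Yof U|.*2)%N -> uniq s -> enum (keys q (~: U) (Yof U)) =i s ->
  bracket p q P (enum (keys q (~: U) (Yof U))) = bracket p q P s.
Proof.
move=> sU us e.
have pe : perm_eq (enum (keys q (~: U) (Yof U))) s.
  by apply: uniq_perm; rewrite ?enum_uniq.
have sz : size (enum (keys q (~: U) (Yof U))) = (n + n)%N.
  rewrite -cardE; apply: card_keys.
    by apply/pred0P => i /=; rewrite !inE; case: (i \in U).
  by rewrite -sU addnC cardsC card_ord mul2n addnn.
exact (rowdet_perm (@dkey_inj _) (rowV p q P) pe sz).
Qed.

Let neqE : (((x == y) = false) * ((x == w) = false) * ((x == v) = false) *
  ((y == w) = false) * ((y == v) = false) * ((w == v) = false) *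
  (((y == x) = false) * ((w == x) = false) * ((v == x) = false) *
  ((w == y) = false) * ((v == y) = false) * ((v == w) = false)))%type.
Proof.
have [[xy xw xv] [yw yv wv']] := neq4.
by do !split; apply/negbTE; rewrite // eq_sym.
Qed.

Let blackE : ((is_black (node x) = true) * (is_black (node w) = true) *
  (is_black (node y) = false) * (is_black (node v) = false))%type.
Proof. by do !split => //; apply/negbTE. Qed.

Lemma uniq_keys : uniq [:: kk x, kk' y, kk w, kk' v & base].
Proof.
rewrite /= !inE !mem_enum !inE /= /kk /kk' !xpair_eqE !neqE !eqxx enum_uniq /=.
by rewrite ?andbF ?orbF; case: (q <= y)%N; case: (q <= v)%N.
Qed.

Lemma mem_keys U z : (z \in enum (keys q (~: U) (Yof U))) =
  if z.1 \in U then ~~ is_black (node z.1) else z.2 == (q <= z.1)%N.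
Proof. by rewrite mem_enum !inE; case: (z.1 \in U); rewrite /= ?orbF. Qed.

Lemma mem_base z : (z \in base) = [&& z.1 != x, z.1 != w & z.2 == (q <= z.1)%N].
Proof. by rewrite mem_enum inE. Qed.

Lemma perm_keys :
  [/\ enum (keys q (~: set0) (Yof set0)) =i [:: kk x, kk w & base],
      enum (keys q (~: [set x; y; w; v]) (Yof [set x; y; w; v])) =i [:: kk' y, kk' v & base],
      enum (keys q (~: [set x; y]) (Yof [set x; y])) =i [:: kk' y, kk w & base] &
  [/\ enum (keys q (~: [set w; v]) (Yof [set w; v])) =i [:: kk x, kk' v & base],
      enum (keys q (~: [set x; v]) (Yof [set x; v])) =i [:: kk w, kk' v & base] &
      enum (keys q (~: [set w; y]) (Yof [set w; y])) =i [:: kk x, kk' y & base]]].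
Proof.
split; [| | |split] => -[i b]; rewrite mem_keys !inE mem_base !xpair_eqE /=;
  (have [->|_] := eqVneq i x; [by rewrite !neqE ?eqxx ?blackE /= ?orbF; case: (q <= x)%N b => [] [] |]);
  (have [->|_] := eqVneq i y; [by rewrite !neqE ?eqxx ?blackE /= ?orbF; case: (q <= y)%N b => [] [] |]);
  (have [->|_] := eqVneq i w; [by rewrite ?neqE ?eqxx ?blackE /= ?orbF; case: (q <= w)%N b => [] [] |]);
  (have [->|_] := eqVneq i v; [by rewrite ?neqE ?eqxx ?blackE /= ?orbF; case: (q <= v)%N b => [] [] |]);
  by rewrite /= ?andbF.
Qed.

Let U4 := [set x; y; w; v].

Lemma sum2 (F : 'I_(2 * n) -> nat) a b : a != b ->
  (\sum_(i in [set a; b]) F i = F a + F b)%N.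
Proof. by move=> ab; rewrite big_setU1 ?inE //= big_set1. Qed.

(** Refers the sums for a two-node deletion to the nodes outside [U4], so that the six exponents can
    be compared. *)
Lemma sum_rest (F : 'I_(2 * n) -> nat) a b : a \in U4 -> b \in U4 -> a != b ->
  (\sum_(i in ~: (U4 :\: [set a; b])) F i = \sum_(i in ~: U4) F i + (F a + F b))%N.
Proof.
move=> aU bU ab; rewrite -(sum2 F ab) -bigU; last first.
  by apply/pred0P => i /=; apply/negbTE/negP => /andP[+ /set2P[] e]; rewrite e inE ?aU ?bU.
apply: eq_bigl => i; rewrite !inE negb_and negbK orbC; congr (_ || _).
Qed.

Lemma rests : [/\ [set x; y] = U4 :\: [set w; v], [set w; v] = U4 :\: [set x; y],
  [set x; v] = U4 :\: [set y; w] & [set w; y] = U4 :\: [set x; v]].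
Proof.
by split; apply/setP => i; rewrite !inE;
  (have [e|_] := eqVneq i x; [by rewrite ?e ?neqE ?blackE |]);
  (have [e|_] := eqVneq i y; [by rewrite ?e ?neqE ?blackE |]);
  (have [e|_] := eqVneq i w; [by rewrite ?e ?neqE ?blackE |]);
  (have [e|_] := eqVneq i v; by rewrite ?e ?neqE ?blackE).
Qed.

Lemma Yofs : [/\ Yof set0 = set0, Yof U4 = [set y; v], Yof [set x; y] = [set y] &
  [/\ Yof [set w; v] = [set v], Yof [set x; v] = [set v] & Yof [set w; y] = [set y]]].
Proof.
by split; [| | |split]; apply/setP => i; rewrite !inE;
  (have [e|_] := eqVneq i x; [by rewrite ?e ?neqE ?blackE |]);
  (have [e|_] := eqVneq i y; [by rewrite ?e ?neqE ?blackE |]);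
  (have [e|_] := eqVneq i w; [by rewrite ?e ?neqE ?blackE |]);
  (have [e|_] := eqVneq i v; by rewrite ?e ?neqE ?blackE).
Qed.

Lemma card_sum U (P : pred 'I_(2 * n)) :
  #|[set i in ~: U | P i]| = (\sum_(i in ~: U) P i)%N.
Proof.
by rewrite -sum1dep_card big_mkcondr /=; apply: eq_bigr => i _; case: (P i).
Qed.

Lemma sexp_signs :
  odd (sexp set0 + sexp U4) = odd (sexp [set x; y] + sexp [set w; v]) /\
  odd (sexp set0 + sexp U4) = odd (sexp [set w; y] + sexp [set x; v]).
Proof.
have [Y0 Y4 Yxy [Ywv Yxv Ywy]] := Yofs.
have [Rxy Rwv Rxv Rwy] := rests.
have inU : [/\ x \in U4, y \in U4, w \in U4 & v \in U4] by rewrite !inE !eqxx !orbT.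
have [xU yU wU vU] := inU.
have [[xy xw xv] [yw yv wv']] := neq4.
have s_xy F := sum_rest F wU vU wv'.
have s_wv F := sum_rest F xU yU xy.
have s_xv F := sum_rest F yU wU yw.
have s_wy F := sum_rest F xU vU xv.
have s_0 (F : 'I_(2 * n) -> nat) :
    (\sum_(i in ~: set0) F i = \sum_(i in ~: U4) F i + (F x + F y + (F w + F v)))%N.
  rewrite -(sum2 F xy) -(sum2 F wv') -!bigU.
  - by apply: eq_bigl => i; rewrite !inE /=; case: (i == x); case: (i == y); case: (i == w); case: (i == v).
  - by apply/pred0P => i /=; rewrite !inE; do 4![case: (i == _)].
  - apply/pred0P => i /=; rewrite !inE; have [e|_] := eqVneq i x; first by rewrite e !neqE.
    by have [e|_] := eqVneq i y; rewrite ?e ?neqE.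
rewrite -Rxy -/U4 in s_xy; rewrite -Rwv in s_wv; rewrite -Rxv in s_xv; rewrite -Rwy in s_wy.
pose t := halfcard U4.
have card4 : #|U4| = 4.
  rewrite -[RHS]/(size [:: x; y; w; v]) -(card_uniqP uniq4).
  by apply: eq_card => i; rewrite !inE -!orbA.
have cardE U : (#|~: U| = \sum_(i in ~: U) 1)%N by rewrite sum1_card.
have c0 : #|~: (set0 : {set 'I_(2 * n)})| = (2 * n)%N by rewrite setC0 cardsT card_ord.
have h0 : halfcard set0 = n by rewrite /halfcard c0 mul2n doubleK.
have c4 : (#|~: U4| + 4 = 2 * n)%N by apply: etrans c0; rewrite !cardE s_0.
have arith a m : (a + 4 = 2 * m -> m = (a./2).+2 /\ a = (a./2).*2)%N.
  move=> e; have oa : odd a = false.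
    by have := congr1 odd e; rewrite oddD mul2n odd_double addbF.
  by have := odd_double_half a; rewrite oa; clear -e; lia.
have [nt e4] := arith _ _ c4; rewrite -[_./2]/t in nt e4.
have h2 (U : {set 'I_(2 * n)}) : (#|~: U| = #|~: U4| + (1 + 1))%N -> halfcard U = t.+1.
  by rewrite /halfcard e4 => ->; rewrite -[(1 + 1)%N]/(1.*2) -doubleD doubleK addn1.
have hxy : halfcard [set x; y] = t.+1 by apply: h2; rewrite !cardE s_xy.
have hwv : halfcard [set w; v] = t.+1 by apply: h2; rewrite !cardE s_wv.
have hxv : halfcard [set x; v] = t.+1 by apply: h2; rewrite !cardE s_xv.
have hwy : halfcard [set w; y] = t.+1 by apply: h2; rewrite !cardE s_wy.
rewrite /sexp /ranksum h0 hxy hwv hxv hwy -/t Y0 Y4 Yxy Ywv Yxv Ywy.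
rewrite big_set0 !big_set1 sum2 // !rank_inE !card_sum.
rewrite !s_0 !s_xy !s_wv !s_xv !s_wy.
set r4 := (\sum_(i in ~: U4) (i < p)%N)%N; set b4 := (\sum_(i in ~: U4) (q <= i)%N)%N.
set ry := (\sum_(k in ~: U4) (k < y))%N; set rv := (\sum_(k in ~: U4) (k < v))%N.
have colors' : [/\ (x < p)%N || (y < p)%N || (w < p)%N || (v < p)%N,
    (p <= x < q)%N || (p <= y < q)%N || (p <= w < q)%N || (p <= v < q)%N &
    (q <= x)%N || (q <= y)%N || (q <= w)%N || (q <= v)%N].
  have cE z : [/\ (0%N == cls p q z) = (z < p)%N, (1%N == cls p q z) = (p <= z < q)%N &
      (2%N == cls p q z) = (q <= z)%N].
    by rewrite /cls; case: (ssrnat.leqP p z) => l1; case: (ssrnat.leqP q z) => l2;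
      split => //; clear -pq l1 l2; lia.
  have c0E z : (0%N == cls p q z) = (z < p)%N by have [] := cE z.
  have c1E z : (1%N == cls p q z) = (p <= z < q)%N by have [] := cE z.
  have c2E z : (2%N == cls p q z) = (q <= z)%N by have [] := cE z.
  have h0' := colors (isT : 0 < 3)%N; have h1' := colors (isT : 1 < 3)%N.
  have h2' := colors (isT : 2 < 3)%N.
  move: h0' h1' h2'; rewrite /= !inE !c0E !c1E !c2E -!orbA.
  by move=> -> -> ->.
exact: (sign_arith r4 b4 ry rv pq nt cyc colors').
Qed.

Lemma sg_labels (i j : 'I_(2 * n)) a b : i != j ->
  sg (@dkey _) R (i, a) (j, b) = if (i < j)%N then 1 else -1.
Proof. by move=> ij; rewrite /sg dkey_lt //= xpair_eqE (negPf ij). Qed.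

Lemma linear_identity :
  Ztri E node wt col [set: 'I_(2 * n)] * Ztri E node wt col (~: U4) =
  Ztri E node wt col (~: [set x; y]) * Ztri E node wt col (~: [set w; v]) +
  Ztri E node wt col (~: [set x; v]) * Ztri E node wt col (~: [set w; y]).
Proof.
have [c [h [P [c0 cP]]]] := realization (dimer_plucker node_inj planar wt) n.
have [[xy xw xv] [yw yv wv']] := neq4.
have [Y0 Y4 Yxy [Ywv Yxv Ywy]] := Yofs.
have [p0 p4 pxy [pwv pxv pwy]] := perm_keys.
have [s1 s2] := sexp_signs.
have card4 : #|U4| = 4.
  rewrite -[RHS]/(size [:: x; y; w; v]) -(card_uniqP uniq4).
  by apply: eq_card => i; rewrite !inE -!orbA.
have ukeys := uniq_keys.
have uniqs : [/\ uniq [:: kk x, kk w & base], uniq [:: kk' y, kk' v & base],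
    uniq [:: kk' y, kk w & base] & [/\ uniq [:: kk x, kk' v & base],
    uniq [:: kk w, kk' v & base] & uniq [:: kk x, kk' y & base]]].
  move: ukeys; rewrite /= !inE !negb_or.
  move=> /and5P[/and4P[-> -> -> ->] /and3P[-> -> ->] /andP[-> ->] -> ->].
  by split.
have [u0 u4 uxy [uwv uxv uwy]] := uniqs.
have value U s : (#|U| = #|Yof U|.*2)%N -> uniq s ->
    enum (keys q (~: U) (Yof U)) =i s ->
    h ^+ 2 * bracket p q P s = c ^+ 2 * ((-1) ^+ sexp U * Ztri E node wt col (~: U)).
  by move=> sU us e; rewrite -(bracket_perm P sU us e) (bracket_Ztri cP).
have := three_term (key := @dkey _) (rowV p q P) ukeys size_base.
rewrite !sg_labels // => tt.
(* The second order has [x] last instead of first, which reverses one comparison in each product. *)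
have signs : ((if (x < w)%N then 1 else -1) * (if (y < v)%N then 1 else -1) =
      (if (y < w)%N then 1 else -1) * (if (x < v)%N then 1 else -1) :> R) /\
    ((if (x < w)%N then 1 else -1) * (if (y < v)%N then 1 else -1) =
      (if (x < y)%N then 1 else -1) * (if (w < v)%N then 1 else -1) :> R).
  have : [&& (x < w)%N, (y < v)%N, (y < w)%N, (x < v)%N, (x < y)%N & (w < v)%N] ||
         [&& (w < x)%N, (y < v)%N, (y < w)%N, (v < x)%N, (y < x)%N & (w < v)%N].
    by move: cyc; clear; lia.
  case/orP => /and5P[h1 -> -> h2 /andP[h3 ->]]; first by rewrite h1 h2 h3.
  by rewrite !ltnNge (ltnW h1) (ltnW h2) (ltnW h3) /= mulr1 mul1r.
have {}tt := tt signs.1 signs.2.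
have v0 := value _ _ _ u0 p0; have v4 := value _ _ _ u4 p4.
have vxy := value _ _ _ uxy pxy; have vwv := value _ _ _ uwv pwv.
have vxv := value _ _ _ uxv pxv; have vwy := value _ _ _ uwy pwy.
rewrite Y0 cards0 in v0; rewrite Y4 card4 cards2 yv in v4.
rewrite Yxy cards2 xy cards1 in vxy; rewrite Ywv cards2 wv' cards1 in vwv.
rewrite Yxv cards2 xv cards1 in vxv; rewrite Ywy cards2 [w == y]eq_sym yw cards1 in vwy.
move: (v0 erefl) (v4 erefl) (vxy erefl) (vwv erefl) (vxv erefl) (vwy erefl).
rewrite setC0 /bracket {v0 v4 vxy vwv vxv vwy value}.
set Z0 := Ztri _ _ _ _ setT; set Z4 := Ztri _ _ _ _ (~: U4).
set Zxy := Ztri _ _ _ _ (~: [set x; y]); set Zwv := Ztri _ _ _ _ (~: [set w; v]).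
set Zxv := Ztri _ _ _ _ (~: [set x; v]); set Zwy := Ztri _ _ _ _ (~: [set w; y]).
move=> v0 v4 vxy vwv vxv vwy.
apply: (three_term_transfer c0 v0 v4 vxy vwv vxv vwy).
- by rewrite tt addrC; congr (_ + _); rewrite mulrC.
- by rewrite -!exprD -[LHS]signr_odd -[RHS]signr_odd s1.
- by rewrite -!exprD -[LHS]signr_odd -[RHS]signr_odd s2 addnC.
by rewrite -exprD signr_eq0.
Qed.

End LinearColors.

Section Transfer.
Local Open Scope ring_scope.
Variables (V1 V2 : finType) (E : {set V1 * V2}) (N : nat).
Variable node : 'I_N -> (V1 + V2)%type.
Variables (R0 R : comNzRingType) (f : {rmorphism R0 -> R}).
Variables (wt0 : V1 * V2 -> R0) (wt : V1 * V2 -> R).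
Hypothesis wtE : forall e, f (wt0 e) = wt e.

(** The pairing found by [pick] does not depend on the weights. *)
Lemma Ztri_morph (col : 'I_N -> 'I_3) S :
  Ztri E node wt col S = f (Ztri E node wt0 col S).
Proof.
rewrite /Ztri; case: pickP => [tau _|_]; last by rewrite rmorph0.
rewrite /ZDD rmorph_sum; apply: eq_bigr => m _.
rewrite /config_weight rmorphM rmorphXn rmorph_nat; congr (_ * _).
by rewrite rmorph_prod; apply: eq_bigr => e _; rewrite rmorphXn wtE.
Qed.

End Transfer.

(** * Reduction to consecutive colors and universal weights *)

Section Rotation.
Variable N : nat.

Definition rotate (u : nat) (k : 'I_N) : 'I_N :=
  Ordinal (ltn_pmod (k + u) (leq_ltn_trans (leq0n k) (ltn_ord k))).

Lemma rotateE u k : (u <= N)%N ->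
  rotate u k = (if k + u < N then k + u else k + u - N)%N :> nat.
Proof.
move=> uN /=; have kN := ltn_ord k; case: ssrnat.ltnP => h; first by rewrite modn_small.
by rewrite -{1}(subnK h) modnDr modn_small; lia.
Qed.

Variable t : nat.
Hypothesis tN : (t <= N)%N.

Lemma rotateK : cancel (rotate t) (rotate (N - t)).
Proof.
move=> k; apply: ord_inj; have kN := ltn_ord k.
rewrite rotateE ?leq_subr // rotateE //.
by case: (ssrnat.ltnP (k + t) N) => h; case: ssrnat.ltnP; lia.
Qed.

Lemma rotateKr : cancel (rotate (N - t)) (rotate t).
Proof.
move=> k; apply: ord_inj; have kN := ltn_ord k.
rewrite rotateE // rotateE ?leq_subr //.
by case: (ssrnat.ltnP (k + (N - t)) N) => h; case: ssrnat.ltnP; lia.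
Qed.

Lemma rotate_inj : injective (rotate t).
Proof. exact: can_inj rotateK. Qed.

(* Crossing is invariant under rotation, even though the nesting condition is
   stated in terms of the linear order. *)
Lemma rotate_pairing (S : {set 'I_N}) s : nc_pairing S s ->
  nc_pairing (rotate t @^-1: S) (fun k => rotate (N - t) (s (rotate t k))).
Proof.
move=> nc; split=> [i|i|i|i k]; rewrite ?inE.
- by move=> iS; rewrite rotateKr (nc_in nc).
- by move=> iS; apply: contra (nc_neq nc iS) => /eqP {2}<-; rewrite rotateKr.
- by move=> iS; rewrite rotateKr (nc_inv nc iS) rotateK.
move=> aS bS.
have iE := rotateK i; have kE := rotateK k.
have := rotateE i tN; have := rotateE k tN.
set a := rotate t i in aS *; set b := rotate t k in bS *.
have := rotateE (rotate (N - t) (s a)) tN; have := rotateE (rotate (N - t) (s b)) tN.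
rewrite !rotateKr.
set i' := rotate (N - t) (s a); set k' := rotate (N - t) (s b).
have saS := nc_in nc aS; have sbS := nc_in nc bS.
have ab1 := nc_between nc aS bS.
have ab2 : (s a < b < a)%N = (s a < s b < a)%N.
  by have := nc_between nc saS bS; rewrite (nc_inv nc aS).
have sbsa : (s b : nat) = s a -> (b : nat) = a.
  by move=> /ord_inj e; rewrite -(nc_inv nc bS) e (nc_inv nc aS).
have sba : (s b : nat) = a -> (b : nat) = s a.
  by move=> /ord_inj <-; rewrite (nc_inv nc bS).
move: (ltn_ord i) (ltn_ord k) (ltn_ord i') (ltn_ord k').
move: tN ab1 ab2 sbsa sba.
move: (nat_of_ord i) (nat_of_ord k) (nat_of_ord i') (nat_of_ord k').
move: (nat_of_ord a) (nat_of_ord b) (nat_of_ord (s a)) (nat_of_ord (s b)).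
clear; move=> a b c d i k i' k' tN ab1 ab2 e1 e2 iN kN i'N k'N.
by do 4![case: ssrnat.ltnP => ? ?]; lia.
Qed.

End Rotation.

Section RotateNodes.
Variables (V1 V2 : finType) (E : {set V1 * V2}) (N t : nat).
Variable node : 'I_N -> (V1 + V2)%type.
Hypothesis tN : (t <= N)%N.
Let rho := @rotate N t.
Let node' := node \o rho.

Lemma adjz_rotate : adjz E node' =2 adjz E node.
Proof.
have e u : [exists i, node' i == u] = [exists i, node i == u].
  apply/existsP/existsP => [[i h]|[i h]]; first by exists (rho i).
  by exists (rotate (N - t) i); rewrite /node' /= /rho rotateKr.
by move=> [u|] [u'|] //=; rewrite e.
Qed.

Lemma planar_rotate : planar_nodes_outer E node -> planar_nodes_outer E node'.
Proof.
move=> [nxt [rot gen out]]; exists nxt; split.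
- move=> a; have [r1 r2] := rot a; split=> [b|b b']; rewrite !adjz_rotate; first exact: r1.
  exact: r2.
- move=> a C D F.
  have CE : C = [set b | connect (adjz E node) a b].
    by apply/setP => b; rewrite !inE; apply: (eq_connect adjz_rotate).
  have DE : D = [set d : option (V1 + V2) * option (V1 + V2) |
      adjz E node d.1 d.2 && (d.1 \in [set b | connect (adjz E node) a b])].
    by rewrite -CE; apply/setP => d; rewrite !in_set adjz_rotate.
  by rewrite /F DE CE; apply: gen.
move=> i j ij; rewrite /node' /=; apply: out; rewrite /= ij !modnDml; congr (_ %% _)%N.
by rewrite addnAC.
Qed.

Hypothesis node_inj : injective node.
Hypothesis planar : planar_nodes_outer E node.
Variables (R : comNzRingType) (wt : V1 * V2 -> R) (col : 'I_N -> 'I_3).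
Let col' := col \o rho.
Variables (p q : nat).
Hypothesis pq : (p <= q)%N.
Hypothesis colE : forall i j, (col' i == col' j) = (cls p q i == cls p q j).

Lemma node'_inj : injective node'.
Proof. exact: inj_comp node_inj (rotate_inj tN). Qed.

(** Both [crossing] and the choice of the pairing refer to the linear order of the labels. The
    comparison passes through [Ztri_sum], whose right-hand side sees only nodes, connections and
    colors; uniqueness is transported from the rotated labels. *)
Lemma Ztri_rotate (S : {set 'I_N}) :
  Ztri E node' wt col' (rho @^-1: S) = Ztri E node wt col S.
Proof.
pose Y := [set i | (i \notin S) && ~~ is_black (node i)].
have YE i : (i \in Y) = (i \notin S) && ~~ is_black (node i) by rewrite inE.
pose Y' := [set i | (i \notin rho @^-1: S) && ~~ is_black (node' i)].
have YE' i : (i \in Y') = (i \notin rho @^-1: S) && ~~ is_black (node' i) by rewrite inE.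
have unique s s' : nc_pairing S s -> nc_pairing S s' ->
    {in S, forall i, col i != col (s i)} -> {in S, forall i, col i != col (s' i)} ->
    {in S, s =1 s'}.
  move=> n1 n2 b1 b2 i iS.
  have bi r : {in S, forall i, col i != col (r i)} ->
      {in rho @^-1: S, forall i, col' i != col' (rotate (N - t) (r (rho i)))}.
    by move=> b k; rewrite inE => kS; rewrite /col' /= /rho rotateKr // b.
  have := colored_unique pq colE (rotate_pairing tN n1) (rotate_pairing tN n2)
    (bi s b1) (bi s' b2).
  move=> /(_ (rotate (N - t) i)); rewrite inE rotateKr // => /(_ iS) /(congr1 rho).
  by rewrite /rho !rotateKr.
rewrite (Ztri_sum node_inj planar wt YE unique).
rewrite (Ztri_sum node'_inj (planar_rotate planar) wt YE' (@colored_unique _ _ _ _ pq colE _)).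
have -> : node' @: (rho @^-1: S) = node @: S.
  apply/setP => u; apply/imsetP/imsetP => [[i]|[i iS ->]].
    by rewrite inE => iS ->; exists (rho i).
  by exists (rotate (N - t) i); rewrite ?inE /node' /= /rho rotateKr.
apply: eq_bigl => m; congr (_ && ~~ _).
apply/existsP/existsP => [[i /andP[iS /existsP[j /and3P[jS ij h]]]]|[i /andP[iS /existsP[j /and3P[jS ij h]]]]].
  exists (rho i); move: iS jS; rewrite !inE => -> jS /=; apply/existsP; exists (rho j).
  by rewrite jS (inj_eq (rotate_inj tN)) ij.
exists (rotate (N - t) i); rewrite inE /rho rotateKr // iS /=; apply/existsP.
exists (rotate (N - t) j); rewrite inE /rho rotateKr // jS /node' /col' /= /rho !rotateKr // h andbT.
by rewrite -(inj_eq (rotate_inj tN)) !rotateKr.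
Qed.

End RotateNodes.

(** The labels are rotated to start with the interval of color 0. The color [c1] found at position
    [l0], just after it, must have its interval begin there, and the third color fills the rest. *)
Lemma linear_coloring (N : nat) (col : 'I_N -> 'I_3) : rgb_coloring col ->
  (forall c, exists i, col i = c) ->
  exists t p q, [/\ (t <= N)%N, (p <= q)%N,
    forall i j, (col (rotate t i) == col (rotate t j)) = (cls p q i == cls p q j) &
    forall r, (r < 3)%N -> exists c, forall i, col (rotate t i) = c -> cls p q i = r].
Proof.
move=> rgb surj; pose c0 : 'I_3 := ord0.
have [i0 i0E] := surj c0; have N0 : (0 < N)%N by apply: leq_ltn_trans (ltn_ord i0).
have [s0 [l0 h0]] := rgb c0; set t := (s0 %% N)%N in h0.
have tN : (t <= N)%N by rewrite ltnW // ltn_pmod.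
have shift (k : 'I_N) u : (u <= N)%N ->
    ((rotate t k + N - u) %% N = (k + (t + (N - u))) %% N)%N.
  by move=> uN; rewrite -addnBA //= modnDml addnA.
have c0E k : (col (rotate t k) == c0) = (k < l0)%N.
  have := h0 (rotate t k); rewrite inE => ->.
  by rewrite shift // subnKC // modnDr modn_small.
have l0N : (l0 < N)%N.
  have [i1 i1E] := surj (inord 1).
  have : ~~ (rotate (N - t) i1 < l0)%N.
    by rewrite -c0E rotateKr // i1E -val_eqE /= inordK.
  by rewrite -leqNgt => /leq_ltn_trans; apply.
have l0_gt0 : (0 < l0)%N.
  apply: (@leq_ltn_trans (rotate (N - t) i0)) => //.
  by rewrite -c0E rotateKr // i0E.
set c1 := col (rotate t (Ordinal l0N)).
have c10 : c1 != c0 by rewrite /c1 c0E /= ltnn.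
have [s1 [l1 h1]] := rgb c1; set u := (s1 %% N)%N in h1.
have uN : (u <= N)%N by rewrite ltnW // ltn_pmod.
set d := (t + (N - u))%N.
have c1E' k : (col (rotate t k) == c1) = ((k + d) %% N < l1)%N.
  by have := h1 (rotate t k); rewrite inE => ->; rewrite shift // /d.
(* Position [l0 - 1] has color 0 and position [l0] has color [c1], so [l0] is the first position of
   the interval of [c1]. *)
have start : ((l0 + d) %% N = 0)%N.
  have l0N' : (l0.-1 < N)%N by lia.
  have := c1E' (Ordinal l0N); rewrite eqxx /= => /esym lt1.
  have : (col (rotate t (Ordinal l0N')) == c1) = false.
    have : col (rotate t (Ordinal l0N')) == c0 by rewrite c0E /= prednK.
    by move=> /eqP ->; rewrite eq_sym (negPf c10).
  rewrite c1E' /= => /negbT; rewrite -leqNgt => le1.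
  apply/eqP; rewrite -leqn0 leqNgt; apply/negP => pos.
  have e : ((l0.-1 + d) %% N = ((l0 + d) %% N).-1)%N.
    have -> : (l0.-1 + d = (l0 + d) - 1)%N by lia.
    rewrite {1}(divn_eq (l0 + d) N) -addnBA // modnMDl modn_small ?subn1 //.
    by have := ltn_pmod (l0 + d) N0; lia.
  by move: le1; rewrite e; lia.
have c1E (k : 'I_N) : (l0 <= k)%N -> (col (rotate t k) == c1) = (k < l0 + l1)%N.
  move=> lk; rewrite c1E'.
  have -> : (k + d = (l0 + d) + (k - l0))%N by lia.
  rewrite -modnDml start add0n modn_small; first by rewrite ltn_subLR.
  by have := ltn_ord k; lia.
(* The colors renumbered in order of appearance. *)
pose kappa (c : 'I_3) : nat := if c == c0 then 0 else if c == c1 then 1 else 2.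
have kE (k : 'I_N) : cls l0 (l0 + l1) k = kappa (col (rotate t k)).
  rewrite /kappa c0E /cls; case: ssrnat.ltnP => h; first by lia.
  by rewrite c1E //; case: ssrnat.ltnP => h2; lia.
have k_inj : injective kappa.
  have c10' : (c1 : nat) <> 0%N by move=> e; move: c10; rewrite -val_eqE /= e.
  move=> a b; rewrite /kappa -!val_eqE /= => e; apply: ord_inj.
  have := ltn_ord a; have := ltn_ord b; have := ltn_ord c1; move: e.
  by do ?[case: eqP => ?]; lia.
exists t, l0, (l0 + l1)%N; split=> //; first exact: leq_addr.
  by move=> i j; rewrite !kE (inj_eq k_inj).
move=> [|[|[|//]]] _.
- by exists c0 => i e; rewrite kE e.
- by exists c1 => i e; rewrite kE e /kappa (negPf c10) eqxx.
(* The third color: the colors sum to 3 and the first one is 0. *)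
exists (inord (3 - c1)) => i e; rewrite kE e /kappa -!val_eqE /=.
have c1_gt0 : (0 < c1)%N by rewrite lt0n; move: c10; rewrite -val_eqE.
by have := ltn_ord c1; rewrite inordK; [do ?[case: eqP => ?]; lia | lia].
Qed.

Section Universal.
Import mpoly.
Local Open Scope ring_scope.
Variables (T : finType) (R : comNzRingType) (wt : T -> R).

(** Integer coefficients, with one variable per edge, make the source a domain that maps to any
    commutative ring. *)
Lemma universal_weights : exists (R0 : idomainType) (f : {rmorphism R0 -> R})
  (wt0 : T -> R0), forall e, f (wt0 e) = wt e.
Proof.
pose f := mmap (intr : int -> R) (fun i : 'I_#|T| => wt (enum_val i)).
exists ({mpoly int[#|T|]}), f, (fun e => 'X_(enum_rank e)) => e.
apply: etrans (mmapX _ (intr : {rmorphism int -> R}) _) _.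
by rewrite mmap1U enum_rankK.
Qed.

End Universal.

Unset Implicit Arguments.

Theorem mainTheorem1 (V1 V2 : finType) (E : {set V1 * V2})
    (R : comNzRingType) (wt : V1 * V2 -> R)
    (n : nat) (node : 'I_(2 * n) -> (V1 + V2)%type)
    (col : 'I_(2 * n) -> 'I_3) (x y w v : 'I_(2 * n)) :
  injective node ->
  #|[set i | is_black (node i)]| = n ->
  planar_nodes_outer E node ->
  rgb_coloring col ->
  triangle_ineq col ->
  uniq [:: x; y; w; v] ->
  cyc_order4 x y w v ->
  (forall c : 'I_3, c \in [seq col i | i <- [:: x; y; w; v]]) ->
  is_black (node x) -> is_black (node w) ->
  ~~ is_black (node y) -> ~~ is_black (node v) ->
  (Ztri E node wt col [set: 'I_(2 * n)] *
     Ztri E node wt col (~: [set x; y; w; v]) =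
   Ztri E node wt col (~: [set x; y]) * Ztri E node wt col (~: [set w; v]) +
   Ztri E node wt col (~: [set x; v]) * Ztri E node wt col (~: [set w; y]))%R.
Proof.
move=> node_inj card_black planar rgb _ uniq4 cyc colors bx bw wy wv.
have [t [p [q [tN pq colE clsE]]]] : exists t p q, [/\ (t <= 2 * n)%N, (p <= q)%N,
    forall i j, (col (rotate t i) == col (rotate t j)) = (cls p q i == cls p q j) &
    forall r, (r < 3)%N -> exists c, forall i, col (rotate t i) = c -> cls p q i = r].
  apply: linear_coloring rgb _ => c; have /mapP[i _ ->] := colors c.
  by exists i.
have [R0 [f [wt0 wtE]]] := universal_weights wt.
pose rot := @rotate (2 * n) t; pose inv := @rotate (2 * n) (2 * n - t).
have rotK : cancel inv rot by apply: rotateKr.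
have invK : cancel rot inv by apply: rotateK.
have inv_inj : injective inv := can_inj rotK.
pose node' := node \o rot; pose col' := col \o rot.
have node'_inj : injective node' by apply: node'_inj.
have planar' : planar_nodes_outer E node' by apply: planar_rotate.
have card_black' : #|[set i | is_black (node' i)]| = n.
  rewrite -[RHS]card_black -[RHS](card_imset _ inv_inj); apply: eq_card => i.
  rewrite [LHS]inE; apply/idP/imsetP => [ib|[j + ->]]; last by rewrite inE /node' /= rotK.
  by exists (rot i); rewrite ?invK ?inE.
have ZE (S S' : {set 'I_(2 * n)}) : (forall i, (i \in S') = (rot i \in S)) ->
    Ztri E node wt col S = f (Ztri E node' wt0 col' S').
  move=> h; rewrite -(Ztri_morph E node' wtE col' S').
  rewrite -(Ztri_rotate tN node_inj planar wt pq colE S); congr Ztri.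
  by apply/setP => i; rewrite inE -h.
have eq_inv k i : (k == inv i) = (rot k == i).
  by rewrite -[k in LHS]invK (inj_eq inv_inj).
have ZE2 i j : Ztri E node wt col (~: [set i; j]) =
    f (Ztri E node' wt0 col' (~: [set inv i; inv j])).
  by apply: ZE => k; rewrite !inE !eq_inv.
have ZE4 : Ztri E node wt col (~: [set x; y; w; v]) =
    f (Ztri E node' wt0 col' (~: [set inv x; inv y; inv w; inv v])).
  by apply: ZE => k; rewrite !inE !eq_inv.
have ZE0 : Ztri E node wt col [set: 'I_(2 * n)] = f (Ztri E node' wt0 col' [set: 'I_(2 * n)]).
  by apply: ZE => k; rewrite !inE.
have uniq4' : uniq [:: inv x; inv y; inv w; inv v].
  by rewrite -[X in uniq X]/(map inv [:: x; y; w; v]) map_inj_uniq.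
have colors' r : (r < 3)%N ->
    r \in [seq cls p q (i : 'I_(2 * n)) | i <- [:: inv x; inv y; inv w; inv v]].
  move=> r3; have [c cE] := clsE r r3; have /mapP[i ixy ce] := colors c.
  have ci : col (rotate t (inv i)) = c by rewrite -[rotate t _]/(rot (inv i)) rotK.
  rewrite -(cE _ ci); apply: (map_f (fun i : 'I_(2 * n) => cls p q i)).
  by rewrite -[X in _ \in X]/(map inv [:: x; y; w; v]) map_f.
have blackE i : is_black (node' (inv i)) = is_black (node i) by rewrite /node' /= rotK.
have cyc' : cyc_order4 (inv x) (inv y) (inv w) (inv v).
  have E1 (z : 'I_(2 * n)) : (z : nat) = (if (inv z + t < 2 * n)%N then inv z + t else inv z + t - 2 * n)%N.
    by rewrite -{1}(rotK z) rotateE.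
  move: (E1 x) (E1 y) (E1 w) (E1 v) cyc; rewrite /cyc_order4.
  move: (ltn_ord (inv x)) (ltn_ord (inv y)) (ltn_ord (inv w)) (ltn_ord (inv v)).
  move: (nat_of_ord (inv x)) (nat_of_ord (inv y)) (nat_of_ord (inv w)) (nat_of_ord (inv v)).
  move: (nat_of_ord x) (nat_of_ord y) (nat_of_ord w) (nat_of_ord v) tN; clear.
  move=> x y w v tN x' y' w' v' lx ly lw lv.
  by do 4![case: ssrnat.ltnP => ? ->]; lia.
rewrite ZE0 ZE4 !ZE2 -!rmorphM -rmorphD; congr (f _).
have main := linear_identity node'_inj card_black' planar' wt0 pq colE.
(* The linear case covers the positions of the cut with [y < w < v] after rotation; the other two
   reduce to it by exchanging (x, y) with (w, v), a symmetry of the identity. *)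
have [c|c] : ((inv x < inv y < inv w)%N && (inv w < inv v)%N ||
    (inv y < inv w < inv v)%N && (inv v < inv x)%N) \/
   ((inv w < inv v < inv x)%N && (inv x < inv y)%N ||
    (inv v < inv x < inv y)%N && (inv y < inv w)%N).
- by move: cyc'; rewrite /cyc_order4; clear; lia.
- by apply: main; rewrite ?blackE.
have -> : [set inv x; inv y; inv w; inv v] = [set inv w; inv v; inv x; inv y].
  by apply/setP => i; rewrite !inE; do 4![case: (i == _)].
have -> : [set inv x; inv v] = [set inv v; inv x] by rewrite setUC.
rewrite main ?blackE //.
- by rewrite mulrC; congr (_ + _)%R; rewrite mulrC [[set inv w; inv y]]setUC [[set inv x; inv v]]setUC.
- by move: uniq4'; rewrite /= !inE !negb_or ![inv w == _]eq_sym ![inv v == _]eq_sym; clear;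
    do 6![case: (_ == _)].
move=> r /colors'; rewrite /= !inE.
by do 4![case: (r == _)].
Qed.
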